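(* Let $\lambda>0$, let $(q_k)_{k\ge 1}$ be a probability mass function on the positive integers, and let $M(t)=\sum_{k=1}^{N_\lambda(t)}X_k$, $t\ge 0$, where $\{X_n:n\ge 1\}$ are i.i.d. with $P(X_1=k)=q_k$ and are independent of the Poisson process $N_\lambda(\cdot)$ of intensity $\lambda$. (i) If $\nu\in(0,1)$, set $M^\nu(t)=M(\mathcal{L}^\nu(t))$ and $p_k^\nu(t)=P(M^\nu(t)=k)$ for integers $k\ge 0$. Then, for $t>0$, $$\frac{d_C^\nu}{dt^\nu}p_0^\nu(t)=-\lambda p_0^\nu(t),\qquad \frac{d_C^\nu}{dt^\nu}p_k^\nu(t)=-\lambda p_k^\nu(t)+\lambda\sum_{i=1}^k q_i\,p_{k-i}^\nu(t)\quad\text{for all integers } k\ge 1,$$ with the initial conditions $p_0^\nu(0)=1$ and $p_k^\nu(0)=0$ for all integers $k\ge 1$. (ii) If $\nu\in(1,\infty)$, set $\hat M^\nu(t)=M(\mathcal{A}^{1/\nu}(t))$ and $\hat p_k^\nu(t)=P(\hat M^\nu(t)=k)$ for integers $k\ge 0$. Then, for $t>0$, $$\frac{d_{RL}^\nu}{dt^\nu}\hat p_0^\nu(t)=\lambda \hat p_0^\nu(t),\qquad \frac{d_{RL}^\nu}{dt^\nu}\hat p_k^\nu(t)=\lambda \hat p_k^\nu(t)-\lambda\sum_{i=1}^k q_i\,\hat p_{k-i}^\nu(t)\quad\text{for all integers } k\ge 1,$$ with the initial conditions $\hat p_0^\nu(0)=1$ and $\hat p_k^\nu(0)=0$ for all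 integers $k\ge 1$.
   Context: Fractional derivatives. For $\nu\in(0,1)$, $\frac{d_C^\nu}{dt^\nu}$ is the Caputo derivative $$\frac{d_C^\nu}{dt^\nu}f(t)=\frac{1}{\Gamma(1-\nu)}\int_0^t (t-s)^{-\nu}f'(s)\,ds.$$ For $\nu\in(1,\infty)$, $\frac{d_{RL}^\nu}{dt^\nu}$ is the right-sided Riemann-Liouville derivative on $\mathbb{R}_+$ $$\frac{d_{RL}^\nu}{dt^\nu}f(t)=\frac{1}{\Gamma(m-\nu)}\left(-\frac{d}{dt}\right)^m\int_t^\infty\frac{f(s)}{(s-t)^{\nu-m+1}}\,ds,\qquad m=\lfloor\nu\rfloor+1.$$ Stable subordinator and inverse. For $\alpha\in(0,1)$, $\mathcal{A}^\alpha(\cdot)$ is the stable subordinator: the L\'evy process started at $0$ with $\mathbb{E}[e^{-\theta\mathcal{A}^\alpha(t)}]=e^{-\theta^\alpha t}$ for $\theta\ge 0$. Its inverse is $\mathcal{L}^\alpha(t)=\inf\{z:\mathcal{A}^\alpha(z)>t\}$. The time-change processes $\mathcal{L}^\nu(\cdot)$ and $\mathcal{A}^{1/\nu}(\cdot)$ are independent of $N_\lambda(\cdot)$ and of $\{X_n\}$. An empty sum is $0$. *)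

(* Defs.v *)
From HB Require Import structures.
From mathcomp Require Import all_boot all_order all_algebra archimedean finmap.
From mathcomp Require Import all_classical all_reals all_analysis.

Set Implicit Arguments.
Unset Strict Implicit.
Unset Printing Implicit Defensive.

Import Order.TTheory GRing.Theory Num.Theory.
Import numFieldNormedType.Exports.

Local Open Scope classical_set_scope.
Local Open Scope ring_scope.

Section independence.
Context {d : measure_display} {T : measurableType d} {R : realType}.
Variable P : probability T R.

Definition independent_systems (F G : set_system T) : Prop :=
  forall A B, F A -> G B -> P (A `&` B) = (P A * P B)%E.

Definition mutually_independent {d'} {T' : measurableType d'} {I : choiceType}
    (D : set I) (Y : I -> T -> T') : Prop :=
  forall J : {fset I}, [set` J] `<=` D ->
  forall B : I -> set T', (forall i, measurable (B i)) ->
  P (\bigcap_(i in [set` J]) Y i @^-1` B i) =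
  (\prod_(i <- J) P (Y i @^-1` B i))%E.

End independence.

(* The sigma-algebra generated by the family (Y i) for i in D. *)
Definition sigma_family {T I : Type} {d'} {T' : measurableType d'}
    (D : set I) (Y : I -> T -> T') : set_system T :=
  <<s \bigcup_(i in D) preimage_set_system setT (Y i) measurable >>.

(* The sigma-algebra generated by two set systems. *)
Definition sigma_join {T : Type} (F G : set_system T) : set_system T :=
  <<s F `|` G >>.

Definition nonneg_times {R : realType} : set R := [set t | 0 <= t].

(* Processes are indexed by all of R, but only the times t >= 0 matter: every
   condition below is restricted to them.  The path conditions hold for every
   outcome (rather than almost every one), so that time-changed processes are
   random variables without completing the probability space. *)
Section processes.
Context {d : measure_display} {T : measurableType d} {R : realType}.
Variable P : probability T R.

Record levy_process (Y : R -> T -> R) : Prop := LevyProcess {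
  levy_measurable : forall t, 0 <= t -> measurable_fun setT (Y t) ;
  levy_start : forall w, Y 0 w = 0 ;
  levy_independent_increments : forall t : nat -> R,
    0 <= t 0%N -> {homo t : i j / (i <= j)%N >-> i <= j} ->
    mutually_independent P setT (fun i : nat => Y (t i.+1) \- Y (t i)) ;
  levy_stationary_increments : forall s t : R, 0 <= s -> 0 <= t ->
    forall B : set R, measurable B ->
    P ((Y (s + t) \- Y s) @^-1` B) = P (Y t @^-1` B) ;
  levy_right_continuous : forall w (t : R), 0 <= t ->
    Y s w @[s --> t^'+] --> Y t w ;
  levy_left_limits : forall w (t : R), 0 < t ->
    cvg (Y s w @[s --> t^'-]) }.

Record poisson_process (lambda : R) (N : R -> T -> nat) : Prop :=
  PoissonProcess {
  poisson_levy : levy_process (fun t w => (N t w)%:R) ;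
  poisson_law : forall t : R, 0 < t -> forall k : nat,
    P (N t @^-1` [set k]) = (poisson_pmf (lambda * t) k)%:E }.

Record stable_subordinator (alpha : R) (A : R -> T -> R) : Prop :=
  StableSubordinator {
  stable_levy : levy_process A ;
  stable_nondecreasing : forall w (s t : R),
    0 <= s -> s <= t -> A s w <= A t w ;
  stable_laplace : forall theta t : R, 0 <= theta -> 0 <= t ->
    ('E_P[(fun w => expR (- theta * A t w))%R] =
     (expR (- (theta `^ alpha) * t))%R%:E)%E }.

End processes.

Definition inverse_subordinator {T : Type} {R : realType} (A : R -> T -> R)
  (t : R) (w : T) : R := inf [set z | 0 <= z /\ t < A z w].

Definition positive_pmf {R : realType} (q : nat -> R) : Prop :=
  (forall k, (1 <= k)%N -> 0 <= q k) /\
  (\sum_(1 <= k <oo) (q k)%:E = 1)%E.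

(* Only X 1, X 2, ... are used. *)
Definition compound_process {T : Type} {R : realType} (N : R -> T -> nat)
  (X : nat -> T -> nat) (t : R) (w : T) : nat :=
  (\sum_(1 <= k < (N t w).+1) X k w)%N.

Definition state_prob {d} {T : measurableType d} {R : realType}
  (P : probability T R) (Z : R -> T -> nat) (k : nat) (t : R) : R :=
  fine (P (Z t @^-1` [set k])).

Section fractional_derivatives.
Context {R : realType}.
Notation mu := (@lebesgue_measure R).

Definition Gamma (x : R) : R :=
  \int[mu]_(t in `]0, +oo[) (t `^ (x - 1) * expR (- t)).

Definition caputo_derive (nu : R) (f : R -> R) (t : R) : R :=
  (Gamma (1 - nu))^-1 * \int[mu]_(s in `]0, t[) ((t - s) `^ (- nu) * derive1 f s).

(* As derivatives and integrals are total functions, the existence of the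
   fractional derivative is stated separately, as in is_derive. *)
Definition is_caputo_derive (nu : R) (f : R -> R) (t l : R) : Prop :=
  [/\ forall s, 0 < s < t -> derivable f s 1,
      mu.-integrable `]0, t[ (fun s => ((t - s) `^ (- nu) * derive1 f s)%:E) &
      caputo_derive nu f t = l].

(* m = floor nu + 1, as Num.truncn is the floor of a nonnegative number. *)
Definition rl_order (nu : R) : nat := (Num.truncn nu).+1.

Definition rl_kernel (nu : R) (f : R -> R) (t s : R) : R :=
  f s / (s - t) `^ (nu - (rl_order nu)%:R + 1).

Definition rl_integral (nu : R) (f : R -> R) (t : R) : R :=
  \int[mu]_(s in `]t, +oo[) rl_kernel nu f t s.

Definition rl_derive (nu : R) (f : R -> R) (t : R) : R :=
  (Gamma ((rl_order nu)%:R - nu))^-1 *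
  ((-1) ^+ rl_order nu * derive1n (rl_order nu) (rl_integral nu f) t).

Definition is_rl_derive (nu : R) (f : R -> R) (t l : R) : Prop :=
  [/\ \forall u \near t,
        mu.-integrable `]u, +oo[ (fun s => (rl_kernel nu f u s)%:E),
      forall n, (n < rl_order nu)%N ->
        \forall u \near t, derivable (derive1n n (rl_integral nu f)) u 1 &
      rl_derive nu f t = l].

End fractional_derivatives.

(* Main.v *)
(* Conditioning on the random time [tau] (either [L t] or [A t]) writes
   [p_k] as the combination, over [n <= k], of the mixed Poisson weights
   [f_n = E ((lambda tau)^n / n! exp (- lambda tau))], with coefficients the
   convolution powers of [q].  Both systems then follow from the fractional
   derivative of [f_n] being, up to sign, [lambda (f_n - f_(n-1))].

   For the Riemann-Liouville derivative, [\sum_n h^n f_n] is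
   [exp (- (lambda (1 - h))^(1/nu) t)], on which the derivative acts as the
   multiplication by [lambda (1 - h)]; coefficients in [h] are compared.

   For the Caputo derivative, [L t] has the law of [t^nu W] where
   [W = (A 1)^(-nu)].  Differentiating the Laplace transform of [A 1] shows
   that its size-biased law is a convolution with [r^(-nu)], which after a
   change of variable reads
     [\int_0^t (t - s)^(-nu) nu s^(nu - 1) E (W g (s^nu W)) ds
        = Gamma (1 - nu) E (g (t^nu W))];
   it remains to take for [g] the derivative of a Poisson weight. *)

Require Import Defs.
From HB Require Import structures.
From mathcomp Require Import all_boot all_order all_algebra archimedean finmap.
From mathcomp Require Import all_classical all_reals measurable_realfun all_analysis.
Set Implicit Arguments.
Unset Strict Implicit.
Unset Printing Implicit Defensive.
Import Order.TTheory GRing.Theory Num.Theory.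
Import numFieldNormedType.Exports.
From mathcomp Require Import ring lra zify.
Local Open Scope classical_set_scope.
Local Open Scope ring_scope.

(** * Uniqueness of Laplace transforms *)

(** Laplace transforms are available only at real [th >= 0], and neither densities nor moments of
    the stable variable are given. Uniqueness is therefore obtained by real means: on nonnegative
    reals the indicator of a half-line is a bounded pointwise limit of polynomials in
    [exp (- th x)]. It is stated for weighted, unnormalised laws, since a size-biased law has to be
    compared with a measure on the product with a half-line.

    Comparing coefficients in [h] never differentiates a series term by term. With [m = rl_order nu]
    and [r = (lambda (1 - h))^(1/nu)], the identity [r^(nu - m) = r^(-m) lambda (1 - h)] shows that
    the fractional integral of [f_n] is, up to a constant, the [m]-fold tail integral of
    [f_n - f_(n-1)]; all terms are nonnegative, Tonelli suffices, and [m] ordinary derivatives undo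
    the tail integrals.

    In the Caputo case the derivative of a weight changes sign and blows up like [s^(nu - 1)] at 0.
    The integral identity is proved for nonnegative [g], applied to two Poisson weights separately,
    and also yields the finiteness of [E W]. *)

Section weighted_law.
Context d (T : measurableType d) (R : realType).
Variable m : {measure set T -> \bar R}.
Variables (w : T -> R) (mw : measurable_fun setT w) (w_ge0 : forall x, 0 <= w x).
Variables (X : T -> R) (mX : measurable_fun setT X).

(** The law of [X] under the measure of density [w]. The weight lets a size-biased law and a density
    on a product space be handled as plain laws are. *)
Definition weighted_law (B : set R) : \bar R := \int[m]_(x in X @^-1` B) (w x)%:E.

Let weighted_law0 : weighted_law set0 = 0%E.
Proof. by rewrite /weighted_law preimage_set0 integral_set0. Qed.

Let weighted_law_ge0 B : (0 <= weighted_law B)%E.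
Proof. by apply: integral_ge0 => x _; rewrite lee_fin. Qed.

Let weighted_law_sigma_additive : semi_sigma_additive weighted_law.
Proof.
move=> F mF tF mUF; rewrite /weighted_law preimage_bigcup ge0_integral_bigcup//=.
- by apply: is_cvg_ereal_nneg_natsum_cond => n _ _; exact: weighted_law_ge0.
- by move=> k; rewrite -[X in measurable X]setTI; exact: mX.
- by apply: (measurable_funS measurableT) => //; exact/measurable_EFinP.
- by move=> x _; rewrite lee_fin.
- move=> i j _ _ [x [Fi Fj]]; by apply: (tF i j) => //; exists (X x).
Qed.

HB.instance Definition _ := isMeasure.Build _ _ _ weighted_law
  weighted_law0 weighted_law_ge0 weighted_law_sigma_additive.

Definition weighted_measure : {measure set R -> \bar R} :=
  [the {measure set R -> \bar R} of weighted_law].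

End weighted_law.

(** [G (X x)] is the length of the set of [r] with [0 < r < G (X x)]; Tonelli, hence the
    sigma-finiteness, exchanges the two integrals. Equality of integrals is thereby reduced to
    equality of laws on sets. *)
Lemma integral_layer_cake d (T : measurableType d) (R : realType)
  (m : {sigma_finite_measure set T -> \bar R}) (w X : T -> R) (G : R -> R) :
  measurable_fun setT w -> (forall x, 0 <= w x) -> measurable_fun setT X ->
  measurable_fun setT G -> (forall x, 0 <= G x) ->
  (\int[m]_x (w x * G (X x))%:E =
   \int[@lebesgue_measure R]_r weighted_law m w X [set y | 0 < r < G y]%R)%E.
Proof.
move=> mw w_ge0 mX mG G_ge0.
pose S := [set p : T * R | 0 < p.2 < G (X p.1)].
have mS : measurable S.
  have mb : measurable_fun setT (fun p : T * R => (0 < p.2) && (p.2 < G (X p.1))).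
    apply: measurable_and; apply: measurable_fun_ltr => //.
    apply: measurableT_comp => //; exact: measurableT_comp.
  by rewrite (_ : S = setT `&` (fun p : T * R => (0 < p.2) && (p.2 < G (X p.1))) @^-1` [set true]);
    [exact: mb|rewrite setTI].
pose f (p : T * R) : \bar R := (w p.1 * \1_S p)%:E.
have mf : measurable_fun setT f.
  apply/measurable_EFinP; apply: measurable_funM; last exact: measurable_indic.
  exact: measurableT_comp.
have f_ge0 p : (0 <= f p)%E by rewrite lee_fin mulr_ge0.
transitivity (\int[m]_x \int[@lebesgue_measure R]_r f (x, r))%E.
  apply: eq_integral => x _; rewrite /f/=.
  have mSx : measurable [set r : R | 0 < r < G (X x)] by rewrite -set_itvoo.
  have -> : (fun r : R => (w x * \1_S (x, r))%:E) =
     (fun r => (w x)%:E * (\1_[set r : R | 0 < r < G (X x)] r)%:E)%E.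
    by apply/funext => r; rewrite -EFinM !indicE; congr (_ * _)%:E; congr (nat_of_bool _)%:R; apply/idP/idP; rewrite !inE.
  rewrite ge0_integralZl_EFin//; last exact/measurable_EFinP/measurable_indic.
  rewrite integral_indic// setIT.
  rewrite EFinM; congr (_ * _)%E; rewrite -set_itvoo.
  transitivity (lebesgue_measure (`]0, G (X x)[%classic : set R)) => //.
  rewrite lebesgue_measure_itv/= lte_fin; have := G_ge0 (X x).
  by rewrite le_eqVlt => /predU1P[<-|->]; rewrite ?ltxx// oppr0 adde0.
rewrite fubini_tonelli//; apply: eq_integral => r _.
rewrite /weighted_law integral_mkcond; apply: eq_integral => x _.
rewrite /f /patch/= indicE.
have -> : ((x, r) \in S) = (x \in X @^-1` [set y | 0 < r < G y]).
  by apply/idP/idP; rewrite !inE.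
by case: ifPn => _; rewrite ?mulr1 ?mulr0.
Qed.

(** * Half-line indicators as limits of polynomials in an exponential *)

Section tail_indicator_limit.
Variable R : realType.
Implicit Types x c : R.

Lemma cvg_expRNn x : 0 < x -> expR (- (n%:R * x)) @[n --> \oo] --> (0 : R).
Proof.
move=> x0; under eq_fun do rewrite -mulrN expRM_natl.
by apply: cvg_expr; rewrite ger0_norm ?expR_ge0// expR_lt1 oppr_lt0.
Qed.

Lemma cvg_subr_expRNn x : 0 < x ->
  1 - expR (- (n%:R * x)) @[n --> \oo] --> (1 : R).
Proof.
move=> x0; rewrite -[X in _ --> X](subr0 1).
by apply: cvgB; [exact: cvg_cst|exact: cvg_expRNn].
Qed.

(** With [y = x / 2], one factor [exp (- n y)] absorbs [n] through [n y <= exp (n y)], and the other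
    still tends to 0. *)
Lemma cvg_mul_expRNn x : 0 < x ->
  n%:R * expR (- (n%:R * x)) @[n --> \oo] --> (0 : R).
Proof.
move=> x0; have y0 : 0 < x / 2 by rewrite divr_gt0.
apply: (@squeeze_cvgr _ _ _ _ (cst 0)
  (fun n : nat => (x / 2)^-1 * expR (- (n%:R * (x / 2))))).
- near=> n; rewrite mulr_ge0 ?ler0n ?expR_ge0//=.
  have -> : - (n%:R * x) = - (n%:R * (x / 2)) - (n%:R * (x / 2)).
    by rewrite -opprD -mulrDr -splitr.
  rewrite expRD mulrA ler_wpM2r ?expR_ge0//.
  rewrite expRN ler_pdivrMr ?expR_gt0// mulrC ler_pdivlMr//.
  by apply: le_trans (expR_ge1Dx _); rewrite lerDr.
- exact: cvg_cst.
- rewrite -[X in _ --> X](mulr0 (x / 2)^-1).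
  by apply: cvgM; [exact: cvg_cst|exact: cvg_expRNn].
Unshelve. all: by end_near. Qed.

Lemma bernoulli_exprB x n : 0 <= x <= 1 -> 1 - n%:R * x <= (1 - x) ^+ n.
Proof.
move=> /andP[x0 x1]; elim: n => [|n IH]; first by rewrite mul0r subr0 expr0.
rewrite exprS; apply: (@le_trans _ _ ((1 - x) * (1 - n%:R * x))); last first.
  by rewrite ler_wpM2l// subr_ge0.
rewrite -natr1 -subr_ge0 (_ : _ - _ = n%:R * x ^+ 2); last by ring.
by rewrite mulr_ge0 ?sqr_ge0.
Qed.

(** A polynomial in [exp (- th x)] with [th = n ln 2 / c], so that its integral is a combination of
    values of the Laplace transform. *)
Definition tail_approx c n x : R :=
  (1 - expR (- (n%:R * (ln 2 / c)) * x)) ^+ (n * 2 ^ n).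

(* With [u = 2^(-x/c)], this is [(1 - u^n)^(n 2^n)], and [2^n u^n] tends to 0
   exponentially fast when [x > c], but is at least 1 when [x <= c]. *)
Lemma cvg_tail_approx c x : 0 < c -> 0 <= x ->
  tail_approx c n x @[n --> \oo] --> (\1_(`]c, +oo[%classic) x : R).
Proof.
move=> c0 x0; rewrite indicE /tail_approx.
have l2 : 0 < ln 2 :> R by rewrite ln_gt0// ltr1n.
have E n : - (n%:R * (ln 2 / c)) * x = - (n%:R * (ln 2 * (x / c))) by ring.
under eq_fun do rewrite E.
have u01 n : 0 <= expR (- (n%:R * (ln 2 * (x / c)))) <= 1.
  rewrite expR_ge0 expR_le1 oppr_le0 mulr_ge0//.
  by apply: mulr_ge0; [exact: ltW|apply: divr_ge0 => //; exact: ltW].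
case: (ltP c x) => cx.
- rewrite mem_set /= ?in_itv/= ?cx//.
  apply: (@squeeze_cvgr _ _ _ _
    (fun n : nat => 1 - n%:R * expR (- (n%:R * (ln 2 * (x / c - 1))))) (cst 1)).
  + near=> n; apply/andP; split; last first.
      by apply: exprn_ile1; have /andP[? ?] := u01 n; rewrite ?subr_ge0 ?lerBlDr ?lerDl.
    apply: le_trans (bernoulli_exprB _ (u01 n)).
    rewrite lerD2l lerN2 natrM -mulrA ler_wpM2l//.
    rewrite natrX -[X in X ^+ n](@lnK R) ?posrE// -expRM_natl -expRD.
    by rewrite ler_expR le_eqVlt; apply/orP; left; apply/eqP; ring.
  + rewrite -[X in _ --> X](subr0 1); apply: cvgB; first exact: cvg_cst.
    by apply: cvg_mul_expRNn; rewrite mulr_gt0// subr_gt0 ltr_pdivlMr// mul1r.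
  + exact: cvg_cst.
- rewrite memNset /= ?in_itv/= ?andbT; last by apply/negP; rewrite -leNgt.
  apply: (@squeeze_cvgr _ _ _ _ (cst 0) (fun n : nat => expR (- (n%:R * 1)))).
  + near=> n; have /andP[? ?] := u01 n; rewrite exprn_ge0 ?subr_ge0//=.
    (* The bound [1 - u <= exp (- u)] turns the power into the exponential of [- n] times a factor
       that is at least 1. *)
    apply: (@le_trans _ _ (expR (- expR (- (n%:R * (ln 2 * (x / c))))) ^+ (n * 2 ^ n))).
      by rewrite lerXn2r ?nnegrE ?subr_ge0 ?expR_ge0//; exact: expR_ge1Dx.
    rewrite -expRM_natl ler_expR mulrN lerN2 mulr1 natrM -mulrA ler_peMr//.
    rewrite natrX -[X in X ^+ n](@lnK R) ?posrE// -expRM_natl -expRD.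
    rewrite -[leLHS]expR0 ler_expR -mulrBr mulr_ge0// -[X in X - _]mulr1 -mulrBr.
    by apply: mulr_ge0; [exact: ltW|rewrite subr_ge0 ler_pdivrMr// mul1r].
  + exact: cvg_cst.
  + by apply: cvg_expRNn.
Unshelve. all: by end_near. Qed.

End tail_indicator_limit.

Section laplace_uniqueness.
Context d1 d2 (T1 : measurableType d1) (T2 : measurableType d2) (R : realType).
Variables (m1 : {measure set T1 -> \bar R}) (m2 : {measure set T2 -> \bar R}).
Variables (w1 X1 : T1 -> R) (w2 X2 : T2 -> R).
Hypotheses (mw1 : measurable_fun setT w1) (mw2 : measurable_fun setT w2).
Hypotheses (w1_ge0 : forall x, 0 <= w1 x) (w2_ge0 : forall x, 0 <= w2 x).
Hypotheses (mX1 : measurable_fun setT X1) (mX2 : measurable_fun setT X2).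
Hypotheses (X1_ge0 : forall x, 0 <= X1 x) (X2_ge0 : forall x, 0 <= X2 x).
Hypotheses (iw1 : m1.-integrable setT (EFin \o w1)).
Hypotheses (iw2 : m2.-integrable setT (EFin \o w2)).
Hypothesis laplace_eq : forall th, 0 <= th ->
  (\int[m1]_x (w1 x * expR (- th * X1 x))%:E =
   \int[m2]_x (w2 x * expR (- th * X2 x))%:E)%E.

Let test (phi : R -> R) :=
  measurable_fun setT phi /\ forall x, 0 <= x -> `|phi x| <= 1.

Let agree (phi : R -> R) :=
  (\int[m1]_x (w1 x * phi (X1 x))%:E = \int[m2]_x (w2 x * phi (X2 x))%:E)%E.

Let test_integrable d (T : measurableType d) (m : {measure set T -> \bar R})
    (w X : T -> R) (phi : R -> R) : measurable_fun setT w ->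
  measurable_fun setT X -> (forall x, 0 <= X x) ->
  m.-integrable setT (EFin \o w) -> test phi ->
  m.-integrable setT (EFin \o (fun x => w x * phi (X x))).
Proof.
move=> mw mX X0 iw [mphi phi1]; apply: le_integrable iw => //.
- apply/measurable_EFinP; apply: measurable_funM => //.
  exact: measurableT_comp.
- by move=> x _ /=; rewrite lee_fin normrM ler_piMr// phi1.
Qed.

Let agreeB phi psi : test phi -> test psi -> agree phi -> agree psi ->
  agree (fun x => phi x - psi x).
Proof.
move=> tphi tpsi ephi epsi; rewrite /agree.
under eq_integral do rewrite mulrBr EFinB.
under [RHS]eq_integral do rewrite mulrBr EFinB.
by rewrite !integralB_EFin// ?ephi ?epsi//; exact: test_integrable.
Qed.

(** Dominated convergence on both sides, the integrable weight itself being the bound. *)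
Let agree_lim (f : nat -> R -> R) phi : (forall n, test (f n)) -> test phi ->
  (forall n, agree (f n)) -> (forall x, 0 <= x -> f n x @[n --> \oo] --> phi x) ->
  agree phi.
Proof.
move=> tf tphi ef fphi.
have cvg_int d (T : measurableType d) (m : {measure set T -> \bar R}) (w X : T -> R) :
    measurable_fun setT w -> (forall x, 0 <= w x) ->
    measurable_fun setT X -> (forall x, 0 <= X x) ->
    m.-integrable setT (EFin \o w) ->
    (\int[m]_x (w x * f n (X x))%:E)%E @[n --> \oo] --> (\int[m]_x (w x * phi (X x))%:E)%E.
  move=> mw w0 mX X0 iw.
  apply: (@dominated_cvg _ _ _ m setT measurableT
    (fun n x => (w x * f n (X x))%:E) _ (EFin \o w)) => //.
  - by move=> n; apply: measurable_int (test_integrable mw mX X0 iw (tf n)).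
  - move=> x _; apply: cvg_EFin; first exact: nearW.
    by apply: cvgM; [exact: cvg_cst|exact: fphi].
  - move=> n x _ /=; rewrite lee_fin normrM (ger0_norm (w0 x)).
    by rewrite ler_piMr// (tf n).2.
have c1 := cvg_int _ _ m1 w1 X1 mw1 w1_ge0 mX1 X1_ge0 iw1.
have c2 := cvg_int _ _ m2 w2 X2 mw2 w2_ge0 mX2 X2_ge0 iw2.
move: c1; rewrite (_ : (fun n => _) = (fun n => \int[m2]_x (w2 x * f n (X2 x))%:E))%E.
  by move=> c1; exact: cvg_unique c1 c2.
by apply/funext => n; exact: ef.
Qed.

Let poly_exp th0 th n x : R := expR (- th0 * x) * (1 - expR (- th * x)) ^+ n.

Let test_poly_exp th0 th n : 0 <= th0 -> 0 <= th -> test (poly_exp th0 th n).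
Proof.
move=> th00 th_0; split.
  by apply: measurable_funM; [|apply: measurable_funX; apply: measurable_funB => //];
    apply: measurableT_comp => //; exact: measurable_funM.
move=> x x0; rewrite normrM !ger0_norm ?expR_ge0 ?exprn_ge0 ?subr_ge0//;
  rewrite ?expR_le1 ?mulNr ?oppr_le0 ?mulr_ge0//.
rewrite mulr_ile1 ?expR_ge0 ?exprn_ge0 ?exprn_ile1 ?subr_ge0 ?lerBlDr ?lerDl ?expR_ge0//;
  by rewrite ?expR_le1 ?mulNr ?oppr_le0 ?mulr_ge0.
Qed.

(** One factor [1 - exp (- th x)] splits off as the difference of the degree [n] expressions at
    [th0] and [th0 + th]; hence the induction leaves [th0] free. *)
Let agree_poly_exp th n : 0 <= th -> forall th0, 0 <= th0 -> agree (poly_exp th0 th n).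
Proof.
move=> th_0; elim: n => [|n IH] th0 th00.
  rewrite /agree /poly_exp; under eq_integral do rewrite expr0 mulr1.
  by under [RHS]eq_integral do rewrite expr0 mulr1; exact: laplace_eq.
rewrite (_ : poly_exp _ _ _ = (fun x => poly_exp th0 th n x - poly_exp (th0 + th) th n x)).
  by apply: agreeB; [exact: test_poly_exp|apply: test_poly_exp; rewrite ?addr_ge0|
    exact: IH|apply: IH; rewrite addr_ge0].
apply/funext => x; rewrite /poly_exp opprD mulrDl expRD exprS.
by ring.
Qed.

Let test_indic (A : set R) : measurable A -> test (\1_A : R -> R).
Proof.
by move=> mA; split => [|x _]; [exact: measurable_indic|
  rewrite indicE ger0_norm// lern1; case: (_ \in _)].
Qed.

(** For [c < 0] the indicator is 1 on nonnegative reals, which is the Laplace transform at 0. At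
    [c = 0], where [tail_approx] would divide by 0, the limit of [1 - exp (- n x)] serves
    instead. *)
Let agree_tail c : agree (\1_(`]c, +oo[%classic) : R -> R).
Proof.
have [c0|] := ltP c 0.
  rewrite /agree.
  have E x : 0 <= x -> \1_(`]c, +oo[%classic) x = expR (- 0 * x) :> R.
    move=> x0; rewrite indicE mem_set ?oppr0 ?mul0r ?expR0//= in_itv/= andbT.
    exact: lt_le_trans x0.
  under eq_integral do rewrite E//.
  by under [RHS]eq_integral do rewrite E//; exact: laplace_eq.
rewrite le_eqVlt => /predU1P[<-|c0].
  apply: (@agree_lim (fun n => poly_exp 0 n%:R 1)).
  - by move=> n; exact: test_poly_exp.
  - exact: test_indic.
  - by move=> n; exact: agree_poly_exp.
  - move=> x; rewrite /poly_exp indicE oppr0.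
    under eq_fun do rewrite mul0r expR0 mul1r expr1 mulNr.
    rewrite le_eqVlt => /predU1P[<-|x0].
      rewrite memNset/= ?in_itv/= ?ltxx//.
      by under eq_fun do rewrite mulr0 oppr0 expR0 subrr; exact: cvg_cst.
    rewrite mem_set/= ?in_itv/= ?x0//.
    exact: cvg_subr_expRNn.
have th0 n : 0 <= n%:R * (ln 2 / c) by rewrite mulr_ge0// divr_ge0 ?ln_ge0 ?ler1n// ltW.
have E : tail_approx c = fun n => poly_exp 0 (n%:R * (ln 2 / c)) (n * 2 ^ n).
  by apply/funext => n; apply/funext => x; rewrite /poly_exp oppr0 mul0r expR0 mul1r.
apply: (@agree_lim (tail_approx c)).
- by move=> n; rewrite E; exact: test_poly_exp.
- exact: test_indic.
- by move=> n; rewrite E; exact: agree_poly_exp.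
- by move=> x; exact: cvg_tail_approx.
Qed.

(** The rays []c, +oo[] are stable under intersection and generate the Borel sets; the rays from
    [- n] exhaust the line and have finite mass because the weight is integrable. *)
Lemma weighted_law_laplace_unique B : measurable B ->
  weighted_law m1 w1 X1 B = weighted_law m2 w2 X2 B.
Proof.
have indicL d (T : measurableType d) (m : {measure set T -> \bar R}) (w X : T -> R) A :
    weighted_law m w X A = (\int[m]_x (w x * \1_A (X x))%:E)%E.
  rewrite /weighted_law integral_mkcond; apply: eq_integral => x _.
  rewrite /patch indicE; have -> : (X x \in A) = (x \in X @^-1` A).
    by apply/idP/idP; rewrite !inE.
  by case: ifPn; rewrite ?mulr1 ?mulr0.
move=> mB.
rewrite -[LHS]/(weighted_measure m1 mw1 w1_ge0 mX1 B).
rewrite -[RHS]/(weighted_measure m2 mw2 w2_ge0 mX2 B).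
apply: (@measure_unique _ R _ (@RGenOInfty.G R) (fun n : nat => `]- n%:R, +oo[%classic)) => //.
- exact: RGenOInfty.measurableE.
- move=> _ _ [x ->] [y ->]; exists (Num.max x y); apply/seteqP.
  by split => z /=; rewrite !in_itv/= !andbT gt_max => /andP.
- by move=> n; exists (- n%:R).
- apply/seteqP; split => // x _; exists (Num.truncn `|x|).+1 => //=.
  rewrite in_itv/= andbT ltrNl; apply: le_lt_trans (truncnS_gt _).
  by rewrite -normrN ler_norm.
- by move=> _ [x ->] /=; rewrite !indicL; exact: agree_tail.
- move=> n /=; apply: (@le_lt_trans _ _ (\int[m1]_x (w1 x)%:E)%E).
    apply: ge0_subset_integral => //; last by move=> ? _; rewrite lee_fin.
    + by rewrite -[X in measurable X]setTI; exact: mX1.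
    + exact/measurable_EFinP.
  have /integrableP[_] := iw1; apply: le_lt_trans.
  by rewrite [leRHS](_ : _ = \int[m1]_x (w1 x)%:E)%E//; apply: eq_integral => x _ /=; rewrite ger0_norm.
Qed.

End laplace_uniqueness.

(* The weighted laws being equal, the layer-cake formula transfers the
   equality to integrals of arbitrary nonnegative functions. *)
Lemma laplace_unique_integral d1 d2 (T1 : measurableType d1)
    (T2 : measurableType d2) (R : realType)
    (m1 : {sigma_finite_measure set T1 -> \bar R})
    (m2 : {sigma_finite_measure set T2 -> \bar R})
    (w1 X1 : T1 -> R) (w2 X2 : T2 -> R) (G : R -> R) :
  measurable_fun setT w1 -> measurable_fun setT w2 ->
  (forall x, 0 <= w1 x) -> (forall x, 0 <= w2 x) ->
  measurable_fun setT X1 -> measurable_fun setT X2 ->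
  (forall x, 0 <= X1 x) -> (forall x, 0 <= X2 x) ->
  m1.-integrable setT (EFin \o w1) -> m2.-integrable setT (EFin \o w2) ->
  (forall th, 0 <= th -> (\int[m1]_x (w1 x * expR (- th * X1 x))%:E =
                          \int[m2]_x (w2 x * expR (- th * X2 x))%:E)%E) ->
  measurable_fun setT G -> (forall x, 0 <= G x) ->
  (\int[m1]_x (w1 x * G (X1 x))%:E = \int[m2]_x (w2 x * G (X2 x))%:E)%E.
Proof.
move=> mw1 mw2 w1_ge0 w2_ge0 mX1 mX2 X1_ge0 X2_ge0 iw1 iw2 L mG G_ge0.
rewrite !integral_layer_cake//; apply: eq_integral => r _.
apply: weighted_law_laplace_unique => //.
have -> : [set y | 0 < r < G y] = setT `&` (fun y => (0 < r) && (r < G y)) @^-1` [set true].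
  by rewrite setTI.
suff : measurable_fun setT (fun y => (0 < r) && (r < G y)) by exact.
by apply: measurable_and => //; exact: measurable_fun_ltr.
Qed.

(** * Substitution on the half-line and the Gamma function *)

(* The library's substitution rules need continuity on closed intervals;
   exhausting by compact intervals extends them to integrands that are singular
   at the end points. *)
Section substitution_exhaustion.
Variable R : realType.
Notation mu := (@lebesgue_measure R).
Variables (F f G : R -> R) (x y : nat -> R).
Hypotheses (xy : forall n, x n <= y n)
  (dec_x : forall m n, (m <= n)%N -> x n <= x m)
  (inc_y : forall m n, (m <= n)%N -> y m <= y n).
Hypotheses (dF : forall n z, x n <= z <= y n -> is_derive z 1 F (f z))
  (cf : forall n z, x n <= z <= y n -> {for z, continuous f}).

Let cF n z : x n <= z <= y n -> {for z, continuous F}.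
Proof. by move=> /dF[? _]; apply: differentiable_continuous; exact/derivable1_diffP. Qed.

Let F'E n z : x n <= z <= y n -> derive1 F z = f z.
Proof. by move=> /dF ?; rewrite derive1E derive_val. Qed.

Let within_cvg_right (h : R -> R) a : {for a, continuous h} -> h z @[z --> a^'+] --> h a.
Proof. exact: cvg_at_right_filter. Qed.

Let within_cvg_left (h : R -> R) a : {for a, continuous h} -> h z @[z --> a^'-] --> h a.
Proof. exact: cvg_at_left_filter. Qed.

Let xx n : x n <= x n <= y n. Proof. by rewrite lexx xy. Qed.
Let yy n : x n <= y n <= y n. Proof. by rewrite lexx xy. Qed.

Let derF n : derivable_oo_LRcontinuous F (x n) (y n).
Proof.
split.
- by move=> z; rewrite in_itv/= => /andP[xz zy]; have [] := @dF n z _; rewrite // !ltW.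
- by apply: within_cvg_right; apply: (@cF n).
- by apply: within_cvg_left; apply: (@cF n).
Qed.

Let F'_near n z : x n < z < y n -> \forall u \near z, derive1 F u = f u.
Proof.
move=> zxy; near=> u; apply: (@F'E n).
have : u \in `]x n, y n[ by near: u; apply: near_in_itvoo; rewrite in_itv.
by rewrite in_itv/= => /andP[? ?]; rewrite !ltW.
Unshelve. all: by end_near. Qed.

Let cF' n : {in `](x n), (y n)[, continuous (derive1 F)}.
Proof.
move=> z; rewrite in_itv/= => zxy; have zxy' : x n <= z <= y n.
  by case/andP: zxy => ? ?; rewrite !ltW.
rewrite /continuous_at (F'E zxy').
have := @cf n z zxy'; apply: cvg_trans; apply: near_eq_cvg.
by have := F'_near zxy; apply: filterS => u /= ->.
Qed.

Let cvgF'x n : x n < y n -> cvg ((derive1 F) z @[z --> (x n)^'+]).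
Proof.
move=> lt; apply/cvg_ex; exists (f (x n)).
have := within_cvg_right (@cf n _ (xx n)); apply: cvg_trans; apply: near_eq_cvg.
near=> u; apply/esym/(@F'E n); apply/andP; split; apply: ltW => //.
Unshelve. all: by end_near. Qed.

Let cvgF'y n : x n < y n -> cvg ((derive1 F) z @[z --> (y n)^'-]).
Proof.
move=> lt; apply/cvg_ex; exists (f (y n)).
have := within_cvg_left (@cf n _ (yy n)); apply: cvg_trans; apply: near_eq_cvg.
near=> u; apply/esym/(@F'E n); apply/andP; split; apply: ltW => //.
Unshelve. all: by end_near. Qed.

Let nd_xy : {homo (fun n => `[x n, y n]%classic) : n m / (n <= m)%N >-> (n <= m)%O}.
Proof.
move=> m n mn; apply/subsetPset => z /=; rewrite !in_itv/= => /andP[xz zy].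
by rewrite (le_trans (dec_x mn)) ?(le_trans zy) ?inc_y.
Qed.

Let integral_cvg_bigcup (h : R -> R) (u v : nat -> R) :
  {homo (fun n => `[u n, v n]%classic) : n m / (n <= m)%N >-> (n <= m)%O} ->
  (forall n z, u n <= z <= v n -> {for z, continuous h}) ->
  (forall n z, u n <= z <= v n -> 0 <= h z) ->
  (\int[mu]_(z in `[u n, v n]) (h z)%:E)%E @[n --> \oo] -->
  (\int[mu]_(z in \bigcup_n `[u n, v n]%classic) (h z)%:E)%E.
Proof.
move=> nd ch h0; apply: ge0_nondecreasing_set_cvg_integral => //.
move=> n; apply/measurable_EFinP.
apply: subspace_continuous_measurable_fun => //.
by apply: continuous_in_subspaceT => z /set_mem/=; rewrite in_itv; exact: ch.
Qed.

Lemma decreasing_ge0_substitution :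
  (forall n, {in `[x n, y n] &, {homo F : a b /~ a < b}}) ->
  (forall n z, x n <= z <= y n -> f z <= 0) ->
  (forall n z, F (y n) <= z <= F (x n) -> {for z, continuous G}) ->
  (forall n z, F (y n) <= z <= F (x n) -> 0 <= G z) ->
  (\int[mu]_(z in \bigcup_n `[F (y n), F (x n)]%classic) (G z)%:E =
   \int[mu]_(z in \bigcup_n `[x n, y n]%classic) (G (F z) * - f z)%:E)%E.
Proof.
move=> homoF f0 cG G0.
have mono n a b : x n <= a <= y n -> x n <= b <= y n -> a <= b -> F b <= F a.
  move=> an bn; rewrite le_eqVlt => /predU1P[->//|ab]; apply: ltW.
  by apply: (homoF n).
have FE n z : x n <= z <= y n -> F (y n) <= F z <= F (x n).
  by move=> zn; have /andP[? ?] := zn; rewrite !(mono n).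
have cvg1 : (\int[mu]_(z in `[F (y n), F (x n)]) (G z)%:E)%E @[n --> \oo] -->
  (\int[mu]_(z in \bigcup_n `[F (y n), F (x n)]%classic) (G z)%:E)%E.
  apply: integral_cvg_bigcup => // m n mn; apply/subsetPset => z /=.
  rewrite !in_itv/= => /andP[xz zy].
  rewrite (le_trans _ xz) ?(le_trans zy)//; apply: (mono n) => //.
  - by rewrite dec_x//= (le_trans (xy m)) ?inc_y.
  - by rewrite dec_x.
  - by rewrite (le_trans (dec_x mn)) ?xy//= inc_y.
  - by rewrite inc_y.
have cvg2 : (\int[mu]_(z in `[x n, y n]) (G (F z) * - f z)%:E)%E @[n --> \oo] -->
  (\int[mu]_(z in \bigcup_n `[x n, y n]%classic) (G (F z) * - f z)%:E)%E.
  apply: integral_cvg_bigcup => //.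
  - move=> n z zn; apply: cvgM.
    + by apply: (@continuous_comp _ _ _ F G); [exact: (@cF n)|apply: (cG n); exact: FE].
    + by apply: cvgN; exact: (@cf n).
  - by move=> n z zn; rewrite mulr_ge0 ?(G0 n) ?oppr_ge0 ?(f0 n)//; exact: FE.
suff E n : (\int[mu]_(z in `[F (y n), F (x n)]) (G z)%:E =
  \int[mu]_(z in `[x n, y n]) (G (F z) * - f z)%:E)%E.
  have -> : (\int[mu]_(z in \bigcup_n `[x n, y n]%classic) (G (F z) * - f z)%:E =
    limn (fun n => \int[mu]_(z in `[F (y n), F (x n)]) (G z)%:E))%E.
    apply/esym/cvg_lim => //; under eq_fun do rewrite E; exact: cvg2.
  by apply/esym/cvg_lim.
have := xy n; rewrite le_eqVlt => /predU1P[->|lt]; first by rewrite !set_itv1 !integral_set1.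
rewrite integration_by_substitution_decreasing//.
- apply: eq_integral => z; rewrite inE/= in_itv/= => zn.
  by rewrite -(F'E zn).
- exact: cvgF'x lt.
- exact: cvgF'y lt.
- by apply: continuous_in_subspaceT => z /set_mem/=; rewrite in_itv; exact: cG.
Qed.

Lemma increasing_ge0_substitution :
  (forall n, {in `[x n, y n] &, {homo F : a b / a < b}}) ->
  (forall n z, x n <= z <= y n -> 0 <= f z) ->
  (forall n z, F (x n) <= z <= F (y n) -> {for z, continuous G}) ->
  (forall n z, F (x n) <= z <= F (y n) -> 0 <= G z) ->
  (\int[mu]_(z in \bigcup_n `[F (x n), F (y n)]%classic) (G z)%:E =
   \int[mu]_(z in \bigcup_n `[x n, y n]%classic) (G (F z) * f z)%:E)%E.
Proof.
move=> homoF f0 cG G0.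
have mono n a b : x n <= a <= y n -> x n <= b <= y n -> a <= b -> F a <= F b.
  move=> an bn; rewrite le_eqVlt => /predU1P[->//|ab]; apply: ltW.
  by apply: (homoF n).
have FE n z : x n <= z <= y n -> F (x n) <= F z <= F (y n).
  by move=> zn; have /andP[? ?] := zn; rewrite !(mono n).
have cvg1 : (\int[mu]_(z in `[F (x n), F (y n)]) (G z)%:E)%E @[n --> \oo] -->
  (\int[mu]_(z in \bigcup_n `[F (x n), F (y n)]%classic) (G z)%:E)%E.
  apply: integral_cvg_bigcup => // m n mn; apply/subsetPset => z /=.
  rewrite !in_itv/= => /andP[xz zy].
  rewrite (le_trans _ xz) ?(le_trans zy)//; apply: (mono n) => //.
  - by rewrite (le_trans (dec_x mn)) ?xy//= inc_y.
  - by rewrite inc_y.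
  - by rewrite dec_x//= (le_trans (xy m)) ?inc_y.
  - by rewrite dec_x.
have cvg2 : (\int[mu]_(z in `[x n, y n]) (G (F z) * f z)%:E)%E @[n --> \oo] -->
  (\int[mu]_(z in \bigcup_n `[x n, y n]%classic) (G (F z) * f z)%:E)%E.
  apply: integral_cvg_bigcup => //.
  - move=> n z zn; apply: cvgM; last exact: (@cf n).
    by apply: (@continuous_comp _ _ _ F G); [exact: (@cF n)|apply: (cG n); exact: FE].
  - by move=> n z zn; rewrite mulr_ge0 ?(G0 n) ?(f0 n)//; exact: FE.
suff E n : (\int[mu]_(z in `[F (x n), F (y n)]) (G z)%:E =
  \int[mu]_(z in `[x n, y n]) (G (F z) * f z)%:E)%E.
  have -> : (\int[mu]_(z in \bigcup_n `[x n, y n]%classic) (G (F z) * f z)%:E =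
    limn (fun n => \int[mu]_(z in `[F (x n), F (y n)]) (G z)%:E))%E.
    apply/esym/cvg_lim => //; under eq_fun do rewrite E; exact: cvg2.
  by apply/esym/cvg_lim.
have := xy n; rewrite le_eqVlt => /predU1P[->|lt]; first by rewrite !set_itv1 !integral_set1.
rewrite integration_by_substitution_increasing//.
- apply: eq_integral => z; rewrite inE/= in_itv/= => zn.
  by rewrite -(F'E zn).
- exact: cvgF'x lt.
- exact: cvgF'y lt.
- by apply: continuous_in_subspaceT => z /set_mem/=; rewrite in_itv; exact: cG.
Qed.

End substitution_exhaustion.

Section substitution_oy.
Variable R : realType.
Notation mu := (@lebesgue_measure R).

Lemma bigcup_itvcc_oy :
  \bigcup_n `[n.+1%:R^-1, n.+1%:R]%classic = `]0, +oo[%classic :> set R.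
Proof.
apply/seteqP; split => [z [n _]|z] /=; rewrite !in_itv/= ?andbT.
  by move=> /andP[+ _]; apply: lt_le_trans; rewrite invr_gt0.
move=> z0; exists (maxn (Num.truncn z) (Num.truncn z^-1)) => //=.
rewrite in_itv/= invf_ple ?posrE//; apply/andP; split.
  apply: (le_trans (ltW (truncnS_gt _))).
  by rewrite ler_nat ltnS leq_max leqnn ?orbT.
apply: (le_trans (ltW (truncnS_gt _))).
by rewrite ler_nat ltnS leq_max leqnn ?orbT.
Qed.

Variables (F f G : R -> R) (J : interval R).
Hypotheses (dF : forall z : R, 0 < z -> is_derive z 1 F (f z))
  (cf : forall z : R, 0 < z -> {for z, continuous f})
  (cG : forall z : R, z \in J -> {for z, continuous G})
  (G0 : forall z : R, z \in J -> 0 <= G z)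
  (FJ : forall z : R, 0 < z -> F z \in J)
  (surjF : forall y : R, y \in J -> exists2 z : R, 0 < z & F z = y).

Let x_gt0 n z : n.+1%:R^-1 <= z <= n.+1%:R -> 0 < z :> R.
Proof. by move=> /andP[+ _]; apply: lt_le_trans; rewrite invr_gt0. Qed.

Let xy n : n.+1%:R^-1 <= n.+1%:R :> R.
Proof. by apply: (@le_trans _ _ 1); rewrite ?invf_le1 ?ler1n. Qed.

Let dec_x m n : (m <= n)%N -> n.+1%:R^-1 <= m.+1%:R^-1 :> R.
Proof. by move=> mn; rewrite lef_pV2 ?posrE// ler_nat. Qed.

Let inc_y m n : (m <= n)%N -> m.+1%:R <= n.+1%:R :> R.
Proof. by rewrite ler_nat. Qed.

Let in_J (a b z : R) : a \in J -> b \in J -> a <= z <= b -> z \in J.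
Proof. by move=> aJ bJ; exact: (@interval_is_interval _ J a b aJ bJ). Qed.

(** The image is described by an interval [J] onto which [F] maps, so that no limit of [F] at 0 or
    at infinity is computed. Monotonicity makes the images of the compact intervals exhaust [J]. *)
Lemma increasing_ge0_substitution_oy :
  (forall a b : R, 0 < a -> a < b -> F a < F b) -> (forall z : R, 0 < z -> 0 <= f z) ->
  (\int[mu]_(z in [set` J]) (G z)%:E =
   \int[mu]_(z in `]0%R, +oo[) (G (F z) * f z)%:E)%E.
Proof.
move=> homoF f0; rewrite -bigcup_itvcc_oy.
have inJ n z : F n.+1%:R^-1 <= z <= F n.+1%:R -> z \in J.
  by apply: in_J; apply: FJ; rewrite ?invr_gt0.
transitivity (\int[mu]_(z in \bigcup_n `[F n.+1%:R^-1, F n.+1%:R]%classic) (G z)%:E)%E; last first.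
  apply: (increasing_ge0_substitution (x := fun n => n.+1%:R^-1)
    (y := fun n => n.+1%:R)) => //.
  - by move=> n z /x_gt0; exact: dF.
  - by move=> n z /x_gt0; exact: cf.
  - by move=> n a b; rewrite !in_itv/= => /x_gt0 a0 _; exact: homoF.
  - by move=> n z /x_gt0; exact: f0.
  - by move=> n z /inJ; exact: cG.
  - by move=> n z /inJ; exact: G0.
congr integral; apply/seteqP; split => z /=; last first.
  by move=> [n _] /=; rewrite in_itv; exact: inJ.
move=> /surjF[w w0 <-].
have : `]0, +oo[%classic w by rewrite /= in_itv/= w0.
rewrite -bigcup_itvcc_oy => -[n _ /=]; rewrite in_itv/= => /andP[w1 w2].
exists n => //=; rewrite in_itv/=; apply/andP; split.
  by move: w1; rewrite le_eqVlt => /predU1P[->//|?]; rewrite ltW// homoF ?invr_gt0.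
by move: w2; rewrite le_eqVlt => /predU1P[->//|?]; rewrite ltW// homoF.
Qed.

Lemma decreasing_ge0_substitution_oy :
  (forall a b : R, 0 < a -> a < b -> F b < F a) -> (forall z : R, 0 < z -> f z <= 0) ->
  (\int[mu]_(z in [set` J]) (G z)%:E =
   \int[mu]_(z in `]0%R, +oo[) (G (F z) * - f z)%:E)%E.
Proof.
move=> homoF f0; rewrite -bigcup_itvcc_oy.
have inJ n z : F n.+1%:R <= z <= F n.+1%:R^-1 -> z \in J.
  by apply: in_J; apply: FJ; rewrite ?invr_gt0.
transitivity (\int[mu]_(z in \bigcup_n `[F n.+1%:R, F n.+1%:R^-1]%classic) (G z)%:E)%E; last first.
  apply: (decreasing_ge0_substitution (x := fun n => n.+1%:R^-1)
    (y := fun n => n.+1%:R)) => //.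
  - by move=> n z /x_gt0; exact: dF.
  - by move=> n z /x_gt0; exact: cf.
  - by move=> n a b; rewrite !in_itv/= => _ /x_gt0 b0; exact: homoF.
  - by move=> n z /x_gt0; exact: f0.
  - by move=> n z /inJ; exact: cG.
  - by move=> n z /inJ; exact: G0.
congr integral; apply/seteqP; split => z /=; last first.
  by move=> [n _] /=; rewrite in_itv; exact: inJ.
move=> /surjF[w w0 <-].
have : `]0, +oo[%classic w by rewrite /= in_itv/= w0.
rewrite -bigcup_itvcc_oy => -[n _ /=]; rewrite in_itv/= => /andP[w1 w2].
exists n => //=; rewrite in_itv/=; apply/andP; split.
  by move: w2; rewrite le_eqVlt => /predU1P[->//|?]; rewrite ltW// homoF.
by move: w1; rewrite le_eqVlt => /predU1P[->//|?]; rewrite ltW// homoF ?invr_gt0.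
Qed.

End substitution_oy.

(** * Gamma integrals and the Laplace transform of powers *)

Section gamma_function.
Variable R : realType.
Notation mu := (@lebesgue_measure R).
Implicit Types a x u : R.

Lemma continuous_powR_gt0 a x : 0 < x -> {for x, continuous (@powR R ^~ a)}.
Proof.
move=> x0; apply: differentiable_continuous; apply/derivable1_diffP.
by have [] := is_derive1_powR a x0.
Qed.

Lemma integral_expRN_oy : (\int[mu]_(x in `]0%R, +oo[) (expR (- x))%:E = 1)%E.
Proof.
rewrite integral_itv_obnd_cbnd; last first.
  apply/measurable_EFinP/measurable_funTS.
  by apply: measurableT_comp.
rewrite (@ge0_continuous_FTC2y _ _ (fun x => - expR (- x)) 0 0).
- by rewrite oppr0 expR0 EFinN oppeK add0e.
- by move=> x _; exact: expR_ge0.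
- by apply: continuous_subspaceT => x; apply: continuous_comp; [exact: opp_continuous|exact: continuous_expR].
- rewrite -oppr0; apply: cvgN; exact: cvgr_expR.
- by move=> x _.
- by apply: cvg_at_right_filter; apply: cvgN; apply: continuous_comp; [exact: opp_continuous|exact: continuous_expR].
- move=> x _; rewrite derive1E derive_val ?scaleN1r ?opprK; (try by rewrite ?mulrN1 ?mulN1r ?opprK).
Qed.


(** [Gamma] takes the finite part of this integral, so the two may be identified only once
    finiteness is known. *)
Definition egamma a : \bar R :=
  (\int[mu]_(t in `]0%R, +oo[) (t `^ (a - 1) * expR (- t))%:E)%E.

(** The substitution [t = x^(1/a)] absorbs the singularity [t^(a - 1)] at 0 into the Jacobian. *)
Lemma egammaE a : 0 < a ->
  egamma a = (\int[mu]_(x in `]0%R, +oo[) (a^-1 * expR (- x `^ a^-1))%:E)%E.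
Proof.
move=> a0; rewrite /egamma.
rewrite (@increasing_ge0_substitution_oy _ (fun z : R => z `^ a^-1)
  (fun z => a^-1 * z `^ (a^-1 - 1)) _ `]0, +oo[).
- apply: eq_integral => x; rewrite inE/= in_itv/= andbT => x0; congr EFin.
  have -> : (x `^ a^-1) `^ (a - 1) = x `^ (1 - a^-1).
    by rewrite -powRrM mulrBr mulVf ?gt_eqF// mulr1.
  have E : x `^ (1 - a^-1) * x `^ (a^-1 - 1) = 1.
    by rewrite -powRD ?(gt_eqF x0) ?implybT// addrA subrK subrr powRr0.
  by rewrite -[RHS]mulr1 -[X in _ = _ * X]E; ring.
- by move=> z z0; apply: cvgM; [exact: cvg_cst|exact: continuous_powR_gt0].
- move=> z; rewrite in_itv/= andbT => z0; apply: cvgM; first exact: continuous_powR_gt0.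
  by apply: continuous_comp; [exact: opp_continuous|exact: continuous_expR].
- by move=> z _; rewrite mulr_ge0 ?powR_ge0 ?expR_ge0.
- by move=> z z0; rewrite in_itv/= powR_gt0.
- move=> y; rewrite in_itv/= andbT => y0; exists (y `^ a); first exact: powR_gt0.
  by rewrite -powRrM divff ?gt_eqF// powRr1// ltW.
- move=> x y x0 xy; apply: gt0_ltr_powR => //; rewrite ?invr_gt0 ?nnegrE ?ltW//.
  exact: lt_trans xy.
- by move=> z z0; rewrite mulr_ge0 ?powR_ge0 ?invr_ge0 ?ltW.
Qed.

(** In the form of [egammaE] the integrand is at least [exp (- 1) / a] on []0, 1[], and
    [x <= 1 + x^(1/a)], where [a <= 1] enters, bounds it by a multiple of [exp (- x)]. *)
Lemma egamma_gt0_lty a : 0 < a <= 1 -> (0 < egamma a < +oo)%E.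
Proof.
move=> /andP[a0 a1]; rewrite egammaE//.
have mf : measurable_fun setT (fun x : R => a^-1 * expR (- x `^ a^-1)).
  by apply: measurable_funM => //; do 2 apply: measurableT_comp => //; exact: measurable_powR.
have a10 : 0 < a^-1 by rewrite invr_gt0.
have a11 : 1 <= a^-1 by rewrite invf_ge1.
apply/andP; split.
  apply: (@lt_le_trans _ _ (\int[mu]_(x in `]0%R, 1%R[) (a^-1 * expR (- 1))%:E)%E).
    rewrite integral_cst//= lebesgue_measure_itv/= lte_fin ltr01 oppr0 adde0 mule1.
    by rewrite lte_fin mulr_gt0 ?expR_gt0.
  apply: (@le_trans _ _ (\int[mu]_(x in `]0%R, 1%R[) (a^-1 * expR (- x `^ a^-1))%:E)%E).
    apply: ge0_le_integral => //.
    - by move=> x _; rewrite lee_fin mulr_ge0 ?expR_ge0 ?ltW.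
    - by apply/measurable_EFinP; exact: measurable_funTS.
    - move=> x /=; rewrite in_itv/= => /andP[x0 x1]; rewrite lee_fin ler_pM2l// ler_expR lerN2.
      have := (@ge0_ler_powR R a^-1 (ltW a10) x 1); rewrite powR1; apply; rewrite ?nnegrE ?ltW//.
  apply: ge0_subset_integral => //.
  - by apply/measurable_EFinP; exact: measurable_funTS.
  - by move=> x _; rewrite lee_fin mulr_ge0 ?expR_ge0 ?ltW.
  - by move=> x /=; rewrite !in_itv/= => /andP[->].
apply: (@le_lt_trans _ _ (\int[mu]_(x in `]0%R, +oo[) ((a^-1 * expR 1)%:E * (expR (- x))%:E))%E).
  apply: ge0_le_integral => //.
  - by move=> x _; rewrite lee_fin mulr_ge0 ?expR_ge0 ?ltW.
  - by apply/measurable_EFinP; exact: measurable_funTS.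
  - apply/measurable_EFinP/measurable_funTS; apply: measurable_funM => //.
    exact: measurableT_comp.
  - move=> x /=; rewrite in_itv/= andbT => x0; rewrite -EFinM lee_fin -mulrA ler_pM2l//.
    rewrite -expRD ler_expR; have p0 := powR_ge0 x a^-1.
    have [x1|x1] := leP x 1; first by lra.
    suff p1 : x <= x `^ a^-1 by lra.
    by have := ler_powR (ltW x1) a11; rewrite (powRr1 (ltW x0)).
rewrite ge0_integralZl_EFin//.
- by rewrite integral_expRN_oy mule1 ltry.
- by apply/measurable_EFinP/measurable_funTS; exact: measurableT_comp.
- by rewrite mulr_ge0 ?expR_ge0 ?ltW.
Qed.

Lemma GammaE a : 0 < a <= 1 -> (Gamma a)%:E = egamma a.
Proof.
move=> /egamma_gt0_lty/andP[g0 g1]; rewrite /Gamma /Rintegral fineK//.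
by rewrite ge0_fin_numE// ltW.
Qed.

Lemma Gamma_gt0 a : 0 < a <= 1 -> 0 < Gamma a.
Proof. by move=> a01; rewrite -lte_fin GammaE//; case/andP: (egamma_gt0_lty a01). Qed.

(** Substitution [s = u + z / m]. It is used with [a = rl_order nu - nu] for the Riemann-Liouville
    kernel and with [a = 1 - nu] for the size-biased law. *)
Lemma integral_expR_powR a m u : 0 < a <= 1 -> 0 < m ->
  (\int[mu]_(s in `]u, +oo[) (expR (- m * s) * (s - u) `^ (a - 1))%:E =
   (Gamma a * m `^ (- a) * expR (- m * u))%:E)%E.
Proof.
move=> a01 m0; have a0 : 0 < a by case/andP: a01.
have dF (z : R) : is_derive z 1 (fun z : R => u + m^-1 * z) m^-1.
  apply: is_derive_eq; by rewrite add0r mul1r /GRing.scale/= mulr1.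
rewrite (@increasing_ge0_substitution_oy _ (fun z : R => u + m^-1 * z)
  (fun=> m^-1) _ `]u, +oo[ (fun z _ => dF z)).
- rewrite (_ : Gamma a * _ * _ = (m `^ (- a) * expR (- m * u)) * Gamma a); last by ring.
  rewrite EFinM GammaE// -ge0_integralZl_EFin//.
  + apply: eq_integral => x; rewrite inE/= in_itv/= andbT => x0; rewrite -EFinM; congr EFin.
    have -> : u + m^-1 * x - u = m^-1 * x by ring.
    have -> : - m * (u + m^-1 * x) = - m * u - x by field; rewrite gt_eqF.
    rewrite expRD powRM ?invr_ge0 ?ltW// -[in m^-1 `^ _]powR_inv1 ?ltW// -powRrM.
    rewrite (_ : m `^ (- a) = m `^ (-1 * (a - 1)) * m^-1); first by ring.
    rewrite -(powR_inv1 (ltW m0)) -powRD; last by rewrite (gt_eqF m0) implybT.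
    by congr (_ `^ _); ring.
  + by move=> x _; rewrite lee_fin mulr_ge0 ?powR_ge0 ?expR_ge0.
  + apply/measurable_EFinP/measurable_funTS/measurable_funM; first exact: measurable_powR.
    exact: measurableT_comp.
  + by rewrite mulr_ge0 ?powR_ge0 ?expR_ge0.
- by move=> z z0; exact: cvg_cst.
- move=> z; rewrite in_itv/= andbT => z0; apply: cvgM.
    apply: continuous_comp; last exact: continuous_expR.
    by apply: cvgM; [exact: cvg_cst|exact: cvg_id].
  apply: (@continuous_comp _ _ _ (fun z => z - u) (@powR R ^~ (a - 1))).
    by apply: cvgB; [exact: cvg_id|exact: cvg_cst].
  by apply: continuous_powR_gt0; rewrite subr_gt0.
- by move=> z _; rewrite mulr_ge0 ?powR_ge0 ?expR_ge0.
- by move=> z z0; rewrite in_itv/= andbT ltrDl mulr_gt0 ?invr_gt0.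
- move=> y; rewrite in_itv/= andbT => uy; exists (m * (y - u)); first by rewrite mulr_gt0 ?subr_gt0.
  by rewrite mulrA mulVf ?gt_eqF// mul1r addrC subrK.
- by move=> x y _ xy; rewrite ltrD2l ltr_pM2l ?invr_gt0.
- by move=> z z0; rewrite invr_ge0 ltW.
Qed.

End gamma_function.

(** * Power series, Poisson weights and stable subordinators *)

Section nonnegative_power_series.
Variable R : realType.
Local Open Scope ereal_scope.

Lemma nneseries_term_le (f : nat -> \bar R) n : (forall k, 0 <= f k) ->
  f n <= \sum_(0 <= k <oo) f k.
Proof.
move=> f0; have /= := @nneseries_lim_ge R f xpredT 0%N n.+1 (fun k _ _ => f0 k).
by apply: le_trans; rewrite big_nat_recr//= leeDr// sume_ge0.
Qed.

Lemma nneseries_recl (f : nat -> \bar R) : (forall k, 0 <= f k) ->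
  \sum_(0 <= k <oo) f k = f 0%N + \sum_(0 <= k <oo) f k.+1.
Proof.
move=> f0; rewrite (nneseries_split 0 1)// add0n big_nat1; congr (_ + _).
by rewrite -(nneseries_addn 1)//; under eq_eseriesr do rewrite addn1.
Qed.

Let pow_series (a : nat -> \bar R) (h : R) := \sum_(0 <= n <oo) (h ^+ n)%:E * a n.

Let pow_seriesS (a : nat -> \bar R) h : (forall n, 0 <= a n) -> (0 <= h)%R ->
  pow_series a h = a 0%N + h%:E * pow_series (fun n => a n.+1) h.
Proof.
move=> a0 h0; rewrite /pow_series nneseries_recl; last first.
  by move=> k; rewrite mule_ge0// lee_fin exprn_ge0.
rewrite expr0 mul1e; congr (_ + _); rewrite -nneseriesZl//; last first.
  by move=> k _; rewrite mule_ge0// lee_fin exprn_ge0.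
by apply: eq_eseriesr => k _; rewrite exprS EFinM muleA.
Qed.

Let pow_series_ge0 a h : (forall n, 0 <= a n) -> (0 <= h)%R -> 0 <= pow_series a h.
Proof. by move=> a0 h0; apply: nneseries_ge0 => n _ _; rewrite mule_ge0// lee_fin exprn_ge0. Qed.

Let pow_series_le a h : (forall n, 0 <= a n) -> (0 < h <= 2^-1)%R ->
  pow_series a h <= pow_series a 2^-1.
Proof.
move=> a0 /andP[h0 h2]; apply: lee_nneseries => [n _ _|n _].
  by rewrite mule_ge0// lee_fin exprn_ge0// ltW.
by rewrite lee_wpmul2r// lee_fin lerXn2r// ?nnegrE ?ltW.
Qed.

(** Let [h] tend to 0 in [a 0 <= b 0 + h S], where [S], the shifted series of [b] at [1/2], bounds
    the remainder for all smaller [h]. *)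
Let head_le a b : (forall n, 0 <= a n) -> (forall n, 0 <= b n) ->
  pow_series b 2^-1 < +oo ->
  (forall h : R, (0 < h <= 2^-1)%R -> pow_series a h = pow_series b h) ->
  a 0%N <= b 0%N.
Proof.
move=> a0 b0 bfin ab; apply/lee_addgt0Pr => e e0.
have b'fin : pow_series (fun n => b n.+1) 2^-1 \is a fin_num.
  rewrite ge0_fin_numE ?pow_series_ge0 ?invr_ge0//; move: bfin.
  rewrite pow_seriesS ?invr_ge0//; apply: contraTT; rewrite -!leNgt !leye_eq => /eqP ->.
  by rewrite gt0_muley ?lte_fin ?invr_gt0// addey// gt_eqF// (lt_le_trans _ (b0 0%N)).
set S := fine (pow_series (fun n => b n.+1) 2^-1).
have S0 : (0 <= S)%R by rewrite fine_ge0 ?pow_series_ge0 ?invr_ge0.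
(* This gives [h S <= e]; the [+ 1] keeps the denominator positive when [S = 0]. *)
set h : R := Num.min (2^-1)%R (e / (S + 1))%R.
have h0 : (0 < h)%R by rewrite lt_min invr_gt0 ltr0n/= divr_gt0// ltr_wpDl.
have h2 : (0 < h <= 2^-1)%R by rewrite h0 ge_min lexx.
apply: (@le_trans _ _ (pow_series a h)).
  by rewrite pow_seriesS ?(ltW h0)// leeDl// mule_ge0 ?pow_series_ge0 ?lee_fin// ltW.
rewrite ab// pow_seriesS ?(ltW h0)// leeD2l//.
apply: (@le_trans _ _ (h%:E * pow_series (fun n => b n.+1) 2^-1)).
  by rewrite lee_wpmul2l ?lee_fin ?(ltW h0)// pow_series_le.
rewrite -(fineK b'fin) -/S -EFinM lee_fin.
apply: (@le_trans _ _ (e / (S + 1) * S)%R); first by rewrite ler_wpM2r// ge_min lexx orbT.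
by rewrite -mulrA ler_piMr ?ltW// mulrC ltr_pdivrMr ?ltr_wpDl// mul1r ltrDl.
Qed.

(** Heads agree by letting [h] tend to 0; they are then cancelled, [h] is divided out, and the
    shifted sequences are treated in the same way. Coefficients are extended reals because they will
    be integrals not yet known to be finite. *)
Lemma power_series_unique (a b : nat -> \bar R) :
  (forall n, 0 <= a n) -> (forall n, 0 <= b n) ->
  \sum_(0 <= n <oo) ((2^-1 : R) ^+ n)%:E * a n < +oo ->
  (forall h : R, (0 < h <= 2^-1)%R -> \sum_(0 <= n <oo) (h ^+ n)%:E * a n =
     \sum_(0 <= n <oo) (h ^+ n)%:E * b n) ->
  forall n, a n = b n.
Proof.
move=> a0 b0 afin ab n; elim: n a b a0 b0 afin ab => [|n IH] a b a0 b0 afin ab.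
  have bfin : pow_series b 2^-1 < +oo.
    by rewrite -[pow_series _ _]ab ?lexx ?invr_gt0 ?ltr0n.
  by apply/eqP; rewrite eq_le !head_le// => h /ab.
have heads : a 0%N = b 0%N.
  have bfin : pow_series b 2^-1 < +oo.
    by rewrite -[pow_series _ _]ab ?lexx ?invr_gt0 ?ltr0n.
  by apply/eqP; rewrite eq_le !head_le// => h /ab.
have half0 : (0 <= 2^-1 :> R)%R by rewrite invr_ge0.
apply: (IH (fun n => a n.+1) (fun n => b n.+1)) => //.
  move: afin; rewrite -[X in X < _]/(pow_series a 2^-1) pow_seriesS//.
  apply: contraTT; rewrite -!leNgt !leye_eq => /eqP E.
  by rewrite /pow_series E gt0_muley ?lte_fin ?invr_gt0// addey// gt_eqF// (lt_le_trans _ (a0 0%N)).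
move=> h h12; have /andP[h0 _] := h12; have := ab h h12.
rewrite -[LHS]/(pow_series a h) -[RHS]/(pow_series b h).
rewrite (pow_seriesS a0 (ltW h0)) (pow_seriesS b0 (ltW h0)) heads.
have b0fin : b 0%N \is a fin_num.
  rewrite -heads ge0_fin_numE//; apply: le_lt_trans afin.
  have := @nneseries_term_le (fun n => ((2^-1 : R) ^+ n)%:E * a n) 0.
  by rewrite expr0 mul1e; apply => k; rewrite mule_ge0// lee_fin exprn_ge0.
rewrite ![b 0%N + _]addeC => /(congr1 (fun x => x - b 0%N)); rewrite !addeK// => /(congr1 (fun x => (h^-1)%:E * x)).
by rewrite !muleA -EFinM mulVf ?gt_eqF// !mul1e.
Qed.

End nonnegative_power_series.

Section poisson_weights.
Variables (R : realType) (l : R).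
Hypothesis l_gt0 : 0 < l.
Implicit Types (x h : R) (n : nat).

Definition pois n x : R := (l * x) ^+ n / n`!%:R * expR (- (l * x)).

(** The weight of index [n - 1], read as 0 for [n = 0], so that the derivative has a single
    formula. *)
Definition pois_pred n x : R := if n is n'.+1 then pois n' x else 0.

Lemma pois0 n : pois n 0 = (n == 0)%:R.
Proof.
rewrite /pois mulr0 oppr0 expR0 mulr1 expr0n; case: n => [|n] /=; last by rewrite mul0r.
by rewrite fact0 divr1.
Qed.

Lemma pois_ge0 n x : 0 <= x -> 0 <= pois n x.
Proof.
by move=> x0; rewrite mulr_ge0 ?expR_ge0// divr_ge0// exprn_ge0// mulr_ge0// ltW.
Qed.

Lemma nneseries_exp_coeff x : 0 <= x ->
  (\sum_(0 <= n <oo) (exp_coeff x n)%:E = (expR x)%:E)%E.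
Proof.
move=> x0; rewrite /expR -EFin_lim; last exact: is_cvg_series_exp_coeff.
by congr (limn _); apply/funext => n; rewrite /= /series/= sumEFin.
Qed.

Lemma nneseries_pois h x : 0 <= h -> 0 <= x ->
  (\sum_(0 <= n <oo) (h ^+ n)%:E * (pois n x)%:E = (expR (- (l * (1 - h) * x)))%:E)%E.
Proof.
move=> h0 x0; have hx : 0 <= h * (l * x) by rewrite !mulr_ge0// ltW.
transitivity (\sum_(0 <= n <oo) (expR (- (l * x)))%:E * (exp_coeff (h * (l * x)) n)%:E)%E.
  apply: eq_eseriesr => n _; rewrite -!EFinM; congr EFin.
  by rewrite /pois /exp_coeff/= [in RHS]exprMn; ring.
rewrite nneseriesZl; last by move=> n _; rewrite lee_fin exp_coeff_ge0.
rewrite nneseries_exp_coeff// -EFinM -expRD; congr (expR _)%:E; ring.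
Qed.

(** A term of the generating series at [h = 1], whose sum is 1. *)
Lemma pois_le1 n x : 0 <= x -> pois n x <= 1.
Proof.
move=> x0; rewrite -lee_fin; have := @nneseries_pois 1 x ler01 x0.
rewrite subrr mulr0 mul0r oppr0 expR0 => <-.
have := @nneseries_term_le R (fun n => (1 ^+ n)%:E * (pois n x)%:E)%E n.
rewrite expr1n mul1e; apply => k; by rewrite expr1n mul1e lee_fin pois_ge0.
Qed.

Lemma pois_pred_ge0 n x : 0 <= x -> 0 <= pois_pred n x.
Proof. by case: n => //= n; exact: pois_ge0. Qed.

Lemma pois_pred_le1 n x : 0 <= x -> pois_pred n x <= 1.
Proof. by case: n => //= n; exact: pois_le1. Qed.

Lemma is_derive_pois n x : is_derive x 1 (pois n) (l * (pois_pred n x - pois n x)).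
Proof.
have d1 : is_derive x 1 (fun x => l * x) l.
  by apply: is_derive_eq; rewrite /GRing.scale/= mulr1.
have d3 : is_derive x 1 (fun x => expR (- (l * x))) (expR (- (l * x)) * - l).
  by apply: (@is_derive1_comp _ expR (fun x => - (l * x))); exact: (is_deriveN d1).
have -> : pois n = (n`!%:R^-1 *: (fun x => l * x) ^+ n) * (fun x => expR (- (l * x))).
  by apply/funext => y; rewrite !fctE /GRing.scale/= /pois [_ / _]mulrC.
apply: is_derive_eq; rewrite !fctE /GRing.scale/=.
case: n => [|n] /=; first by rewrite fact0 invr1; ring.
rewrite /pois factS natrM exprS; field.
by rewrite nat1r !pnatr_eq0 -lt0n fact_gt0.
Qed.

Lemma continuous_pois n : continuous (pois n).
Proof.
move=> x; apply: differentiable_continuous; apply/derivable1_diffP.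
by have [] := is_derive_pois n x.
Qed.

Lemma measurable_pois n : measurable_fun setT (pois n).
Proof. by apply: continuous_measurable_fun; exact: continuous_pois. Qed.

End poisson_weights.

Section stable_subordinator.
Context d (T : measurableType d) (R : realType) (P : probability T R).
Variables (alpha : R) (A : R -> T -> R).
Hypotheses (alpha_gt0 : 0 < alpha) (sA : stable_subordinator P alpha A).
Implicit Types (s th : R) (w : T).

Lemma stable_measurable s : 0 <= s -> measurable_fun setT (A s).
Proof. exact: (levy_measurable (stable_levy sA)). Qed.

Lemma stable_ge0 s w : 0 <= s -> 0 <= A s w.
Proof.
move=> s0; rewrite -(levy_start (stable_levy sA) w).
exact: (stable_nondecreasing sA).
Qed.

Lemma integral_stable_expR th s : 0 <= th -> 0 <= s ->
  (\int[P]_w (expR (- th * A s w))%:E = (expR (- (th `^ alpha) * s))%:E)%E.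
Proof. by move=> th0 s0; rewrite -(stable_laplace sA)// unlock. Qed.

(** The indicator of the event is at most [exp (- th A s)], whose expectation [exp (- th^alpha s)]
    is arbitrarily small; [th] is chosen to make it [exp (- |ln e|) <= e]. *)
Lemma stable_eq0_null s : 0 < s -> P (A s @^-1` [set 0]) = 0%E.
Proof.
move=> s0; have s0' := ltW s0.
have mA := stable_measurable s0'.
have mE : measurable (A s @^-1` [set 0]).
  by rewrite -[X in measurable X]setTI; exact: mA.
apply/eqP; rewrite eq_le measure_ge0 andbT; apply/lee_addgt0Pr => e e0; rewrite add0e.
pose th := (`|ln e| / s) `^ alpha^-1.
have th0 : 0 <= th by exact: powR_ge0.
have thE : th `^ alpha * s = `|ln e|.
  rewrite /th -powRrM mulVf ?gt_eqF// powRr1 ?divr_ge0// ?(ltW s0)//.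
  by rewrite divfK// gt_eqF.
apply: (@le_trans _ _ (\int[P]_w (expR (- th * A s w))%:E)%E); last first.
  rewrite integral_stable_expR// lee_fin mulNr thE.
  rewrite -[leRHS]lnK ?posrE// ler_expR lerNl.
  by rewrite -normrN ler_norm.
rewrite -[X in P X]setIT -integral_indic//.
apply: ge0_le_integral => //.
- exact/measurable_EFinP/measurable_indic.
- apply/measurable_EFinP; apply: measurableT_comp => //.
  exact: measurable_funM.
- move=> w _; rewrite lee_fin indicE.
  have [/set_mem/= ->|_] := boolP (w \in _); last exact: expR_ge0.
  by rewrite mulr0 expR0.
Qed.

(** Self-similarity: both variables have Laplace transform [exp (- th^alpha s)], and uniqueness is
    applied with weight 1. *)
Lemma integral_stable_scaling (G : R -> R) s : 0 < s -> measurable_fun setT G ->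
  (forall x, 0 <= G x) ->
  (\int[P]_w (G (A s w))%:E = \int[P]_w (G (s `^ alpha^-1 * A 1 w))%:E)%E.
Proof.
move=> s0 mG G0.
transitivity (\int[P]_w (cst 1 w * G (A s w))%:E)%E.
  by apply: eq_integral => w _; rewrite mul1r.
transitivity (\int[P]_w (cst 1 w * G (s `^ alpha^-1 * A 1 w))%:E)%E; last first.
  by apply: eq_integral => w _; rewrite mul1r.
apply: (@laplace_unique_integral _ _ T T R P P (cst 1) (A s) (cst 1)
  (fun w => s `^ alpha^-1 * A 1 w) G) => //.
- exact: stable_measurable (ltW s0).
- by apply: measurable_funM => //; exact: stable_measurable.
- by move=> w; exact: stable_ge0 (ltW s0).
- by move=> w; rewrite mulr_ge0 ?powR_ge0 ?stable_ge0.
- exact: finite_measure_integrable_cst.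
- exact: finite_measure_integrable_cst.
- move=> th th0; under eq_integral do rewrite mul1r.
  rewrite integral_stable_expR ?(ltW s0)//.
  under eq_integral do rewrite mul1r mulrA mulNr.
  rewrite integral_stable_expR ?mulr_ge0 ?powR_ge0// powRM ?powR_ge0// -powRrM.
  by rewrite mulVf ?gt_eqF// powRr1 ?(ltW s0)// mulr1 mulNr.
Qed.

End stable_subordinator.

(** * Riemann-Liouville derivative of Poisson mixtures *)

Section tail_integral.
Variable R : realType.
Notation mu := (@lebesgue_measure R).

Lemma Gamma1 : Gamma 1 = 1 :> R.
Proof.
apply: EFin_inj; rewrite GammaE ?ltr01 ?lexx// /egamma -[RHS]integral_expRN_oy.
by apply: eq_integral => x _; rewrite subrr powRr0 mul1r.
Qed.

Lemma integral_expR_tail (m u : R) : 0 < m ->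
  (\int[mu]_(s in `]u, +oo[) (expR (- m * s))%:E = (m^-1 * expR (- m * u))%:E)%E.
Proof.
move=> m0; transitivity ((Gamma 1 * m `^ (-1) * expR (- m * u))%:E); last first.
  by rewrite Gamma1 mul1r (powR_inv1 (ltW m0)).
rewrite -integral_expR_powR ?ltr01 ?lexx//.
by apply: eq_integral => s _; rewrite subrr powRr0 mulr1.
Qed.

(** Near [u] the tail integral is a constant minus the integral from [a = u / 2], to which the
    fundamental theorem of calculus applies. *)
Lemma is_derive_tail_integral (g : R -> R) (u : R) :
  (forall s, 0 < s -> {for s, continuous g}) ->
  (forall a, 0 < a -> mu.-integrable `]a, +oo[ (EFin \o g)) ->
  0 < u -> is_derive u 1 (fun u => \int[mu]_(s in `]u, +oo[) g s) (- g u).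
Proof.
move=> cg ig u0; set a := u / 2.
have a0 : 0 < a by rewrite divr_gt0.
have au : a < u by rewrite ltr_pdivrMr// ltr_pMr// ltr1n.
have iau : mu.-integrable `]a, (u + 1)] (EFin \o g).
  apply: integrableS (ig _ a0) => // x /=; rewrite !in_itv/= => /andP[-> _]//.
have [dG GE] : derivable (fun x => \int[mu]_(t in `]a, x]) g t) u 1 /\
    derive1 (fun x => \int[mu]_(t in `]a, x]) g t) u = g u.
  apply: (continuous_FTC1 (u := u + 1) _ iau) => //; first by rewrite ltrDl.
  exact: cg.
have dG' : is_derive u 1 (fun x => \int[mu]_(t in `]a, x]) g t) (g u).
  by apply: DeriveDef => //; rewrite -GE derive1E.
have D : is_derive u 1 (cst (\int[mu]_(t in `]a, +oo[) g t) -
    (fun x => \int[mu]_(t in `]a, x]) g t)) (0 - g u) by exact: is_deriveB.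
rewrite -[X in is_derive _ _ _ X]add0r; apply: near_eq_is_derive D.
near=> x; have ax : a < x by near: x; exact: lt_nbhsr.
by rewrite !fctE (Rintegral_itvB (ig _ a0))//= ?bnd_simp ltW.
Unshelve. all: by end_near. Qed.

End tail_integral.

Section poisson_stable_mixture.
Context d (T : measurableType d) (R : realType) (P : probability T R).
Notation mu := (@lebesgue_measure R).
Variables (l nu : R) (A : R -> T -> R).
Hypotheses (l_gt0 : 0 < l) (nu_gt1 : 1 < nu) (sA : stable_subordinator P (1 / nu) A).
Implicit Types (s u h : R) (n j : nat).

Definition mixed_pois n s : R := (\int[P]_w pois l n (A s w))%R.

Let alpha_gt0 : 0 < 1 / nu. Proof. by rewrite divr_gt0// (lt_trans _ nu_gt1). Qed.
Let nu_gt0 : 0 < nu. Proof. exact: lt_trans nu_gt1. Qed.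

Let mpoisA n s : 0 <= s -> measurable_fun setT (fun w => pois l n (A s w)).
Proof.
move=> s0; apply: measurableT_comp; first exact: measurable_pois.
exact: stable_measurable sA _ s0.
Qed.

Let poisA01 n s w : 0 <= s -> 0 <= pois l n (A s w) <= 1.
Proof. by move=> s0; have A0 := stable_ge0 sA w s0; rewrite pois_ge0// pois_le1. Qed.

Let ipoisA n s : 0 <= s -> P.-integrable setT (EFin \o (fun w => pois l n (A s w))).
Proof.
move=> s0; apply: (@le_integrable _ _ _ P _ measurableT _ (cst 1%E)).
- exact/measurable_EFinP/mpoisA.
- by move=> w _ /=; rewrite lee_fin normr1; have /andP[? ?] := poisA01 n w s0; rewrite ger0_norm.
- exact: finite_measure_integrable_cst.
Qed.

Lemma mixed_poisE n s : 0 <= s ->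
  ((mixed_pois n s)%:E = \int[P]_w (pois l n (A s w))%:E)%E.
Proof. by move=> s0; rewrite /mixed_pois /Rintegral fineK//; exact: integrable_fin_num (ipoisA n s0). Qed.

Lemma mixed_pois_ge0 n s : 0 <= s -> 0 <= mixed_pois n s.
Proof. by move=> s0; apply: Rintegral_ge0 => w _; case/andP: (poisA01 n w s0). Qed.

Definition rate h : R := (l * (1 - h)) `^ (1 / nu).

Lemma nneseries_mixed_pois h s : 0 <= h <= 1 -> 0 <= s ->
  (\sum_(0 <= n <oo) (h ^+ n)%:E * (mixed_pois n s)%:E = (expR (- rate h * s))%:E)%E.
Proof.
move=> /andP[h0 h1] s0.
have lh0 : 0 <= l * (1 - h) by rewrite mulr_ge0 ?subr_ge0// ltW.
transitivity (\sum_(0 <= n <oo) \int[P]_w ((h ^+ n)%:E * (pois l n (A s w))%:E))%E.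
  apply: eq_eseriesr => n _; rewrite mixed_poisE// -ge0_integralZl_EFin//.
  - by move=> w _; rewrite lee_fin; case/andP: (poisA01 n w s0).
  - exact/measurable_EFinP/mpoisA.
  - by rewrite exprn_ge0.
rewrite -integral_nneseries//; last 2 first.
- by move=> n; apply/measurable_EFinP/measurable_funM => //; exact: mpoisA.
- move=> n w _; rewrite lee_fin mulr_ge0 ?exprn_ge0//.
  by case/andP: (poisA01 n w s0).
under eq_integral => w _ do rewrite nneseries_pois ?(stable_ge0 sA)//.
under eq_integral => w _ do rewrite -mulNr.
by rewrite (integral_stable_expR sA).
Qed.

(** The paths of [A] may jump, but [A s] has the law of [s^nu A 1], which depends continuously on
    [s] for each outcome; dominated convergence then applies. *)
Lemma continuous_mixed_pois n s : 0 < s -> {for s, continuous (mixed_pois n)}.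
Proof.
move=> s0.
pose g (s : R) w : R := pois l n (s `^ nu * A 1 w).
have A1 w : 0 <= A 1 w by exact: (stable_ge0 sA).
have mA1 : measurable_fun setT (A 1) by exact: (stable_measurable sA).
have mg u : measurable_fun setT (g u).
  apply: measurableT_comp; first exact: measurable_pois.
  exact: measurable_funM.
have g01 u w : 0 <= g u w <= 1.
  by rewrite pois_ge0 ?pois_le1// mulr_ge0 ?powR_ge0.
have E u : 0 < u -> mixed_pois n u = \int[P]_w g u w.
  move=> u0; apply: EFin_inj; rewrite mixed_poisE ?(ltW u0)//.
  (* [integral_stable_scaling] takes functions that are nonnegative on the whole line, hence the
     absolute value. *)
  transitivity (\int[P]_w (pois l n `|A u w|)%:E)%E.
    by apply: eq_integral => w _; rewrite ger0_norm// (stable_ge0 sA)// ltW.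
  rewrite (integral_stable_scaling alpha_gt0 sA (G := fun x => pois l n `|x|))//; last 2 first.
  - apply: measurableT_comp; first exact: measurable_pois.
    by apply: continuous_measurable_fun; exact: norm_continuous.
  - by move=> x; exact: pois_ge0.
  rewrite /Rintegral fineK.
    apply: eq_integral => w _.
    by rewrite ger0_norm ?mulr_ge0 ?powR_ge0// mul1r invrK.
  apply: integrable_fin_num => //.
  apply: (@le_integrable _ _ _ P _ measurableT _ (cst 1%E)).
  - exact/measurable_EFinP.
  - by move=> w _ /=; rewrite lee_fin normr1; have /andP[? ?] := g01 u w; rewrite ger0_norm.
  - exact: finite_measure_integrable_cst.
have ig u : P.-integrable setT (EFin \o g u).
  apply: (@le_integrable _ _ _ P _ measurableT _ (cst 1%E)).
  - exact/measurable_EFinP.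
  - by move=> w _ /=; rewrite lee_fin normr1; have /andP[? ?] := g01 u w; rewrite ger0_norm.
  - exact: finite_measure_integrable_cst.
have cg : {for s, continuous (fun u => \int[P]_w g u w)}.
  apply: (@continuity_under_integral _ _ _ P g setT measurableT 0 (s + 1) _ _ (cst 1)).
  - by move=> x _; exact: ig.
  - apply/nearW => w _ x; rewrite inE/= in_itv/= => /andP[x0 _].
    apply: (@continuous_comp _ _ _ (fun x => x `^ nu * A 1 w) (pois l n)); last exact: continuous_pois.
    by apply: cvgM; [exact: continuous_powR_gt0|exact: cvg_cst].
  - exact: finite_measure_integrable_cst.
  - by move=> x _; apply/nearW => w _ /=; have /andP[? ?] := g01 x w; rewrite ger0_norm.
  - by rewrite inE/= in_itv/= s0/= ltrDl ltr01.
suff : mixed_pois n u @[u --> s] --> mixed_pois n s by [].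
rewrite (E s s0); apply: cvg_trans cg.
apply: near_eq_cvg; near=> u; apply/esym/E.
by near: u; exact: lt_nbhsr.
Unshelve. all: by end_near. Qed.

(** Up to sign, a [j]-fold antiderivative of [mixed_pois n]. On generating functions each tail
    integral divides by [rate h]. *)
Fixpoint iter_tail n j u : R :=
  if j is j'.+1 then \int[mu]_(s in `]u, +oo[) iter_tail n j' s
  else mixed_pois n u.

Let rate_gt0 h : 0 <= h < 1 -> 0 < rate h.
Proof. by move=> /andP[h0 h1]; rewrite powR_gt0// mulr_gt0// subr_gt0. Qed.

Let oy_measurable (g : R -> R) u : 0 <= u -> (forall s, 0 < s -> {for s, continuous g}) ->
  measurable_fun `]u, +oo[ (EFin \o g).
Proof.
move=> u0 cg; apply/measurable_EFinP; apply: open_continuous_measurable_fun.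
  exact: interval_open.
by move=> x; rewrite inE/= in_itv/= andbT => ux; apply: cg; exact: le_lt_trans ux.
Qed.

(** The four facts are proved by one induction, as each tail integral needs continuity, sign and
    integrability of the previous one. The condition [h < 1] keeps [rate h] positive. *)
Let iter_tail_spec j :
  [/\ forall n s, 0 < s -> {for s, continuous (iter_tail n j)},
      forall n s, 0 < s -> 0 <= iter_tail n j s,
      forall h s, 0 <= h < 1 -> 0 < s -> (\sum_(0 <= n <oo) (h ^+ n)%:E * (iter_tail n j s)%:E =
        ((rate h)^-1 ^+ j * expR (- rate h * s))%:E)%E &
      forall n u, 0 < u -> mu.-integrable `]u, +oo[ (EFin \o iter_tail n j)].
Proof.
have step (c : nat -> R -> R) (K : R -> R) : (forall n s, 0 < s -> {for s, continuous (c n)}) ->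
  (forall n s, 0 < s -> 0 <= c n s) ->
  (forall h s, 0 <= h < 1 -> 0 < s -> (\sum_(0 <= n <oo) (h ^+ n)%:E * (c n s)%:E =
    (K h * expR (- rate h * s))%:E)%E) -> (forall h, 0 <= K h) ->
  (forall h u, 0 <= h < 1 -> 0 < u -> (\sum_(0 <= n <oo) (h ^+ n)%:E * \int[mu]_(s in `]u, +oo[) (c n s)%:E =
    (K h * ((rate h)^-1 * expR (- rate h * u)))%:E)%E) /\
  forall n u, 0 < u -> mu.-integrable `]u, +oo[ (EFin \o c n).
  move=> cc c0 cK K0.
  have c0' n u s : 0 < u -> `]u, +oo[%classic s -> 0 <= c n s.
    by move=> u0; rewrite /= in_itv/= andbT => us; apply: c0; exact: lt_trans us.
  have ser h u : 0 <= h < 1 -> 0 < u -> (\sum_(0 <= n <oo) (h ^+ n)%:E * \int[mu]_(s in `]u, +oo[) (c n s)%:E =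
    (K h * ((rate h)^-1 * expR (- rate h * u)))%:E)%E.
    move=> h01 u0; have /andP[h0 _] := h01.
    transitivity (\sum_(0 <= n <oo) \int[mu]_(s in `]u, +oo[) ((h ^+ n)%:E * (c n s)%:E))%E.
      apply: eq_eseriesr => n _; rewrite -ge0_integralZl_EFin//.
      - by move=> s us; rewrite lee_fin (c0' n u).
      - by apply: oy_measurable; [exact: ltW|exact: cc].
      - by rewrite exprn_ge0.
    rewrite -integral_nneseries//; last 2 first.
    - move=> n; apply/measurable_EFinP/measurable_funM => //.
      by move/measurable_EFinP: (oy_measurable (ltW u0) (cc n)).
    - by move=> n s us; rewrite lee_fin mulr_ge0 ?exprn_ge0// (c0' n u).
    transitivity (\int[mu]_(s in `]u, +oo[) ((K h)%:E * (expR (- rate h * s))%:E))%E.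
      apply: eq_integral => s; rewrite inE/= in_itv/= andbT => us.
      by rewrite cK// (lt_trans u0 us).
    rewrite ge0_integralZl_EFin//; last first.
      by apply/measurable_EFinP/measurable_funTS; apply: measurableT_comp.
    by rewrite integral_expR_tail// rate_gt0.
  split => // n u u0; apply/integrableP; split; first by apply: oy_measurable; [exact: ltW|exact: cc].
  have h0 : 0 <= 2^-1 :> R by rewrite invr_ge0.
  have h0' : 0 < 2^-1 :> R by rewrite invr_gt0.
  have h1 : 2^-1 < 1 :> R by rewrite invf_lt1 ?ltr1n.
  have I0 k : (0 <= \int[mu]_(s in `]u, +oo[) (c k s)%:E)%E.
    by apply: integral_ge0 => s us; rewrite lee_fin (c0' k u).
  have -> : (\int[mu]_(x in `]u, +oo[) `|(EFin \o c n) x| = \int[mu]_(x in `]u, +oo[) (c n x)%:E)%E.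
    by apply: eq_integral => s; rewrite inE/= => us; rewrite ger0_norm// (c0' n u).
  rewrite ltey; apply/negP => /eqP E.
  (* Integrability of each term comes from the series: an infinite integral at index [n] would make
     the finite sum at [h = 1/2] infinite. *)
  have := ser 2^-1 u; rewrite h0 h1 => /(_ isT u0) S.
  have := @nneseries_term_le R (fun n => ((2^-1 : R) ^+ n)%:E * \int[mu]_(s in `]u, +oo[) (c n s)%:E)%E n.
  rewrite S E gt0_muley ?lte_fin ?exprn_gt0// leye_eq.
  suff a0 k : (0 <= (2^-1 ^+ k : R)%:E * \int[mu]_(s in `]u, +oo[) (c k s)%:E)%E by move=> /(_ a0).
  by rewrite mule_ge0// lee_fin exprn_ge0.
elim: j => [|j [IHc IH0 IHs IHi]].
  have c0 n s : 0 < s -> {for s, continuous (iter_tail n 0)}.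
    by move=> s0; exact: continuous_mixed_pois.
  have p0 n s : 0 < s -> 0 <= iter_tail n 0 s by move=> s0; exact: mixed_pois_ge0 (ltW s0).
  have S0 h s : 0 <= h < 1 -> 0 < s -> (\sum_(0 <= n <oo) (h ^+ n)%:E * (iter_tail n 0 s)%:E =
        ((rate h)^-1 ^+ 0 * expR (- rate h * s))%:E)%E.
    move=> /andP[h0 h1] s0; rewrite expr0 mul1r -nneseries_mixed_pois ?h0 ?(ltW h1)//.
    exact: ltW.
  split => //.
  have [] := step (fun n => iter_tail n 0) (fun h => (rate h)^-1 ^+ 0) c0 p0 S0 => //.
have Kge0 h : 0 <= (rate h)^-1 ^+ j by rewrite exprn_ge0// invr_ge0 powR_ge0.
have [ser _] := step (fun n => iter_tail n j) (fun h => (rate h)^-1 ^+ j) IHc IH0 IHs Kge0.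
have c0 n s : 0 < s -> {for s, continuous (iter_tail n j.+1)}.
  move=> s0; apply: differentiable_continuous; apply/derivable1_diffP.
  have [] // := is_derive_tail_integral (g := iter_tail n j) (IHc n) (IHi n) s0.
have p0 n s : 0 < s -> 0 <= iter_tail n j.+1 s.
  move=> s0; apply: Rintegral_ge0 => u /=; rewrite in_itv/= andbT => su.
  by apply: IH0; exact: lt_trans su.
have S0 h s : 0 <= h < 1 -> 0 < s -> (\sum_(0 <= n <oo) (h ^+ n)%:E * (iter_tail n j.+1 s)%:E =
        ((rate h)^-1 ^+ j.+1 * expR (- rate h * s))%:E)%E.
  move=> h01 s0; rewrite exprSr -mulrA -ser//; apply: eq_eseriesr => n _; congr (_ * _)%E.
  by rewrite /= /Rintegral fineK//; exact: integrable_fin_num (IHi n s s0).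
split => //.
have [] // := step (fun n => iter_tail n j.+1) (fun h => (rate h)^-1 ^+ j.+1) c0 p0 S0.
by move=> h; rewrite exprn_ge0// invr_ge0 powR_ge0.
Qed.

Lemma iter_tail_ge0 n j s : 0 < s -> 0 <= iter_tail n j s.
Proof. by case: (iter_tail_spec j) => _ + _ _; exact. Qed.

Lemma nneseries_iter_tail h j s : 0 <= h < 1 -> 0 < s ->
  (\sum_(0 <= n <oo) (h ^+ n)%:E * (iter_tail n j s)%:E =
   ((rate h)^-1 ^+ j * expR (- rate h * s))%:E)%E.
Proof. by case: (iter_tail_spec j) => _ _ + _; exact. Qed.

Lemma is_derive_iter_tail n j u : 0 < u ->
  is_derive u 1 (iter_tail n j.+1) (- iter_tail n j u).
Proof.
case: (iter_tail_spec j) => c _ _ i u0.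
exact: (is_derive_tail_integral (g := iter_tail n j) (c n) (i n) u0).
Qed.

(** The value 1 is attained at integer [nu], where the order is [nu + 1]. *)
Let order_ceil : 0 < (rl_order nu)%:R - nu <= 1.
Proof.
have /andP[h1 h2] := truncn_itv (ltW nu_gt0).
by rewrite subr_gt0 h2/= /rl_order -natr1 lerBlDr addrC lerD2l.
Qed.

Lemma rl_kernelE (f : R -> R) u s :
  rl_kernel nu f u s = f s * (s - u) `^ ((rl_order nu)%:R - nu - 1).
Proof. by rewrite /rl_kernel -powRN; congr (_ * _ `^ _); ring. Qed.

(** Kept in the extended reals, since its finiteness will follow from its identification with tail
    integrals. *)
Let rlJ n u : \bar R := (\int[mu]_(s in `]u, +oo[) (rl_kernel nu (mixed_pois n) u s)%:E)%E.

Let rl_kernel_ge0 n u s : 0 < u -> `]u, +oo[%classic s -> 0 <= rl_kernel nu (mixed_pois n) u s.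
Proof.
move=> u0; rewrite /= in_itv/= andbT => us.
by rewrite rl_kernelE mulr_ge0 ?powR_ge0// mixed_pois_ge0// ltW// (lt_trans u0).
Qed.

Let rlJ_ge0 n u : 0 < u -> (0 <= rlJ n u)%E.
Proof. by move=> u0; apply: integral_ge0 => s us; rewrite lee_fin rl_kernel_ge0. Qed.

Let rl_kernel_measurable n u : 0 < u ->
  measurable_fun `]u, +oo[ (fun s => (rl_kernel nu (mixed_pois n) u s)%:E).
Proof.
move=> u0; apply/measurable_EFinP.
rewrite (_ : rl_kernel _ _ _ = (fun s => mixed_pois n s * (s - u) `^ ((rl_order nu)%:R - nu - 1))).
  apply: measurable_funM.
    have := @oy_measurable (mixed_pois n) u (ltW u0) (@continuous_mixed_pois n).
    by move/measurable_EFinP.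
  apply: measurable_funTS; apply: (measurableT_comp (measurable_powR _)).
  exact: measurable_funB.
by apply/funext => s; rewrite rl_kernelE.
Qed.

Let nneseries_rlJ h u : 0 <= h < 1 -> 0 < u ->
  (\sum_(0 <= n <oo) (h ^+ n)%:E * rlJ n u =
   (Gamma ((rl_order nu)%:R - nu) * rate h `^ (- ((rl_order nu)%:R - nu)) * expR (- rate h * u))%:E)%E.
Proof.
move=> h01 u0; have /andP[h0 h1] := h01.
transitivity (\sum_(0 <= n <oo) \int[mu]_(s in `]u, +oo[) ((h ^+ n)%:E * (rl_kernel nu (mixed_pois n) u s)%:E))%E.
  apply: eq_eseriesr => n _; rewrite -ge0_integralZl_EFin//.
  - by move=> s us; rewrite lee_fin rl_kernel_ge0.
  - exact: rl_kernel_measurable.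
  - by rewrite exprn_ge0.
rewrite -integral_nneseries//; last 2 first.
- move=> n; apply/measurable_EFinP/measurable_funM => //.
  by have /measurable_EFinP := rl_kernel_measurable n u0.
- by move=> n s us; rewrite lee_fin mulr_ge0 ?exprn_ge0// rl_kernel_ge0.
rewrite -integral_expR_powR ?rate_gt0//; apply: eq_integral => s.
rewrite inE/= in_itv/= andbT => us.
set k := (s - u) `^ ((rl_order nu)%:R - nu - 1).
transitivity (\sum_(0 <= n <oo) k%:E * ((h ^+ n)%:E * (mixed_pois n s)%:E))%E.
  by apply: eq_eseriesr => n _; rewrite rl_kernelE -!EFinM; congr EFin; rewrite -/k; ring.
have s0 : 0 <= s by rewrite ltW// (lt_trans u0).
rewrite nneseriesZl; last by move=> n _; rewrite lee_fin mulr_ge0 ?exprn_ge0 ?mixed_pois_ge0.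
by rewrite nneseries_mixed_pois ?h0 ?(ltW h1)// -EFinM mulrC.
Qed.

Definition iter_tail_pred n j u : R := if n is n'.+1 then iter_tail n' j u else 0.

Let iter_tail_pred_ge0 n j u : 0 < u -> 0 <= iter_tail_pred n j u.
Proof. by case: n => //= n; exact: iter_tail_ge0. Qed.

(* Both sides are compared through their generating functions in [n]. *)
Let rlJE n u : 0 < u -> rlJ n u = (l * Gamma ((rl_order nu)%:R - nu) *
  (iter_tail n (rl_order nu) u - iter_tail_pred n (rl_order nu) u))%:E.
Proof.
move=> u0; set m := rl_order nu; set a := m%:R - nu; set K := l * Gamma a.
have K0 : 0 <= K by rewrite mulr_ge0 ?ltW ?Gamma_gt0.
(* The term of index [n - 1] is moved to the left, so that both sequences of coefficients are
   nonnegative as [power_series_unique] requires. *)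
have S h : 0 <= h < 1 -> (\sum_(0 <= n <oo) (h ^+ n)%:E *
    (rlJ n u + (K * iter_tail_pred n m u)%:E) =
    (K * ((rate h)^-1 ^+ m * expR (- rate h * u)))%:E)%E.
  move=> h01; have /andP[h0 h1] := h01; have rh0 := rate_gt0 h01.
  transitivity (\sum_(0 <= n <oo) ((h ^+ n)%:E * rlJ n u +
      (h ^+ n)%:E * (K * iter_tail_pred n m u)%:E))%E.
    by apply: eq_eseriesr => k _; rewrite ge0_muleDr ?rlJ_ge0// lee_fin mulr_ge0 ?iter_tail_pred_ge0.
  rewrite nneseriesD; last 2 first.
  - by move=> k _ _; rewrite mule_ge0 ?rlJ_ge0// lee_fin exprn_ge0.
  - by move=> k _ _; rewrite lee_fin mulr_ge0 ?exprn_ge0// mulr_ge0 ?iter_tail_pred_ge0.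
  rewrite nneseries_rlJ//.
  rewrite [X in (_ + X)%E](nneseries_recl (f := fun n => (h ^+ n)%:E * (K * iter_tail_pred n m u)%:E)%E); last first.
    by move=> k; rewrite lee_fin mulr_ge0 ?exprn_ge0// mulr_ge0 ?iter_tail_pred_ge0.
  rewrite /= mulr0 mule0 add0e.
  rewrite (_ : (\sum_(0 <= k <oo) (h ^+ k.+1)%:E * (K * iter_tail k m u)%:E)%E =
     (\sum_(0 <= k <oo) (h * K)%:E * ((h ^+ k)%:E * (iter_tail k m u)%:E))%E); last first.
    by apply: eq_eseriesr => k _; rewrite -!EFinM exprS; congr EFin; ring.
  rewrite nneseriesZl; last by move=> k _; rewrite lee_fin mulr_ge0 ?exprn_ge0 ?iter_tail_ge0.
  rewrite nneseries_iter_tail// -EFinM -EFinD; congr EFin.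
  (* The fractional power becomes an integer one at the price of [rate h ^ nu = l (1 - h)], whose
     two terms give the indices [n] and [n - 1]. *)
  have -> : rate h `^ (- a) = (rate h)^-1 ^+ m * (l * (1 - h)).
    have rnu : rate h `^ nu = l * (1 - h).
      rewrite /rate -powRrM div1r mulVf ?gt_eqF// powRr1// mulr_ge0 ?ltW// subr_gt0.
      by [].
    rewrite -rnu exprVn -powR_mulrn ?ltW// -powRN -powRD; last by rewrite (gt_eqF rh0) implybT.
    by congr (_ `^ _); rewrite /a; ring.
  by rewrite /K; ring.
have H : (rlJ n u + (K * iter_tail_pred n m u)%:E = (K * iter_tail n m u)%:E)%E.
  have h2 : 0 <= (2^-1 : R) < 1 by rewrite invr_ge0 invf_lt1 ?ltr1n ?ler0n ?ltr0n.
  apply: (@power_series_unique R (fun n => rlJ n u + (K * iter_tail_pred n m u)%:E)%E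
    (fun n => (K * iter_tail n m u)%:E)%E).
  - by move=> k; rewrite adde_ge0 ?rlJ_ge0// lee_fin mulr_ge0 ?iter_tail_pred_ge0.
  - by move=> k; rewrite lee_fin mulr_ge0 ?iter_tail_ge0.
  - by rewrite S// ltry.
  - move=> h /andP[h0 hh]; have h01 : 0 <= h < 1.
      by rewrite ltW//= (le_lt_trans hh)//; case/andP: h2.
    rewrite S//; transitivity (\sum_(0 <= n <oo) K%:E * ((h ^+ n)%:E * (iter_tail n m u)%:E))%E; last first.
      by apply: eq_eseriesr => k _; rewrite -!EFinM; congr EFin; ring.
    rewrite nneseriesZl; last first.
      by move=> k _; rewrite lee_fin mulr_ge0 ?exprn_ge0 ?iter_tail_ge0// ltW.
    by rewrite nneseries_iter_tail// -EFinM.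
have /(congr1 (fun x => x - (K * iter_tail_pred n m u)%:E)%E) := H.
by rewrite addeK// -EFinB mulrBr.
Qed.

Let integrable_rl_kernel n u : 0 < u ->
  mu.-integrable `]u, +oo[ (fun s => (rl_kernel nu (mixed_pois n) u s)%:E).
Proof.
move=> u0; apply/integrableP; split; first exact: rl_kernel_measurable.
rewrite (_ : (\int[mu]_(x in _) _)%E = rlJ n u); first by rewrite rlJE// ltry.
by apply: eq_integral => s; rewrite inE/= => us; rewrite ger0_norm// rl_kernel_ge0.
Qed.

Definition mixed_pois_pred n s : R := if n is n'.+1 then mixed_pois n' s else 0.

Let iter_tail_pred0 n s : iter_tail_pred n 0 s = mixed_pois_pred n s.
Proof. by case: n. Qed.

Variables (K : nat) (w : nat -> R) (p : R -> R).
Hypothesis pE : forall s, 0 < s -> p s = \sum_(n < K) w n * mixed_pois n s.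

Let diff n j u := iter_tail n j u - iter_tail_pred n j u.

Let rl_kernel_sum u s : 0 < u -> u < s ->
  rl_kernel nu p u s = \sum_(n < K) w n * rl_kernel nu (mixed_pois n) u s.
Proof.
move=> u0 us; rewrite rl_kernelE pE ?(lt_trans u0)// mulr_suml.
by apply: eq_bigr => n _; rewrite rl_kernelE mulrA.
Qed.

Let rl_kernel_sum_integrable u : 0 < u ->
  mu.-integrable `]u, +oo[ (fun s => (rl_kernel nu p u s)%:E).
Proof.
move=> u0.
apply: (@eq_integrable _ _ _ mu _ _
  (fun s => \sum_(n < K) ((w n)%:E * (rl_kernel nu (mixed_pois n) u s)%:E))%E) => //.
  move=> s; rewrite inE/= in_itv/= andbT => us.
  by rewrite rl_kernel_sum// -sumEFin; apply: eq_bigr => n _; rewrite EFinM.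
by apply: integrable_sum => // n _; apply: integrableZl => //; exact: integrable_rl_kernel.
Qed.

Let rl_integralE u : 0 < u -> rl_integral nu p u =
  \sum_(n < K) w n * (l * Gamma ((rl_order nu)%:R - nu) * diff n (rl_order nu) u).
Proof.
move=> u0; apply: EFin_inj; rewrite /rl_integral /Rintegral fineK; last first.
  exact: integrable_fin_num (rl_kernel_sum_integrable u0).
transitivity (\int[mu]_(s in `]u, +oo[)
    (\sum_(n < K) ((w n)%:E * (rl_kernel nu (mixed_pois n) u s)%:E)))%E.
  apply: eq_integral => s; rewrite inE/= in_itv/= andbT => us.
  by rewrite rl_kernel_sum// -sumEFin; apply: eq_bigr => n _; rewrite EFinM.
rewrite integral_sum//; last first.
  by move=> n; apply: integrableZl => //; exact: integrable_rl_kernel.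
rewrite -sumEFin; apply: eq_bigr => n _.
rewrite integralZl//; last exact: integrable_rl_kernel.
by rewrite -/(rlJ n u) rlJE.
Qed.

Let is_derive_diff n j u : 0 < u -> is_derive u 1 (diff n j.+1) (- diff n j u).
Proof.
move=> u0.
have D : is_derive u 1 (iter_tail n j.+1 - iter_tail_pred n j.+1)
    (- iter_tail n j u - - iter_tail_pred n j u).
  apply: is_deriveB; first exact: is_derive_iter_tail.
  by case: n => [|n] /=; [rewrite oppr0; exact: is_derive_cst|exact: is_derive_iter_tail].
by rewrite /diff opprB addrC -[iter_tail_pred n j u]opprK.
Qed.

(** At [j = rl_order nu] this is [rl_integral nu p]; every derivative lowers [j] by one and changes
    the sign. *)
Let G j u := \sum_(n < K) w n * (l * Gamma ((rl_order nu)%:R - nu) * diff n j u).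

Let is_derive_G j u : 0 < u -> is_derive u 1 (G j.+1) (- G j u).
Proof.
move=> u0.
have -> : G j.+1 = \sum_(n < K) ((w n * (l * Gamma ((rl_order nu)%:R - nu))) *: diff n j.+1).
  by apply/funext => s; rewrite /G fct_sumE; apply: eq_bigr => n _; rewrite mulrA.
rewrite /G -sumrN.
apply: is_derive_sum => n.
rewrite (_ : - (w n * _) = (w n * (l * Gamma ((rl_order nu)%:R - nu))) *: - diff n j u).
  by apply: is_deriveZ; exact: is_derive_diff.
by rewrite /GRing.scale/=; ring.
Qed.

Let derive1n_rl_integral j u : (j <= rl_order nu)%N -> 0 < u ->
  derive1n j (rl_integral nu p) u = (-1) ^+ j * G (rl_order nu - j) u.
Proof.
elim: j u => [|j IH] u jm u0; first by rewrite derive1n0 expr0 mul1r subn0 rl_integralE.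
rewrite derive1nS derive1E.
have D : is_derive u 1 ((-1) ^+ j *: G (rl_order nu - j)) ((-1) ^+ j *: - G (rl_order nu - j.+1) u).
  by apply: is_deriveZ; rewrite -[(rl_order nu - j)%N]prednK ?subn_gt0// -subnS; exact: is_derive_G.
have E : \forall x \near u, derive1n j (rl_integral nu p) x = ((-1) ^+ j *: G (rl_order nu - j)) x.
  by near=> x; rewrite IH ?(ltnW jm)//; near: x; exact: lt_nbhsr.
by rewrite (near_eq_derive _ E) derive_val exprS /GRing.scale/=; ring.
Unshelve. all: by end_near. Qed.

(** After all the derivatives the tail integrals are undone and [G 0] remains; its sign cancels
    against that of the fractional derivative, and its Gamma factor against the normalisation. *)
Lemma is_rl_derive_mixture t : 0 < t ->
  is_rl_derive nu p t (l * \sum_(n < K) w n * (mixed_pois n t - mixed_pois_pred n t)).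
Proof.
move=> t0; split.
- by near=> u; apply: rl_kernel_sum_integrable; near: u; exact: lt_nbhsr.
- move=> j jm; near=> u; have u0 : 0 < u by near: u; exact: lt_nbhsr.
  have D : is_derive u 1 ((-1) ^+ j *: G (rl_order nu - j)) ((-1) ^+ j *: - G (rl_order nu - j.+1) u).
    by apply: is_deriveZ; rewrite -[(rl_order nu - j)%N]prednK ?subn_gt0// -subnS; exact: is_derive_G.
  have [D1 _] := D; apply: near_eq_derivable D1.
  near=> x; rewrite derive1n_rl_integral ?(ltnW jm)//.
  by near: x; exact: lt_nbhsr.
- rewrite /rl_derive derive1n_rl_integral// subnn mulrA -exprMn mulrNN mul1r expr1n mul1r.
  rewrite /G mulr_sumr mulr_sumr; apply: eq_bigr => n _.
  have g0 := Gamma_gt0 order_ceil.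
  rewrite /diff iter_tail_pred0 /=.
  by field; rewrite gt_eqF.
Unshelve. all: by end_near. Qed.

End poisson_stable_mixture.

(** * Size-biased law of a stable variable *)

Lemma expR_powR (R : realType) (x p : R) : expR x `^ p = expR (p * x).
Proof. by rewrite /powR gt_eqF ?expR_gt0// expRK. Qed.

(* The substitution is [s = t a / (a + r)]. *)
Lemma beta_substitution (R : realType) (nu a t : R) (g : R -> R) :
  0 < a -> 0 < t -> continuous g -> (forall x, 0 <= g x) ->
  (\int[@lebesgue_measure R]_(s in `]0%R, t[)
     (a `^ (- nu) * ((t - s) `^ (- nu) * s `^ (nu - 1)) * g (s `^ nu * a `^ (- nu)))%:E =
   \int[@lebesgue_measure R]_(r in `]0%R, +oo[)
     (r `^ (- nu) * (a + r) `^ (- 1) * g (t `^ nu * (a + r) `^ (- nu)))%:E)%E.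
Proof.
move=> a0 t0 cg g0.
have ar0 r : 0 < r -> 0 < a + r by move=> r0; rewrite addr_gt0.
have dF (r : R) : 0 < r -> is_derive r 1 (fun r => t * a * (a + r)^-1) (- (t * a / (a + r) ^+ 2)).
  move=> r0; have D1 : is_derive r 1 (fun r => a + r) 1.
    have D2 : is_derive r 1 (cst a + @id R) (0 + 1) by exact: is_deriveD.
    by rewrite -[X in is_derive _ _ _ X]add0r.
  have D3 : is_derive r 1 (fun r => (a + r)^-1) (- (a + r) ^- 2 *: 1).
    by apply: is_deriveV => //; rewrite gt_eqF// ar0.
  have D4 : is_derive r 1 ((t * a) *: (fun r => (a + r)^-1)) ((t * a) *: (- (a + r) ^- 2 *: 1)).
    exact: is_deriveZ.
  rewrite (_ : - (t * a / (a + r) ^+ 2) = (t * a) *: (- (a + r) ^- 2 *: 1)) //.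
  by rewrite /GRing.scale/= mulr1 mulrN.
rewrite (@decreasing_ge0_substitution_oy _ (fun r : R => t * a * (a + r)^-1)
  (fun r => - (t * a / (a + r) ^+ 2)) _ `]0, t[ dF).
- apply: eq_integral => r; rewrite inE/= in_itv/= andbT => r0; congr EFin.
  have s0 := ar0 r r0; have sN0 : a + r != 0 by rewrite gt_eqF.
  have -> : t - t * a * (a + r)^-1 = t * r * (a + r)^-1 by field.
  rewrite opprK.
  set S := a + r in s0 sN0 *.
  (* All factors are written as exponentials of logarithms, so that the identity between powers
     becomes a linear one between exponents. *)
  rewrite -(lnK a0) -(lnK t0) -(lnK r0) -(lnK s0) -expRN -!expRD !expR_powR -!expRD.
  rewrite -expRM_natl -expRN -!expRD.
  rewrite (_ : nu * _ + - nu * ln a = nu * ln t + - nu * ln S); last by ring.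
  rewrite mulrAC -expRD; congr (expR _ * _); ring.
- move=> r r0; apply: cvgN; apply: cvgM; first exact: cvg_cst.
  apply: cvgV; first by rewrite expf_neq0// gt_eqF// ar0.
  have c (x : R) : a + y @[y --> x] --> a + x by apply: cvgD; [exact: cvg_cst|exact: cvg_id].
  exact: (cvgM (c r) (c r)).
- move=> s; rewrite in_itv/= => /andP[s0 st]; apply: cvgM; last first.
    apply: (@continuous_comp _ _ _ (fun s => s `^ nu * a `^ (- nu)) g); last exact: cg.
    by apply: cvgM; [exact: continuous_powR_gt0|exact: cvg_cst].
  apply: cvgM; first exact: cvg_cst; apply: cvgM; last exact: continuous_powR_gt0.
  apply: (@continuous_comp _ _ _ (fun s => t - s) (@powR R ^~ (- nu))).
    by apply: cvgB; [exact: cvg_cst|exact: cvg_id].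
  by apply: continuous_powR_gt0; rewrite subr_gt0.
- by move=> s _; rewrite !mulr_ge0 ?powR_ge0.
- move=> r r0; rewrite in_itv/=; apply/andP; split.
    by rewrite divr_gt0 ?ar0// mulr_gt0.
  by rewrite ltr_pdivrMr ?ar0// ltr_pM2l// ltrDl.
- move=> s; rewrite in_itv/= => /andP[s0 st]; exists (a * (t - s) / s).
    by rewrite divr_gt0 ?mulr_gt0 ?subr_gt0.
  have sN0 : s != 0 by rewrite gt_eqF.
  have -> : a + a * (t - s) / s = a * t / s by field.
  by field; rewrite !gt_eqF.
- move=> x y x0 xy; rewrite ltr_pM2l ?mulr_gt0// ltf_pV2 ?posrE ?ar0 ?ltrD2l//.
  exact: lt_trans xy.
- by move=> r r0; rewrite oppr_le0 !mulr_ge0 ?invr_ge0 ?sqr_ge0 ?ltW.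
Qed.

Lemma lebesgue_itvoo_lty (R : realType) (a b : R) :
  (lebesgue_measure (`]a, b[%classic : set R) < +oo)%E.
Proof. by rewrite lebesgue_measure_itv/= lte_fin; case: ifPn => _; rewrite ?ltry. Qed.

Section product_sigma_finite.
Context d (T : measurableType d) (R : realType) (P : probability T R).

Let product_lebesgue_sigma_finite : sigma_finite setT (P \x @lebesgue_measure R)%E.
Proof.
exists (fun n : nat => setT `*` `](- n%:R), n%:R[%classic).
  apply/seteqP; split => // -[w r] _; exists (Num.truncn `|r|).+1 => //=; split => //.
  by rewrite /= in_itv/= -ltr_norml truncnS_gt.
move=> n; split; first exact: measurableX.
have mI : measurable (`](- n%:R), n%:R[%classic : set R) by exact: measurable_itv.
apply: (@le_lt_trans _ _ (P setT * lebesgue_measure (`](- n%:R)%R, n%:R%R[%classic : set R))%E).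
  by have := product_measure1E P (@lebesgue_measure R) measurableT mI => /= <-.
by rewrite probability_setT mul1e; exact: lebesgue_itvoo_lty.
Qed.

Let product_lebesgue_mixin := Measure_isSigmaFinite.Build _ _ _
  (P \x @lebesgue_measure R)%E product_lebesgue_sigma_finite.

(** The layer-cake formula takes a sigma-finite measure; this packs the product with that structure,
    the slabs over []-n, n[] having finite mass. *)
Definition product_lebesgue :
    {sigma_finite_measure set (T * measurableTypeR R)%type -> \bar R} :=
  HB.pack_for {sigma_finite_measure set (T * measurableTypeR R)%type -> \bar R}
    (P \x @lebesgue_measure R)%E product_lebesgue_mixin.

End product_sigma_finite.

Section stable_size_bias.
Context d (T : measurableType d) (R : realType) (P : probability T R).
Notation mu := (@lebesgue_measure R).
Variables (nu : R) (A : R -> T -> R).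
Hypotheses (nu01 : 0 < nu < 1) (sA : stable_subordinator P nu A).
Implicit Types (s t th a r x : R) (w : T).

Let nu_gt0 : 0 < nu. Proof. by case/andP: nu01. Qed.
Let nu_lt1 : nu < 1. Proof. by case/andP: nu01. Qed.
Let onemnu : 0 < 1 - nu <= 1. Proof. by rewrite subr_gt0 nu_lt1/= gerBl ltW. Qed.
Let mA1 : measurable_fun setT (A 1). Proof. exact: (stable_measurable sA). Qed.
Let A1_ge0 w : 0 <= A 1 w. Proof. exact: (stable_ge0 sA). Qed.

Let mexpA th : measurable_fun setT (fun w => expR (- th * A 1 w)).
Proof. by apply: measurableT_comp => //; exact: measurable_funM. Qed.

Let iexpA th : 0 <= th -> P.-integrable setT (EFin \o (fun w => expR (- th * A 1 w))).
Proof.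
move=> th0; apply: (@le_integrable _ _ _ P _ measurableT _ (cst 1%E)).
- exact/measurable_EFinP.
- move=> w _ /=; rewrite lee_fin normr1 ger0_norm ?expR_ge0//.
  by rewrite expR_le1 mulNr oppr_le0 mulr_ge0.
- exact: finite_measure_integrable_cst.
Qed.

Lemma mulr_expRN_le x a : 0 < a -> 0 <= x -> x * expR (- a * x) <= a^-1.
Proof.
move=> a0 x0; rewrite mulNr expRN ler_pdivrMr ?expR_gt0// mulrC ler_pdivlMr// mulrC.
by apply: le_trans (expR_ge1Dx _); rewrite lerDr.
Qed.

(** Derivative in [th] of the Laplace transform [exp (- th^nu)] of [A 1], taken under the
    expectation. *)
Lemma integral_stable_size_bias th : 0 < th ->
  (\int[P]_w (A 1 w * expR (- th * A 1 w))%:E =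
   (nu * th `^ (nu - 1) * expR (- (th `^ nu)))%:E)%E.
Proof.
move=> th0; have th2 : 0 < th / 2 by rewrite divr_gt0.
have dexp w x : is_derive x 1 (fun y => expR (- y * A 1 w)) (- A 1 w * expR (- x * A 1 w)).
  have D : is_derive x 1 (fun y => - y * A 1 w) (- A 1 w).
    have D1 : is_derive x 1 (- A 1 w *: (@id R)) (- A 1 w *: 1) by exact: is_deriveZ.
    rewrite (_ : (fun y => - y * A 1 w) = - A 1 w *: (@id R)).
      by rewrite -[X in is_derive _ _ _ X]mulr1.
    by apply/funext => y; rewrite fctE /GRing.scale/= mulNr mulrC mulNr.
  by rewrite mulrC; apply: (@is_derive1_comp _ expR (fun y => - y * A 1 w)).
have iA : P.-integrable setT (EFin \o (fun w => A 1 w * expR (- th * A 1 w))).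
  apply: (@le_integrable _ _ _ P _ measurableT _ (cst (th^-1)%:E)).
  - by apply/measurable_EFinP/measurable_funM.
  - move=> w _ /=; rewrite lee_fin normrM !ger0_norm ?expR_ge0 ?invr_ge0 ?(ltW th0)//.
    exact: mulr_expRN_le.
  - exact: finite_measure_integrable_cst.
(* For parameters in []th/2, th + 1[] the derivative is bounded by [(th/2)^-1], by [mulr_expRN_le];
   no moment of [A 1] is involved. *)
have := @differentiation_under_integral _ _ _ P (fun th w => expR (- th * A 1 w)) setT measurableT
  th (th / 2) (th + 1) _ _ _ (cst (th / 2)^-1).
have -> : derive1 (fun x' => \int[P]_w expR (- x' * A 1 w)) th = - (nu * th `^ (nu - 1) * expR (- (th `^ nu))).
  rewrite derive1E.
  have D : is_derive th 1 (fun x => expR (- (x `^ nu))) (- (nu * th `^ (nu - 1) * expR (- (th `^ nu)))).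
    have D1 : is_derive th 1 (- (@powR R ^~ nu)) (- (nu * th `^ (nu - 1))).
      by apply: is_deriveN; exact: is_derive1_powR.
    rewrite (_ : - (_ * expR _) = expR (- th `^ nu) * - (nu * th `^ (nu - 1))); last by ring.
    have D2 := @is_derive1_comp R expR (- (@powR R ^~ nu)) th _ _ (is_derive_expR _) D1.
    exact: D2.
  rewrite -(derive_val (is_derive := D)); apply: near_eq_derive.
  near=> x; apply: EFin_inj; have x0 : 0 <= x by apply: ltW; near: x; exact: lt_nbhsr.
  rewrite /Rintegral fineK; last exact: integrable_fin_num (iexpA x0).
  by rewrite (integral_stable_expR sA)// mulr1.
have -> : \int[P]_w partial1of2 (fun th w => expR (- th * A 1 w)) th w = - \int[P]_w (A 1 w * expR (- th * A 1 w)).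
  rewrite -mulN1r -RintegralZl//.
  apply: eq_Rintegral => w _.
  by rewrite /partial1of2 derive1E (derive_val (is_derive := dexp w th)) mulN1r mulNr.
move=> H; suff E : nu * th `^ (nu - 1) * expR (- th `^ nu) = \int[P]_w (A 1 w * expR (- th * A 1 w)).
  by rewrite E /Rintegral fineK//; exact: integrable_fin_num iA.
apply: oppr_inj; apply: H.
- by rewrite /= in_itv/= ltr_pdivrMr// ltr_pMr// ltr1n/= ltrDl.
- move=> x; rewrite /= in_itv/= => /andP[x0 _]; apply: iexpA.
  by rewrite ltW// (lt_trans th2).
- by move=> x w _ _; have [] := dexp w x.
- by move=> w; rewrite /= invr_ge0 ltW.
- exact: finite_measure_integrable_cst.
- move=> x w; rewrite /= in_itv/= => /andP[x0 _] _.
  rewrite /partial1of2 derive1E (derive_val (is_derive := dexp w x)).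
  rewrite normrM normrN !ger0_norm ?expR_ge0//.
  apply: le_trans (mulr_expRN_le th2 (A1_ge0 w)).
  by rewrite ler_wpM2l// ler_expR !mulNr lerN2 ler_wpM2r// ltW.
Unshelve. all: by end_near. Qed.

Lemma integral_indicr (D : set R) (H : T * R -> R) : measurable D ->
  measurable_fun setT H -> (forall p, 0 <= H p) ->
  (\int[product_lebesgue P]_p (\1_D p.2 * H p)%:E =
   \int[P]_w \int[mu]_(r in D) (H (w, r))%:E)%E /\
  (\int[product_lebesgue P]_p (\1_D p.2 * H p)%:E =
   \int[mu]_(r in D) \int[P]_w (H (w, r))%:E)%E.
Proof.
move=> mD mH H0.
have mf : measurable_fun setT (fun p : T * R => (\1_D p.2 * H p)%:E).
  apply/measurable_EFinP/measurable_funM => //.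
  by apply: measurableT_comp; [exact: measurable_indic|exact: measurable_snd].
have f0 (p : T * R) : (0 <= (\1_D p.2 * H p)%:E)%E by rewrite lee_fin mulr_ge0.
split.
- transitivity (\int[P]_w fubini_F mu (fun p : T * R => (\1_D p.2 * H p)%:E) w)%E.
    exact: (fubini_tonelli1 (m1 := P) (m2 := @lebesgue_measure R) _ mf f0).
  apply: eq_integral => w _; rewrite /fubini_F /= [RHS]integral_mkcond.
  apply: eq_integral => r _; rewrite /patch indicE.
  by case: ifPn => _; rewrite ?mul1r ?mul0r.
- transitivity (\int[mu]_r fubini_G P (fun p : T * R => (\1_D p.2 * H p)%:E) r)%E.
    exact: (fubini_tonelli2 (m1 := P) (m2 := @lebesgue_measure R) _ mf f0).
  rewrite [RHS]integral_mkcond; apply: eq_integral => r _; rewrite /fubini_G /= /patch indicE.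
  case: ifPn => _; first by apply: eq_integral => w _; rewrite mul1r.
  by apply: integral0_eq => w _; rewrite mul0r.
Qed.

(** The constant for which [kappa r^(-nu)] has Laplace transform [nu th^(nu - 1)]; this function is
    [r] times the density of the Levy measure of [A]. *)
Let kappa : R := nu / Gamma (1 - nu).
Let kappa_ge0 : 0 <= kappa.
Proof. by rewrite divr_ge0 ?ltW// Gamma_gt0. Qed.

(* The size-biased law of [A 1] is, up to a constant, the convolution of the law of
   [A 1] with the density [r^(-nu)]: differentiating the Laplace transform
   [exp (- th^nu)] multiplies it by [- nu th^(nu - 1)]. *)
Lemma size_bias_convolution (G : R -> R) : measurable_fun setT G -> (forall x, 0 <= G x) ->
  (\int[P]_w (A 1 w * expR (- A 1 w) * G (A 1 w))%:E =
   \int[P]_w \int[mu]_(r in `]0%R, +oo[)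
     (kappa * (r `^ (- nu) * expR (- (A 1 w + r))) * G (A 1 w + r))%:E)%E.
Proof.
move=> mG G0.
(* Both sides are tilted by [exp (- x)]: the weight becomes integrable although [r^(-nu)] is not,
   and the transform is evaluated at [th + 1], which is positive even for [th = 0]. *)
pose V (p : T * R) : R := kappa * (p.2 `^ (- nu) * expR (- (A 1 p.1 + p.2))).
pose w2 (p : T * R) : R := \1_(`]0, +oo[%classic) p.2 * V p.
(* The absolute value makes [X2] nonnegative on the whole product; [w2] vanishes where it changes
   anything. *)
pose X2 (p : T * R) : R := A 1 p.1 + `|p.2|.
have mV : measurable_fun setT V.
  apply: measurable_funM => //; apply: measurable_funM.
    by apply: (measurableT_comp (measurable_powR _)).
  apply: measurableT_comp => //; apply: measurable_funN; apply: measurable_funD => //.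
  exact: measurableT_comp.
have V0 p : 0 <= V p by rewrite mulr_ge0// mulr_ge0 ?powR_ge0 ?expR_ge0.
have mind : measurable_fun setT (fun p : T * R => \1_(`]0, +oo[%classic) p.2 : R).
  by apply: measurableT_comp; [exact: measurable_indic|exact: measurable_snd].
have mw2 : measurable_fun setT w2 by exact: measurable_funM.
have w2_ge0 p : 0 <= w2 p by rewrite mulr_ge0.
have mX2 : measurable_fun setT X2.
  apply: measurable_funD; first exact: measurableT_comp.
  by apply: measurableT_comp => //; exact: measurable_snd.
have X2_ge0 p : 0 <= X2 p by rewrite addr_ge0.
have iter (h : R -> R) : measurable_fun setT h -> (forall x, 0 <= h x) ->
  (\int[product_lebesgue P]_p (w2 p * h (X2 p))%:E =
   \int[P]_w \int[mu]_(r in `]0%R, +oo[) (V (w, r) * h (A 1 w + r))%:E)%E.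
  move=> mh h0.
  have [E _] := @integral_indicr `]0, +oo[%classic (fun p => V p * h (X2 p)) (measurable_itv _)
    (measurable_funM mV (measurableT_comp mh mX2)) (fun p => mulr_ge0 (V0 p) (h0 _)).
  transitivity (\int[P]_w \int[mu]_(r in `]0%R, +oo[) (V (w, r) * h (X2 (w, r)))%:E)%E.
    by rewrite -E; apply: eq_integral => p _; rewrite mulrA.
  apply: eq_integral => w _; apply: eq_integral => r; rewrite inE/= in_itv/= andbT => r0.
  by rewrite /X2/= gtr0_norm.
have lap th : 0 <= th -> (\int[product_lebesgue P]_p (w2 p * expR (- th * X2 p))%:E =
    (nu * (th + 1) `^ (nu - 1) * expR (- ((th + 1) `^ nu)))%:E)%E.
  move=> th0; have th1 : 0 < th + 1 by rewrite ltr_wpDl.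
  rewrite (iter (fun x => expR (- th * x))); first last.
  - by move=> x; exact: expR_ge0.
  - by apply: measurableT_comp => //; exact: measurable_funM.
  transitivity (\int[P]_w ((nu * (th + 1) `^ (nu - 1))%:E * (expR (- (th + 1) * A 1 w))%:E))%E.
    apply: eq_integral => w _.
    transitivity (\int[mu]_(r in `]0%R, +oo[) ((kappa * expR (- (th + 1) * A 1 w))%:E *
        (expR (- (th + 1) * r) * (r - 0) `^ (1 - nu - 1))%:E))%E.
      apply: eq_integral => r _; rewrite -EFinM; congr EFin; rewrite /V/=.
      have -> : 1 - nu - 1 = - nu by ring.
      have -> : expR (- (th + 1) * A 1 w) = expR (- th * A 1 w) * expR (- A 1 w).
        by rewrite -expRD; congr expR; ring.
      have -> : expR (- (th + 1) * r) = expR (- th * r) * expR (- r).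
        by rewrite -expRD; congr expR; ring.
      by rewrite subr0 mulrDr opprD !expRD; ring.
    rewrite ge0_integralZl_EFin//; last 3 first.
    - by move=> r _; rewrite lee_fin mulr_ge0 ?powR_ge0 ?expR_ge0.
    - apply/measurable_EFinP/measurable_funTS/measurable_funM.
        by apply: measurableT_comp => //; exact: measurable_funM.
      by apply: (measurableT_comp (measurable_powR _)); exact: measurable_funB.
    - by rewrite mulr_ge0 ?expR_ge0.
    rewrite integral_expR_powR// -!EFinM; congr EFin; rewrite mulr0 expR0 mulr1.
    rewrite opprB /kappa; field.
    by rewrite gt_eqF// Gamma_gt0.
  rewrite ge0_integralZl_EFin//; last 2 first.
  - exact/measurable_EFinP.
  - by rewrite mulr_ge0 ?powR_ge0// ltW.
  by rewrite (integral_stable_expR sA) ?(ltW th1)// mulr1.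
have iw2 : (product_lebesgue P).-integrable setT (EFin \o w2).
  apply/integrableP; split; first exact/measurable_EFinP.
  have := lap 0 (lexx _); under eq_integral do rewrite oppr0 mul0r expR0 mulr1.
  move=> E; under eq_integral do rewrite /= ger0_norm//.
  by rewrite E ltry.
rewrite -(iter G)//.
apply: (@laplace_unique_integral _ _ _ _ R P (product_lebesgue P)
  (fun w => A 1 w * expR (- A 1 w)) (A 1) w2 X2 G) => //.
- apply: measurable_funM => //; apply: measurableT_comp => //; exact: measurable_funN.
- by move=> w; rewrite mulr_ge0 ?expR_ge0.
- apply: (@le_integrable _ _ _ P _ measurableT _ (cst 1%E)).
  + apply/measurable_EFinP/measurable_funM => //.
    by apply: measurableT_comp => //; exact: measurable_funN.
  + move=> w _ /=; rewrite lee_fin normr1 ger0_norm ?mulr_ge0 ?expR_ge0//.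
    by have := mulr_expRN_le ltr01 (A1_ge0 w); rewrite mulN1r invr1.
  + exact: finite_measure_integrable_cst.
- move=> th th0; rewrite lap// -integral_stable_size_bias ?ltr_wpDl//.
  apply: eq_integral => w _; congr EFin.
  by rewrite opprD mulrDl mulN1r expRD; ring.
Qed.

Lemma measurable_integral_section1 (D : set R) (H : T * R -> R) : measurable D ->
  measurable_fun setT H -> (forall p, 0 <= H p) ->
  measurable_fun setT (fun w => \int[mu]_(r in D) (H (w, r))%:E)%E.
Proof.
move=> mD mH H0.
have mf : measurable_fun setT (fun p : T * R => (\1_D p.2 * H p)%:E).
  apply/measurable_EFinP/measurable_funM => //.
  by apply: measurableT_comp; [exact: measurable_indic|exact: measurable_snd].
have f0 (p : T * R) : (0 <= (\1_D p.2 * H p)%:E)%E by rewrite lee_fin mulr_ge0.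
have := measurable_fun_fubini_tonelli_F (m2 := mu) _ mf f0.
rewrite (_ : fubini_F _ _ = (fun w => \int[mu]_(r in D) (H (w, r))%:E)%E)//.
apply/funext => w; rewrite /fubini_F [RHS]integral_mkcond.
apply: eq_integral => r _; rewrite /patch indicE.
by case: ifPn => _; rewrite ?mul1r ?mul0r.
Qed.

Lemma measurable_integral_section2 (H : T * R -> R) :
  measurable_fun setT H -> (forall p, 0 <= H p) ->
  measurable_fun setT (fun r => \int[P]_w (H (w, r))%:E)%E.
Proof.
move=> mH H0.
have mf : measurable_fun setT (EFin \o H) by exact/measurable_EFinP.
have f0 p : (0 <= (EFin \o H) p)%E by rewrite lee_fin.
exact: (measurable_fun_fubini_tonelli_G (m1 := P) _ mf f0).
Qed.

Lemma stable_gt0_ae : \forall w \ae P, 0 < A 1 w.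
Proof.
exists (A 1 @^-1` [set 0]); split.
- by rewrite -[X in measurable X]setTI; exact: mA1.
- exact: (stable_eq0_null nu_gt0 sA ltr01).
- move=> w /= /negP; rewrite -leNgt => A0; apply/eqP; rewrite eq_le A0 /=.
  exact: A1_ge0.
Qed.

Definition inv_scale w : R := A 1 w `^ (- nu).

Let mW : measurable_fun setT inv_scale.
Proof. exact: (measurableT_comp (measurable_powR _)). Qed.

Let W_ge0 w : 0 <= inv_scale w. Proof. exact: powR_ge0. Qed.

(** For each outcome with [A 1 w > 0], hence almost surely, [beta_substitution] with [a = A 1 w]
    turns the convolution integral over [r] into one over [s] in []0, t[]; Tonelli then brings the
    expectation inside. *)
Lemma kernel_identity t (g : R -> R) : 0 < t -> continuous g -> (forall x, 0 <= g x) ->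
  (\int[mu]_(s in `]0%R, t[) ((nu * ((t - s) `^ (- nu) * s `^ (nu - 1)))%:E *
      \int[P]_w (inv_scale w * g (s `^ nu * inv_scale w))%:E) =
   (Gamma (1 - nu))%:E * \int[P]_w (g (t `^ nu * inv_scale w))%:E)%E.
Proof.
move=> t0 cg g0.
have mg : measurable_fun setT g by exact: continuous_measurable_fun.
have gam0 : 0 < Gamma (1 - nu) by exact: Gamma_gt0.
(* Chosen so that [x exp (- x) G x = g (t^nu x^(-nu))] for [x > 0], which removes both the tilt and
   the size bias. *)
pose G x : R := expR x * x `^ (- 1) * g (t `^ nu * x `^ (- nu)).
have mG : measurable_fun setT G.
  apply: measurable_funM.
    by apply: measurable_funM => //; exact: measurable_powR.
  apply: measurableT_comp => //; apply: measurable_funM => //; exact: measurable_powR.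
have G0 x : 0 <= G x by rewrite !mulr_ge0 ?expR_ge0 ?powR_ge0.
pose H (p : T * R) : R := kappa * (inv_scale p.1 *
  ((t - p.2) `^ (- nu) * p.2 `^ (nu - 1)) * g (p.2 `^ nu * inv_scale p.1)).
have mpow q : measurable_fun setT (fun p : T * R => p.2 `^ q).
  by apply: (measurableT_comp (measurable_powR _)); exact: measurable_snd.
have mW1 : measurable_fun setT (fun p : T * R => inv_scale p.1).
  by apply: measurableT_comp.
have mH : measurable_fun setT H.
  apply: measurable_funM => //; apply: measurable_funM.
    apply: measurable_funM => //; apply: measurable_funM => //.
    apply: (measurableT_comp (measurable_powR _)).
    by apply: measurable_funB => //; exact: measurable_snd.
  by apply: measurableT_comp => //; exact: measurable_funM.
have H0 p : 0 <= H p by rewrite mulr_ge0// mulr_ge0// mulr_ge0// mulr_ge0 ?powR_ge0.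
pose V (p : T * R) : R := kappa * (p.2 `^ (- nu) * expR (- (A 1 p.1 + p.2))) * G (A 1 p.1 + p.2).
have mAr : measurable_fun setT (fun p : T * R => A 1 p.1 + p.2).
  by apply: measurable_funD; [exact: measurableT_comp|exact: measurable_snd].
have mV : measurable_fun setT V.
  apply: measurable_funM; last exact: measurableT_comp.
  apply: measurable_funM => //; apply: measurable_funM => //.
  by apply: measurableT_comp => //; exact: measurable_funN.
have V0 p : 0 <= V p by rewrite mulr_ge0// mulr_ge0// mulr_ge0 ?powR_ge0 ?expR_ge0.
have step1 : (\int[P]_w (g (t `^ nu * inv_scale w))%:E =
    \int[P]_w (A 1 w * expR (- A 1 w) * G (A 1 w))%:E)%E.
  apply: ge0_ae_eq_integral => //.
  - apply/measurable_EFinP; apply: measurableT_comp => //; exact: measurable_funM.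
  - apply/measurable_EFinP; apply: measurable_funM; last exact: measurableT_comp.
    by apply: measurable_funM => //; apply: measurableT_comp => //; exact: measurable_funN.
  - by move=> w _; rewrite lee_fin.
  - by move=> w _; rewrite lee_fin mulr_ge0// mulr_ge0 ?expR_ge0.
  - apply: filterS stable_gt0_ae => w A0 _; congr EFin.
    rewrite /G powR_inv1 ?(ltW A0)// expRN /inv_scale; field.
    by rewrite !gt_eqF// expR_gt0.
have step2 : (\int[P]_w \int[mu]_(r in `]0%R, +oo[) (V (w, r))%:E =
    \int[P]_w \int[mu]_(s in `]0%R, t[) (H (w, s))%:E)%E.
  apply: ge0_ae_eq_integral => //.
  - exact: measurable_integral_section1.
  - exact: measurable_integral_section1.
  - by move=> w _; apply: integral_ge0 => r _; rewrite lee_fin.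
  - by move=> w _; apply: integral_ge0 => r _; rewrite lee_fin.
  - apply: filterS stable_gt0_ae => w A0 _.
    transitivity (kappa%:E * \int[mu]_(s in `]0%R, t[)
        (A 1 w `^ (- nu) * ((t - s) `^ (- nu) * s `^ (nu - 1)) * g (s `^ nu * A 1 w `^ (- nu)))%:E)%E; last first.
      rewrite -ge0_integralZl_EFin//.
      + by move=> s _; rewrite lee_fin !mulr_ge0 ?powR_ge0.
      + apply/measurable_EFinP/measurable_funTS/measurable_funM.
          apply: measurable_funM => //; apply: measurable_funM; last exact: measurable_powR.
          by apply: (measurableT_comp (measurable_powR _)); exact: measurable_funB.
        by apply: measurableT_comp => //; apply: measurable_funM => //; exact: measurable_powR.
    rewrite beta_substitution// -ge0_integralZl_EFin//; last 2 first.
    + by move=> s _; rewrite lee_fin !mulr_ge0 ?powR_ge0.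
    + have mar : measurable_fun setT (fun r => A 1 w + r) by exact: measurable_funD.
      apply/measurable_EFinP/measurable_funTS/measurable_funM.
        apply: measurable_funM; first exact: measurable_powR.
        exact: (measurableT_comp (measurable_powR _)).
      apply: measurableT_comp => //; apply: measurable_funM => //.
      exact: (measurableT_comp (measurable_powR _)).
    apply: eq_integral => r; rewrite inE/= in_itv/= andbT => r0; rewrite -EFinM; congr EFin.
    rewrite /V/= /G expRN; field.
    by rewrite gt_eqF// expR_gt0.
transitivity ((Gamma (1 - nu))%:E * \int[P]_w \int[mu]_(s in `]0%R, t[) (H (w, s))%:E)%E; last first.
  congr (_ * _)%E; rewrite step1 -step2; apply/esym.
  exact: (size_bias_convolution mG G0).
have [E1 E2] := @integral_indicr `]0, t[%classic H (measurable_itv _) mH H0.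
have X1 : (\int[P]_w \int[mu]_(s in `]0%R, t[) (H (w, s))%:E =
    \int[mu]_(s in `]0%R, t[) \int[P]_w (H (w, s))%:E)%E.
  exact: (etrans (esym E1) E2).
have J0 s : (0 <= \int[P]_w (H (w, s))%:E)%E.
  by apply: integral_ge0 => w _; rewrite lee_fin.
have mJ : measurable_fun `]0, t[ (fun s => \int[P]_w (H (w, s))%:E)%E.
  exact: (measurable_funTS (measurable_integral_section2 mH H0)).
transitivity (\int[mu]_(s in `]0%R, t[) ((Gamma (1 - nu))%:E * \int[P]_w (H (w, s))%:E))%E; last first.
  transitivity ((Gamma (1 - nu))%:E * \int[mu]_(s in `]0%R, t[) \int[P]_w (H (w, s))%:E)%E.
    exact: (ge0_integralZl_EFin mu (measurable_itv _) (fun s _ => J0 s) mJ (ltW gam0)).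
  by rewrite X1.
clear E1 E2 X1 mJ J0 step1 step2.
apply: eq_integral => s _.
have mWg : measurable_fun setT (fun w => (inv_scale w * g (s `^ nu * inv_scale w))%:E).
  apply/measurable_EFinP; apply: measurable_funM; first exact: mW.
  apply: (measurableT_comp mg); apply: measurable_funM; [exact: measurable_cst|exact: mW].
have Wg0 w : setT w -> (0 <= (inv_scale w * g (s `^ nu * inv_scale w))%:E)%E.
  by move=> _; rewrite lee_fin mulr_ge0.
have mHs : measurable_fun setT (fun w => (H (w, s))%:E).
  by apply/measurable_EFinP; apply: (measurableT_comp mH); exact: measurable_pair2.
have Hs0 w : setT w -> (0 <= (H (w, s))%:E)%E by rewrite lee_fin.
have c0 : 0 <= nu * ((t - s) `^ (- nu) * s `^ (nu - 1)).
  by apply: mulr_ge0; [exact: ltW nu_gt0|apply: mulr_ge0; exact: powR_ge0].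
rewrite -(ge0_integralZl_EFin P measurableT Wg0 mWg c0).
rewrite -(ge0_integralZl_EFin P measurableT Hs0 mHs (ltW gam0)).
apply: eq_integral => w _; rewrite -!EFinM; congr EFin.
by rewrite /H/= /kappa; field; rewrite gt_eqF.
Qed.

(** With [g = 1] and [t = 1] the identity equates a multiple of [E W] with the finite
    [Gamma (1 - nu)], and the kernel is at least [nu] on []0, 1[]. *)
Lemma integrable_inv_scale : P.-integrable setT (EFin \o inv_scale).
Proof.
apply/integrableP; split; first exact/measurable_EFinP.
under eq_integral do rewrite /= ger0_norm//.
set EW := (\int[P]_w (inv_scale w)%:E)%E.
have cg : continuous (cst 1 : R -> R) by move=> x; exact: cvg_cst.
have K := kernel_identity ltr01 cg (fun=> ler01).
have E : (\int[mu]_(s in `]0%R, 1%R[) ((nu * ((1 - s) `^ (- nu) * s `^ (nu - 1)))%:E * EW) =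
    (Gamma (1 - nu))%:E)%E.
  have P1 : (\int[P]_w (cst (1 : R) (1 `^ nu * inv_scale w))%:E = 1)%E.
    transitivity (\int[P]_w (cst 1%E w))%E; first by [].
    by rewrite integral_cst// mul1e; exact: probability_setT.
  rewrite -[RHS]mule1 -P1 -K; apply: eq_integral => s _; congr (_ * _)%E.
  by apply: eq_integral => w _; rewrite /= mulr1.
have EW0 : (0 <= EW)%E by apply: integral_ge0 => w _; rewrite lee_fin.
have : (nu%:E * EW <= (Gamma (1 - nu))%:E)%E.
  rewrite -E.
  apply: (@le_trans _ _ (\int[mu]_(s in `]0%R, 1%R[) (nu%:E * EW))%E).
    rewrite integral_cst//= lebesgue_measure_itv/= lte_fin ltr01 oppr0 adde0.
    by rewrite mule1.
  apply: ge0_le_integral => //.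
  - by move=> s _; rewrite mule_ge0// lee_fin ltW.
  - apply: emeasurable_funM; last exact: measurable_cst.
    apply/measurable_EFinP/measurable_funTS.
    apply: measurable_funM => //; apply: measurable_funM; last exact: measurable_powR.
    by apply: (measurableT_comp (measurable_powR _)); exact: measurable_funB.
  - move=> s /=; rewrite in_itv/= => /andP[s0 s1]; rewrite lee_wpmul2r// lee_fin.
    rewrite ler_peMr ?(ltW nu_gt0)//.
    have ge1 x q : 0 < x <= 1 -> q <= 0 -> 1 <= x `^ q.
      move=> /andP[x0 x1] q0; rewrite /powR gt_eqF// -[leLHS]expR0 ler_expR.
      by rewrite mulr_le0// ln_le0.
    rewrite -[leLHS]mulr1 ler_pM//; apply: ge1.
    + by rewrite subr_gt0 s1/= gerBl ltW.
    + by rewrite oppr_le0 ltW.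
    + by rewrite s0 ltW.
    + by rewrite subr_le0 ltW.
case: EW EW0 E => [r _ _| _ _|//]; first by rewrite ltry.
by rewrite gt0_muley ?lte_fin// leye_eq.
Qed.

End stable_size_bias.

(** * Caputo derivative of Poisson mixtures *)

Lemma is_derive_under_integral (R : realType) d (Y : measurableType d)
    (m : {measure set Y -> \bar R}) (f : R -> Y -> R) (df : R -> Y -> R) (a u v : R) (G : Y -> R) :
  u < a < v ->
  (forall x, u < x < v -> m.-integrable setT (EFin \o f x)) ->
  (forall x y, u < x < v -> is_derive x 1 (f ^~ y) (df x y)) ->
  (forall y, 0 <= G y) -> m.-integrable setT (EFin \o G) ->
  (forall x y, u < x < v -> `|df x y| <= G y) ->
  is_derive a 1 (fun x => \int[m]_y f x y) (\int[m]_y df a y).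
Proof.
move=> uav intf dfE G0 iG ub.
have inI x : `]u, v[%classic x -> u < x < v by rewrite /= in_itv.
have partialE x y : u < x < v -> partial1of2 f x y = df x y.
  by move=> xI; rewrite /partial1of2 derive1E (derive_val (is_derive := dfE x y xI)).
have := @cvg_differentiation_under_integral R d Y m f setT measurableT a u v _ _ _ G G0 iG _.
have -> : \int[m]_y partial1of2 f a y = \int[m]_y df a y.
  by apply: eq_Rintegral => y _; exact: partialE.
move=> /(_ _ _ _ _)/wrap[].
- by rewrite /= in_itv.
- by move=> x /inI; exact: intf.
- by move=> x y /inI xI _; have [] := dfE x y xI.
- by move=> x y /inI xI _; rewrite partialE// ub.
move=> H.
have E : (fun h : R => h^-1 *: (((fun x => \int[m]_y f x y) \o shift a) (h *: 1) -
    \int[m]_y f a y)) @ 0^' --> \int[m]_y df a y.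
  move: H; apply: cvg_trans; apply: near_eq_cvg; apply: nearW => h /=.
  by rewrite /shift/= [h *: 1]mulr1.
by apply: DeriveDef; [apply/cvg_ex; exists (\int[m]_y df a y)|rewrite /derive; exact: cvg_lim E].
Qed.

Lemma ger0_powR_le (R : realType) (x y q : R) : 0 < x -> x <= y -> q <= 0 -> y `^ q <= x `^ q.
Proof.
move=> x0 xy q0; have y0 := lt_le_trans x0 xy.
by rewrite /powR !gt_eqF// ler_expR ler_wnM2l// ler_ln ?posrE.
Qed.

Section caputo_mixture.
Context d (T : measurableType d) (R : realType) (P : probability T R).
Notation mu := (@lebesgue_measure R).
Variables (l nu : R) (W : T -> R).
Hypotheses (l_gt0 : 0 < l) (nu01 : 0 < nu < 1) (mW : measurable_fun setT W)
  (W_ge0 : forall w, 0 <= W w) (iW : P.-integrable setT (EFin \o W)).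
Hypothesis kernelW : forall (t : R) (g : R -> R), 0 < t -> continuous g -> (forall x, 0 <= g x) ->
  (\int[mu]_(s in `]0%R, t[) ((nu * ((t - s) `^ (- nu) * s `^ (nu - 1)))%:E *
      \int[P]_w (W w * g (s `^ nu * W w))%:E) =
   (Gamma (1 - nu))%:E * \int[P]_w (g (t `^ nu * W w))%:E)%E.
Implicit Types (s t x : R) (n : nat).

Let nu_gt0 : 0 < nu. Proof. by case/andP: nu01. Qed.
Let nu_lt1 : nu < 1. Proof. by case/andP: nu01. Qed.
Let gamma_gt0 : 0 < Gamma (1 - nu).
Proof. by apply: Gamma_gt0; rewrite subr_gt0 nu_lt1 gerBl ltW. Qed.
Let tW_ge0 t w : 0 <= t `^ nu * W w. Proof. by rewrite mulr_ge0 ?powR_ge0. Qed.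

Let bounded01 (g : R -> R) := forall x, 0 <= x -> 0 <= g x <= 1.

Let mgtW (g : R -> R) t : continuous g -> measurable_fun setT (fun w => g (t `^ nu * W w)).
Proof.
move=> cg; apply: measurableT_comp; first exact: continuous_measurable_fun.
exact: measurable_funM.
Qed.

Let igtW (g : R -> R) t : continuous g -> bounded01 g ->
  P.-integrable setT (EFin \o (fun w => g (t `^ nu * W w))).
Proof.
move=> cg g01; apply: (@le_integrable _ _ _ P _ measurableT _ (cst 1%E)).
- by apply/measurable_EFinP; exact: mgtW.
- move=> w _ /=; rewrite lee_fin normr1; have /andP[? ?] := g01 _ (tW_ge0 t w).
  by rewrite ger0_norm.
- exact: finite_measure_integrable_cst.
Qed.

Let iWg (g : R -> R) t : continuous g -> bounded01 g ->
  P.-integrable setT (EFin \o (fun w => W w * g (t `^ nu * W w))).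
Proof.
move=> cg g01; apply: (@le_integrable _ _ _ P _ measurableT _ (EFin \o W)) => //.
- by apply/measurable_EFinP; apply: measurable_funM => //; exact: mgtW.
- move=> w _ /=; rewrite lee_fin normrM; have /andP[? ?] := g01 _ (tW_ge0 t w).
  by rewrite [X in _ * X]ger0_norm// ler_piMr.
Qed.

(** By the chain rule [nu s^(nu - 1) M g s] is the derivative of [E (Psi (s^nu W))] when [g] is the
    derivative of [Psi]. *)
Let M (g : R -> R) s := \int[P]_w (W w * g (s `^ nu * W w)).

Let ME (g : R -> R) s : continuous g -> bounded01 g ->
  ((M g s)%:E = \int[P]_w (W w * g (s `^ nu * W w))%:E)%E.
Proof.
by move=> cg g01; rewrite /M /Rintegral fineK//; exact: integrable_fin_num (iWg s cg g01).
Qed.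

Let k (g : R -> R) t s := (t - s) `^ (- nu) * (nu * s `^ (nu - 1) * M g s).

Let M_ge0 (g : R -> R) s : bounded01 g -> 0 <= M g s.
Proof. by move=> g01; apply: Rintegral_ge0 => w _; rewrite mulr_ge0//; case/andP: (g01 _ (tW_ge0 s w)). Qed.

Let k_ge0 (g : R -> R) t s : bounded01 g -> 0 <= k g t s.
Proof.
by move=> g01; apply: mulr_ge0; [exact: powR_ge0|apply: mulr_ge0; [
  apply: mulr_ge0; [exact: ltW|exact: powR_ge0]|exact: M_ge0]].
Qed.

(** [kernelW] read in the reals; integrability of the nonnegative [k] follows from the finite
    right-hand side, [g] being bounded on nonnegative reals. *)
Let k_spec (g : R -> R) t : 0 < t -> continuous g -> bounded01 g ->
  mu.-integrable `]0, t[ (EFin \o k g t) /\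
  (\int[mu]_(s in `]0%R, t[) (k g t s)%:E =
   (Gamma (1 - nu) * \int[P]_w g (t `^ nu * W w))%:E)%E.
Proof.
move=> t0 cg g01.
(* A Poisson weight may be negative at negative arguments, while [kernelW] asks for a nonnegative
   function on the whole line. *)
have cg' : continuous (g \o (@Num.norm R R)).
  by move=> x; apply: continuous_comp; [exact: norm_continuous|exact: cg].
pose H (p : T * R) : R := W p.1 * g `|p.2 `^ nu * W p.1|.
have H0 p : 0 <= H p by apply: mulr_ge0 => //; case/andP: (g01 _ (normr_ge0 (p.2 `^ nu * W p.1))).
have mH : measurable_fun setT H.
  have mW1 : measurable_fun setT (fun p : T * R => W p.1) by exact: measurableT_comp.
  apply: measurable_funM => //.
  apply: (measurableT_comp (continuous_measurable_fun cg')).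
  apply: measurable_funM => //; apply: (measurableT_comp (measurable_powR _)).
  exact: measurable_snd.
have HE s : (\int[P]_w (H (w, s))%:E = (M g s)%:E)%E.
  by rewrite ME//; apply: eq_integral => w _; rewrite /H/= ger0_norm.
have kE s : (k g t s)%:E = ((nu * ((t - s) `^ (- nu) * s `^ (nu - 1)))%:E * \int[P]_w (H (w, s))%:E)%E.
  by rewrite HE -EFinM /k; congr EFin; ring.
have mk : measurable_fun `]0, t[ (EFin \o k g t).
  rewrite (_ : EFin \o _ = (fun s => (nu * ((t - s) `^ (- nu) * s `^ (nu - 1)))%:E * \int[P]_w (H (w, s))%:E)%E).
    apply: emeasurable_funM; last exact: (measurable_funTS (measurable_integral_section2 P mH H0)).
    apply/measurable_EFinP/measurable_funTS; apply: measurable_funM => //.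
    apply: measurable_funM; last exact: measurable_powR.
    by apply: (measurableT_comp (measurable_powR _)); exact: measurable_funB.
  by apply/funext => s; exact: kE.
have E : (\int[mu]_(s in `]0%R, t[) (k g t s)%:E =
   (Gamma (1 - nu) * \int[P]_w g (t `^ nu * W w))%:E)%E.
  rewrite EFinM; transitivity ((Gamma (1 - nu))%:E * \int[P]_w (g `|t `^ nu * W w|)%:E)%E; last first.
    congr (_ * _)%E; rewrite /Rintegral fineK; last exact: integrable_fin_num (igtW t cg g01).
    by apply: eq_integral => w _; rewrite ger0_norm.
  rewrite -(kernelW t0 cg'); last by move=> x /=; case/andP: (g01 _ (normr_ge0 x)).
  by apply: eq_integral => s _; rewrite kE; congr (_ * _)%E.
split => //; apply/integrableP; split => //.
under eq_integral do rewrite /= ger0_norm ?k_ge0//.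
by rewrite E ltry.
Qed.

Definition scaled_pois n t : R := \int[P]_w pois l n (t `^ nu * W w).
Definition scaled_pois_pred n t : R := if n is n'.+1 then scaled_pois n' t else 0.

Let cpois n : continuous (pois l n). Proof. exact: continuous_pois. Qed.
Let cpois_pred n : continuous (pois_pred l n).
Proof. by case: n => [|n] /=; [move=> x; exact: cvg_cst|exact: continuous_pois]. Qed.
Let pois01 n : bounded01 (pois l n).
Proof. by move=> x x0; rewrite pois_ge0 ?pois_le1. Qed.
Let pois_pred01 n : bounded01 (pois_pred l n).
Proof. by move=> x x0; rewrite pois_pred_ge0 ?pois_pred_le1. Qed.

(** On []t/2, t + 1[] the derivative is dominated by a multiple of [W]: two weights in [[0, 1]]
    differ by at most 1, and [x^(nu - 1)] is largest at the left end. This is where [E W] must be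
    finite. *)
Let is_derive_scaled_pois n t : 0 < t ->
  is_derive t 1 (scaled_pois n)
    (l * (nu * t `^ (nu - 1) * M (pois_pred l n) t - nu * t `^ (nu - 1) * M (pois l n) t)).
Proof.
move=> t0; have t2 : 0 < t / 2 by rewrite divr_gt0.
pose df x w := l * (pois_pred l n (x `^ nu * W w) - pois l n (x `^ nu * W w)) * (W w * (nu * x `^ (nu - 1))).
have D x w : 0 < x -> is_derive x 1 (fun x => pois l n (x `^ nu * W w)) (df x w).
  move=> x0; have D1 : is_derive x 1 (W w *: (@powR R ^~ nu)) (W w *: (nu * x `^ (nu - 1))).
    by apply: is_deriveZ; exact: is_derive1_powR.
  have -> : (fun x => pois l n (x `^ nu * W w)) = pois l n \o (W w *: (@powR R ^~ nu)).
    by apply/funext => y /=; rewrite mulrC.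
  apply: (is_derive1_comp _ D1).
  have -> : (W w *: (@powR R ^~ nu)) x = x `^ nu * W w by rewrite mulrC.
  exact: is_derive_pois.
have -> : l * (nu * t `^ (nu - 1) * M (pois_pred l n) t - nu * t `^ (nu - 1) * M (pois l n) t) =
    \int[P]_w df t w.
  rewrite -mulrBr /M -RintegralB//; last 2 first.
  - exact: iWg.
  - exact: iWg.
  rewrite mulrA -RintegralZl//; last first.
    exact: (integrableB measurableT (iWg t (@cpois_pred n) (pois_pred01 n))
      (iWg t (@cpois n) (pois01 n))).
  by apply: eq_Rintegral => w _; rewrite /df; ring.
apply: (@is_derive_under_integral R _ T P _ df t (t / 2) (t + 1)
  (fun w => (l * (nu * (t / 2) `^ (nu - 1))) * W w)).
- by rewrite ltr_pdivrMr// ltr_pMr// ltr1n/= ltrDl.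
- by move=> x _; exact: igtW.
- by move=> x w /andP[x0 _]; apply: D; exact: lt_trans x0.
- by move=> w; rewrite mulr_ge0// mulr_ge0 ?(ltW l_gt0)// mulr_ge0 ?powR_ge0 ?(ltW nu_gt0).
- rewrite (_ : EFin \o _ = (fun w => (l * (nu * (t / 2) `^ (nu - 1)))%:E * (W w)%:E)%E).
    exact: integrableZl.
  by apply/funext => w; rewrite /= EFinM.
- move=> x w /andP[x0 _]; rewrite /df !normrM (ger0_norm (ltW l_gt0)) (ger0_norm (W_ge0 w)).
  rewrite (ger0_norm (ltW nu_gt0)) (ger0_norm (powR_ge0 _ _)).
  have B : `|pois_pred l n (x `^ nu * W w) - pois l n (x `^ nu * W w)| <= 1.
    have /andP[? ?] := pois_pred01 n (tW_ge0 x w).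
    have /andP[? ?] := pois01 n (tW_ge0 x w).
    by rewrite ler_norml; lra.
  have B2 : x `^ (nu - 1) <= (t / 2) `^ (nu - 1).
    by apply: ger0_powR_le => //; [exact: ltW|rewrite subr_le0 ltW].
  rewrite -!mulrA ler_wpM2l ?(ltW l_gt0)//.
  apply: (@le_trans _ _ (W w * (nu * x `^ (nu - 1)))).
    by rewrite ler_piMl// mulr_ge0// mulr_ge0 ?powR_ge0 ?(ltW nu_gt0).
  by rewrite mulrC -mulrA ler_wpM2l ?(ltW nu_gt0)// ler_wpM2r.
Qed.

Variables (K : nat) (c : nat -> R) (p : R -> R).
Hypothesis pE : forall s, 0 < s -> p s = \sum_(n < K) c n * scaled_pois n s.

Let is_derive_p s : 0 < s -> is_derive s 1 p (\sum_(n < K) c n *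
  (l * (nu * s `^ (nu - 1) * M (pois_pred l n) s - nu * s `^ (nu - 1) * M (pois l n) s))).
Proof.
move=> s0.
have D : is_derive s 1 (\sum_(n < K) c n *: scaled_pois n) (\sum_(n < K) c n *
  (l * (nu * s `^ (nu - 1) * M (pois_pred l n) s - nu * s `^ (nu - 1) * M (pois l n) s))).
  by apply: is_derive_sum => n; apply: is_deriveZ; exact: is_derive_scaled_pois.
apply: near_eq_is_derive D; near=> x; rewrite pE ?fct_sumE//.
by near: x; exact: lt_nbhsr.
Unshelve. all: by end_near. Qed.

Let integrandE t s : 0 < s -> (t - s) `^ (- nu) * derive1 p s =
  \sum_(n < K) (c n * l) * (k (pois_pred l n) t s - k (pois l n) t s).
Proof.
move=> s0; rewrite derive1E (derive_val (is_derive := is_derive_p s0)) mulr_sumr.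
by apply: eq_bigr => n _; rewrite /k; ring.
Qed.

(** The derivative of a weight is [l] times a difference of two weights, and [k_spec] evaluates the
    integral of each; the factor [Gamma (1 - nu)] cancels. *)
Lemma is_caputo_derive_mixture t : 0 < t ->
  is_caputo_derive nu p t (l * \sum_(n < K) c n * (scaled_pois_pred n t - scaled_pois n t)).
Proof.
move=> t0.
pose h n s : \bar R := ((c n * l)%:E * ((k (pois_pred l n) t s)%:E - (k (pois l n) t s)%:E))%E.
have hE s : `]0, t[%classic s -> ((t - s) `^ (- nu) * derive1 p s)%:E = (\sum_(n < K) h n s)%E.
  rewrite /= in_itv/= => /andP[s0 _]; rewrite integrandE// -sumEFin.
  by apply: eq_bigr => n _; rewrite /h -EFinB -EFinM.
have ik n : mu.-integrable `]0, t[ (fun s => ((k (pois_pred l n) t s)%:E - (k (pois l n) t s)%:E)%E).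
  apply: integrableB => //.
  - by case: (k_spec t0 (@cpois_pred n) (pois_pred01 n)).
  - by case: (k_spec t0 (@cpois n) (pois01 n)).
have ih n : mu.-integrable `]0, t[ (h n) by apply: integrableZl.
have ip : mu.-integrable `]0, t[ (fun s => ((t - s) `^ (- nu) * derive1 p s)%:E).
  apply: (@eq_integrable _ _ _ mu _ _ (fun s => \sum_(n < K) h n s)%E) => //.
    by move=> s; rewrite inE => ?; rewrite hE.
  by apply: integrable_sum.
split => //.
- by move=> s /andP[s0 _]; have [] := is_derive_p s0.
- rewrite /caputo_derive; apply: (@mulfI _ (Gamma (1 - nu))); first by rewrite gt_eqF.
  rewrite mulrA divff ?gt_eqF// mul1r; apply: EFin_inj.
  rewrite /Rintegral fineK; last exact: integrable_fin_num ip.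
  transitivity (\int[mu]_(s in `]0%R, t[) (\sum_(n < K) h n s))%E.
    by apply: eq_integral => s; rewrite inE => ?; rewrite hE.
  rewrite integral_sum// mulrA mulr_sumr -sumEFin; apply: eq_bigr => n _.
  rewrite /h integralZl// integralB//; last 2 first.
  - by case: (k_spec t0 (@cpois_pred n) (pois_pred01 n)).
  - by case: (k_spec t0 (@cpois n) (pois01 n)).
  have [_ ->] := k_spec t0 (@cpois_pred n) (pois_pred01 n).
  have [_ ->] := k_spec t0 (@cpois n) (pois01 n).
  rewrite -EFinB -EFinM; congr EFin; rewrite -/(scaled_pois n t).
  have -> : \int[P]_w pois_pred l n (t `^ nu * W w) = scaled_pois_pred n t.
    by case: (n : nat) => [|n'] //=; rewrite /Rintegral integral0.
  by ring.
Qed.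

End caputo_mixture.

(** * Law of the inverse subordinator *)

(** The rays []-oo, x[] determine the law, and the layer-cake formula with weight 1 passes from laws
    to integrals. *)
Lemma integral_eq_of_tails (R : realType) d (T : measurableType d) (P : probability T R)
    (X Y : T -> R) (g : R -> R) :
  measurable_fun setT X -> measurable_fun setT Y ->
  (forall x, P [set w | X w < x] = P [set w | Y w < x]) ->
  measurable_fun setT g -> (forall x, 0 <= g x) ->
  (\int[P]_w (g (X w))%:E = \int[P]_w (g (Y w))%:E)%E.
Proof.
move=> mX mY XY mg g0.
have mw : measurable_fun setT (cst 1 : T -> R) by exact: measurable_cst.
have w0 (w : T) : 0 <= (cst 1 w : R) by exact: ler01.
have lawE Z : measurable_fun setT Z -> forall B, measurable B ->
    weighted_law P (cst 1) Z B = P (Z @^-1` B).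
  move=> mZ B mB; rewrite -[RHS]mul1e -(integral_cst P)//.
  by rewrite -[X in measurable X]setTI; exact: mZ.
have E B : measurable B -> weighted_law P (cst 1) X B = weighted_law P (cst 1) Y B.
  apply: (@measure_unique _ R _ (@RGenInftyO.G R) (fun i : nat => `]-oo, i%:R[%classic) _ _ _ _
    (weighted_measure P mw w0 mX) (weighted_measure P mw w0 mY)).
  - exact: RGenInftyO.measurableE.
  - move=> _ _ [x ->] [y ->]; exists (Num.min x y).
    by apply/seteqP; split => z /=; rewrite !in_itv/= lt_min; [move=> [-> ->]|move=> /andP].
  - by move=> i; exists i%:R.
  - rewrite -subTset => x _; exists (Num.truncn `|x|).+1 => //=; rewrite in_itv/=.
    by apply: le_lt_trans (ler_norm x) _; exact: truncnS_gt.
  - move=> _ [x ->]; rewrite /weighted_measure/= !lawE//.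
    have := XY x; congr (_ = _); congr (P _); apply/seteqP; by split => w /=; rewrite in_itv.
  - move=> k; rewrite /weighted_measure/= lawE//; apply: le_lt_trans (ltry 1).
    by apply: probability_le1; rewrite -[X in measurable X]setTI; exact: mX.
transitivity (\int[P]_w (cst 1 w * g (X w))%:E)%E.
  by apply: eq_integral => w _; rewrite mul1r.
transitivity (\int[P]_w (cst 1 w * g (Y w))%:E)%E; last first.
  by apply: eq_integral => w _; rewrite mul1r.
rewrite (integral_layer_cake P mw w0 mX mg g0) (integral_layer_cake P mw w0 mY mg g0).
apply: eq_integral => r _; apply: (E [set y | 0 < r < g y]).
rewrite (_ : [set y | _] = g @^-1` `]r, +oo[%classic `&` [set y | 0 < r]).
  apply: measurableI; first by rewrite -[X in measurable X]setTI; exact: mg.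
  by have [r0|r0] := pselect (0 < r); [rewrite (_ : [set _ | _] = setT)//|
    rewrite (_ : [set _ | _] = set0)//]; apply/seteqP; split => y.
by apply/seteqP; split => y /=; rewrite in_itv/= andbT; [move=> /andP[]|move=> [-> ->]].
Qed.

Section inverse_law.
Context d (T : measurableType d) (R : realType) (P : probability T R).
Variables (nu : R) (A : R -> T -> R).
Hypotheses (nu01 : 0 < nu < 1) (sA : stable_subordinator P nu A).
Implicit Types (s t x : R) (w : T).

Let L := inverse_subordinator A.
Let nu_gt0 : 0 < nu. Proof. by case/andP: nu01. Qed.

Lemma inverse_subordinator_ge0 t w : 0 <= L t w.
Proof.
rewrite /L /inverse_subordinator; set S := [set _ | _].
(* A path that never exceeds [t] gives the empty set, whose [inf] is 0 by default. *)
have [->|S0] := eqVneq S set0; first by rewrite inf0.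
by apply: lb_le_inf; [exact/set0P|move=> z []].
Qed.

Lemma inverse_subordinator_le t s w : 0 <= s -> t < A s w -> L t w <= s.
Proof.
by move=> s0 ts; apply: ge_inf; [exists 0 => z []|split].
Qed.

Lemma inverse_subordinator_lt t s w : 0 <= s -> (exists n : nat, t < A n%:R w) ->
  L t w < s -> exists2 z, 0 <= z < s & t < A z w.
Proof.
move=> s0 [n tn] /inf_lt[|z [z0 tz] zs]; first by exists n%:R.
by exists z => //; rewrite z0.
Qed.

Let bounded_path t := \bigcap_n [set w | A n%:R w <= t].

Let measurable_le s t : 0 <= s -> measurable [set w | A s w <= t].
Proof.
move=> s0; have := stable_measurable sA s0 measurableT (measurable_itv `]-oo, t]).
by rewrite setTI; congr (_ (_ : set T)); apply/seteqP; split => w /=; rewrite in_itv.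
Qed.

Let measurable_gt s t : 0 <= s -> measurable [set w | t < A s w].
Proof.
move=> s0; have := stable_measurable sA s0 measurableT (measurable_itv `]t, +oo[).
by rewrite setTI; congr (_ (_ : set T)); apply/seteqP; split => w /=; rewrite in_itv/= andbT.
Qed.

Let measurable_bounded_path t : measurable (bounded_path t).
Proof. by apply: bigcapT_measurable => n; exact: measurable_le. Qed.

(** On this event [exp (- A n) >= exp (- t)], so [exp (- t)] times its probability is at most
    [E (exp (- A n)) = exp (- n)] for every [n]. *)
Let bounded_path_null t : P (bounded_path t) = 0%E.
Proof.
apply/eqP; rewrite eq_le measure_ge0 andbT.
have B n : ((expR (- t))%:E * P (bounded_path t) <= (expR (- n%:R))%:E)%E.
  rewrite -integral_cst//; apply: (@le_trans _ _ (\int[P]_(w in bounded_path t) (expR (- 1 * A n%:R w))%:E)%E).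
    apply: ge0_le_integral => //.
    - by move=> w _; rewrite lee_fin expR_ge0.
    - apply/measurable_EFinP/measurable_funTS; apply: measurableT_comp => //.
      by apply: measurable_funM => //; exact: (stable_measurable sA (ler0n _ n)).
    - by move=> w /(_ n I) /= h; rewrite lee_fin ler_expR mulN1r lerN2.
  apply: (@le_trans _ _ (\int[P]_w (expR (- 1 * A n%:R w))%:E)%E).
    apply: ge0_subset_integral => //.
    - apply/measurable_EFinP; apply: measurableT_comp => //.
      by apply: measurable_funM => //; exact: (stable_measurable sA (ler0n _ n)).
  by rewrite (integral_stable_expR sA)// powR1 mulN1r.
have F : ((expR (- t))%:E * P (bounded_path t) <= 0)%E.
  rewrite -(fineK (fin_num_measure P _ (measurable_bounded_path t))) -EFinM lee_fin.
  have C : expR (- n%:R) @[n --> \oo] --> (0 : R).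
    by under eq_fun do rewrite -[X in - X]mulr1; exact: cvg_expRNn.
  apply: (cvgr_to_ge C); apply: nearW => n.
  by rewrite -lee_fin EFinM fineK ?B//; exact: (fin_num_measure P _ (measurable_bounded_path t)).
by move: F; rewrite pmule_rle0// lte_fin expR_gt0.
Qed.

Let below x n : R := x - x / n.+1%:R.

Let below_ge0 x n : 0 < x -> 0 <= below x n.
Proof.
by move=> x0; rewrite subr_ge0 ler_pdivrMr// ler_pMr// ler1n.
Qed.

Let below_lt x n : 0 < x -> below x n < x.
Proof. by move=> x0; rewrite ltrBlDr ltrDl divr_gt0. Qed.

Let belowP x z : 0 < x -> z < x -> exists n, z <= below x n.
Proof.
move=> x0 zx; exists (Num.truncn (x / (x - z))).
have xz : 0 < x - z by rewrite subr_gt0.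
rewrite /below lerBrDl -lerBrDr ler_pdivrMr// mulrC -ler_pdivrMr//.
exact/ltW/truncnS_gt.
Qed.

(** The infimum is below [x] when [A] exceeds [t] at some time before [x], and monotone paths need
    be tested only along a sequence. On bounded paths [L t] has its default value 0. *)
Let ltLE t x : 0 < x -> [set w | L t w < x] =
  (\bigcup_n [set w | t < A (below x n) w]) `|` bounded_path t.
Proof.
move=> x0; apply/seteqP; split => w /=.
- move=> Lx; have [[n tn]|ne] := pselect (exists n : nat, t < A n%:R w); last first.
    by right => n _ /=; rewrite leNgt; apply/negP => tn; apply: ne; exists n.
  left; have [z /andP[z0 zx] tz] := inverse_subordinator_lt (ltW x0) (ex_intro _ n tn) Lx.
  have [m zm] := belowP x0 zx; exists m => //=.
  by apply: lt_le_trans tz _; exact: (stable_nondecreasing sA).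
- move=> [[n _ /= tn]|ne].
    by apply: le_lt_trans (below_lt n x0); apply: inverse_subordinator_le => //; exact: below_ge0.
  rewrite /L /inverse_subordinator (_ : [set _ | _] = set0) ?inf0//.
  apply/seteqP; split => // z [z0 tz]; have := ne (Num.truncn z).+1 I; rewrite /= leNgt => /negP; apply.
  apply: lt_le_trans tz _; apply: (stable_nondecreasing sA) => //.
  exact/ltW/truncnS_gt.
Qed.

Lemma measurable_inverse_subordinator t : measurable_fun setT (L t).
Proof.
apply: (measurability (@RGenInftyO.G R)); first exact: RGenInftyO.measurableE.
move=> _ [_ [x ->] <-]; rewrite setTI.
have -> : L t @^-1` `]-oo, x[%classic = [set w | L t w < x].
  by apply/seteqP; split => w /=; rewrite in_itv.
have [x0|x0] := leP x 0.
  rewrite (_ : [set _ | _] = set0)//; apply/seteqP; split => // w /= /lt_le_trans/(_ x0).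
  by rewrite ltNge inverse_subordinator_ge0.
rewrite ltLE//; apply: measurableU => //; apply: bigcupT_measurable => n.
by apply: measurable_gt; exact: below_ge0.
Qed.

Let measurable_inv_scale t : measurable_fun setT (fun w => t `^ nu * inv_scale nu A w).
Proof.
apply: measurable_funM => //; apply: (measurableT_comp (measurable_powR _)).
exact: (stable_measurable sA ler01).
Qed.

Let measurable_lt_inv_scale t x : measurable [set w | t `^ nu * inv_scale nu A w < x].
Proof.
have := measurable_inv_scale t measurableT (measurable_itv `]-oo, x[).
by rewrite setTI; congr (_ (_ : set T)); apply/seteqP; split => w /=; rewrite in_itv.
Qed.

(** By scaling [A x] has the law of [x^(1/nu) A 1], and the inequality is solved for [x]. This is
    valid where [A 1 > 0]; the null set [Z] is added to both events. *)
Let tail_stable t x : 0 < t -> 0 < x ->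
  P [set w | t < A x w] = P [set w | t `^ nu * inv_scale nu A w < x].
Proof.
move=> t0 x0.
have mI : measurable_fun setT (\1_(`]t, +oo[%classic) : R -> R) by exact: measurable_indic.
have I0 y : 0 <= (\1_(`]t, +oo[%classic) y : R) by rewrite indicE.
have := integral_stable_scaling nu_gt0 sA x0 mI I0.
have intE (Y : T -> R) : measurable_fun setT Y ->
    (\int[P]_w (\1_(`]t, +oo[%classic) (Y w) : R)%:E)%E = P [set w | t < Y w].
  move=> mY; rewrite -(setIT [set w | t < Y w]) -integral_indic//; last first.
    have := mY measurableT _ (measurable_itv `]t, +oo[).
    by rewrite setTI; congr (_ (_ : set T)); apply/seteqP; split => w /=; rewrite in_itv/= andbT.
  by apply: eq_integral => w _; rewrite !indicE !mem_setE/= in_itv/= andbT.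
rewrite intE; last exact: (stable_measurable sA (ltW x0)).
rewrite intE; last by apply: measurable_funM => //; exact: (stable_measurable sA ler01).
move=> ->.
have mgt : measurable [set w | t < x `^ nu^-1 * A 1 w].
  have mY : measurable_fun setT (fun w => x `^ nu^-1 * A 1 w).
    by apply: measurable_funM => //; exact: (stable_measurable sA ler01).
  have := mY measurableT _ (measurable_itv `]t, +oo[).
  by rewrite setTI; congr (_ (_ : set T)); apply/seteqP; split => w /=; rewrite in_itv/= andbT.
have key w : 0 < A 1 w -> (t < x `^ nu^-1 * A 1 w) = (t `^ nu * inv_scale nu A w < x).
  move=> a0; rewrite /inv_scale powRN.
  rewrite ltr_pdivrMr ?powR_gt0// -ltr_pdivrMl ?powR_gt0//.
  have E (u v : R) : 0 < u -> 0 < v -> (u < v) = (u `^ nu < v `^ nu).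
    move=> u0 v0; apply/idP/idP; first by move=> uv; apply: gt0_ltr_powR; rewrite ?nnegrE ?ltW.
    by rewrite !ltNge; apply: contra; apply: ge0_ler_powR; rewrite ?nnegrE ltW.
  rewrite E ?mulr_gt0 ?powR_gt0// powRM ?powR_ge0 ?ltW// -powRrM mulVf ?gt_eqF// powRr1 ?ltW//.
  by rewrite mulrC -ltr_pdivrMr// mulrC.
pose Z := [set w | A 1 w <= 0].
have mZ : measurable Z by exact: measurable_le.
have PZ : P Z = 0%E.
  rewrite -(stable_eq0_null nu_gt0 sA ltr01); congr (P _); apply/seteqP; split => w /=.
    by move=> h; apply/eqP; rewrite eq_le h (stable_ge0 sA).
  by rewrite /Z/= => ->.
rewrite -(measureU0 mgt mZ PZ) -(measureU0 (measurable_lt_inv_scale t x) mZ PZ).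
congr (P _); apply/seteqP; split => w /= [h|h]; try by right.
- by have [a0|a0] := leP (A 1 w) 0; [right|left; rewrite -key].
- by have [a0|a0] := leP (A 1 w) 0; [right|left; rewrite key].
Qed.

(** Since [A] may jump, [L t < x] is not the event [t < A x] but the increasing union of the events
    at times [below x n]. Continuity of [P] along increasing unions gives the same limit for both
    sides. *)
Let tail_inverse t x : 0 < t ->
  P [set w | L t w < x] = P [set w | t `^ nu * inv_scale nu A w < x].
Proof.
move=> t0; have [x0|x0] := leP x 0.
  congr (P _); apply/seteqP; split => w /= /lt_le_trans/(_ x0); rewrite ltNge.
    by rewrite inverse_subordinator_ge0.
  by rewrite mulr_ge0 ?powR_ge0.
have mb n : measurable [set w | t < A (below x n) w] by apply: measurable_gt; exact: below_ge0.
have mU : measurable (\bigcup_n [set w | t < A (below x n) w]).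
  by apply: bigcupT_measurable => n; exact: mb.
rewrite (ltLE t x0) (measureU0 mU (measurable_bounded_path t) (bounded_path_null t)).
have below_nd n m : (n <= m)%N -> below x n <= below x m.
  by move=> nm; rewrite lerB// ler_pM2l// lef_pV2 ?posrE// ler_nat.
(* Indices start at 1, as [below x 0 = 0] and [tail_stable] is about positive times. *)
have -> : [set w | t `^ nu * inv_scale nu A w < x] =
    \bigcup_n [set w | t `^ nu * inv_scale nu A w < below x n.+1].
  apply/seteqP; split => w /=.
    move=> h; have [n zn] := belowP x0 (midf_lt h).2; exists n => //=.
    apply: lt_le_trans (below_nd _ _ (leqnSn n)); apply: lt_le_trans zn.
    exact: (midf_lt h).1.
  by move=> [n _ /= h]; apply: lt_trans h _; exact: below_lt.
have -> : \bigcup_n [set w | t < A (below x n) w] = \bigcup_n [set w | t < A (below x n.+1) w].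
  apply/seteqP; split => w [n _ /= h]; last by exists n.+1.
  exists n => //=; apply: lt_le_trans h _; apply: (stable_nondecreasing sA); first exact: below_ge0.
  exact/below_nd.
have c1 : (P \o (fun n => [set w | t < A (below x n.+1) w])) n @[n --> \oo] -->
    P (\bigcup_n [set w | t < A (below x n.+1) w]).
  apply: nondecreasing_cvg_mu.
  - by move=> n; exact: mb.
  - by apply: bigcupT_measurable => n; exact: mb.
  - move=> n m nm; apply/subsetPset => w /= h; apply: lt_le_trans h _.
    by apply: (stable_nondecreasing sA); [exact: below_ge0|exact: below_nd].
have c2 : (P \o (fun n => [set w | t `^ nu * inv_scale nu A w < below x n.+1])) n @[n --> \oo] -->
    P (\bigcup_n [set w | t `^ nu * inv_scale nu A w < below x n.+1]).
  apply: nondecreasing_cvg_mu.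
  - by move=> n; exact: measurable_lt_inv_scale.
  - by apply: bigcupT_measurable => n; exact: measurable_lt_inv_scale.
  - by move=> n m nm; apply/subsetPset => w /= h; apply: lt_le_trans h _; exact: below_nd.
have E : P \o (fun n => [set w | t < A (below x n.+1) w]) =
    P \o (fun n => [set w | t `^ nu * inv_scale nu A w < below x n.+1]).
  apply/funext => n /=; apply: tail_stable => //.
  by rewrite subr_gt0 ltr_pdivrMr// ltr_pMr// ltr1n.
by rewrite E in c1; exact: cvg_unique c1 c2.
Qed.

Lemma integral_inverse_subordinator t (g : R -> R) : 0 < t ->
  measurable_fun setT g -> (forall x, 0 <= g x) ->
  (\int[P]_w (g (L t w))%:E = \int[P]_w (g (t `^ nu * inv_scale nu A w)%R)%:E)%E.
Proof.
move=> t0; apply: integral_eq_of_tails.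
- exact: measurable_inverse_subordinator.
- exact: measurable_inv_scale.
- by move=> x; exact: tail_inverse.
Qed.

(** If [L 0 > 0] then [A] vanishes at some [1/(n + 1)], which puts the outcome in a countable union
    of null events. *)
Lemma inverse_subordinator0_null : P [set w | L 0 w != 0] = 0%E.
Proof.
have mL : measurable [set w | L 0 w != 0].
  have := measurable_inverse_subordinator 0 measurableT (measurableC (measurable_set1 (0 : R))).
  by rewrite setTI; congr (_ (_ : set T)); apply/seteqP; split => w /= /eqP.
apply/eqP; rewrite eq_le measure_ge0 andbT.
have mZ n : measurable [set w | A (n.+1%:R^-1) w <= 0] by apply: measurable_le; rewrite invr_ge0.
apply: (@le_trans _ _ (P (\bigcup_n [set w | A (n.+1%:R^-1) w <= 0]))).
  apply: le_measure; rewrite ?inE//; first exact: bigcupT_measurable.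
  move=> w /= L0; have Lp : 0 < L 0 w by rewrite lt_def L0 inverse_subordinator_ge0.
  exists (Num.truncn (L 0 w)^-1) => //=; rewrite leNgt; apply/negP => Ap.
  have := inverse_subordinator_le (s := ((Num.truncn (L 0 w)^-1).+1)%:R^-1) _ Ap.
  rewrite invr_ge0 ler0n => /(_ isT); rewrite leNgt => /negP; apply.
  by rewrite -[ltRHS]invrK ltf_pV2 ?posrE ?invr_gt0// truncnS_gt.
apply: (@le_trans _ _ (\sum_(n <oo) P [set w | (A (n.+1%:R^-1) w <= 0)%R])%E).
  by apply: measure_sigma_subadditive => //; exact: bigcupT_measurable.
rewrite eseries0// => n _ _; rewrite -(stable_eq0_null nu_gt0 sA (s := n.+1%:R^-1)) ?invr_gt0//.
congr (P _); apply/seteqP; split => w /=.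
  by move=> h; apply/eqP; rewrite eq_le h (stable_ge0 sA)// invr_ge0.
by move=> ->.
Qed.

End inverse_law.

(** * Compound Poisson process at an independent time *)

Section convolution_power.
Variables (R : realType) (q : nat -> R).

(** The probability that [n] jumps add up to [k]. *)
Fixpoint conv_power (n k : nat) : R :=
  if n is n'.+1 then \sum_(1 <= i < k.+1) q i * conv_power n' (k - i)%N else (k == 0)%:R.

Lemma conv_power_eq0 n k : (k < n)%N -> conv_power n k = 0.
Proof.
elim: n k => // n IH k kn; rewrite /= big_nat big1// => i /andP[i1 ik].
by rewrite IH ?mulr0//; lia.
Qed.

Lemma conv_power_ge0 n k : (forall i, (1 <= i)%N -> 0 <= q i) -> 0 <= conv_power n k.
Proof.
move=> q0; elim: n k => [|n IH] k /=; first exact: ler0n.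
by rewrite big_nat; apply: sumr_ge0 => i /andP[i1 _]; apply: mulr_ge0 => //; exact: q0.
Qed.

(** Unfold one convolution and exchange the sums; [i] is the size of the jump split off, and the
    range of [n] shrinks because [n] jumps add up to at least [n]. *)
Lemma sum_conv_powerS k (f : nat -> R) :
  \sum_(n < k.+1) conv_power n k * (if n : nat is n'.+1 then f n' else 0) =
  \sum_(1 <= i < k.+1) q i * \sum_(n < (k - i).+1) conv_power n (k - i)%N * f n.
Proof.
rewrite big_ord_recl mulr0 add0r.
transitivity (\sum_(n < k) \sum_(1 <= i < k.+1) q i * (conv_power n (k - i)%N * f n)).
  by apply: eq_bigr => n _; rewrite /= mulr_suml; apply: eq_bigr => i _; rewrite mulrA.
rewrite exchange_big/= !big_nat; apply: eq_bigr => i /andP[i1 ik].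
rewrite -mulr_sumr; congr (_ * _).
have lek : ((k - i).+1 <= k)%N by lia.
rewrite (big_ord_widen _ (fun n => conv_power n (k - i)%N * f n) lek).
rewrite [RHS]big_mkcond/=; apply: eq_bigr => n _; case: ifPn => // h.
by rewrite conv_power_eq0 ?mul0r//; lia.
Qed.

End convolution_power.

Lemma nneseries_fin_support (R : realType) (f : nat -> \bar R) n :
  (forall k, 0 <= f k)%E -> (forall k, (n <= k)%N -> f k = 0%E) ->
  (\sum_(k <oo) f k = \sum_(k < n) f k)%E.
Proof.
move=> f0 fn; rewrite (nneseries_split 0 n)// add0n [X in (_ + X)%E]eseries0; last first.
  by move=> k nk _; exact: fn.
by rewrite adde0 big_mkord.
Qed.

Lemma measure_level_split d (T : measurableType d) (R : realType) (P : probability T R)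
    (F : set T) (Z : T -> nat) : measurable F -> (forall k, measurable [set w | Z w = k]) ->
  (P F = \sum_(k <oo) P (F `&` [set w | Z w = k]))%E.
Proof.
move=> mF mZ; have -> : P F = P (\bigcup_k (F `&` [set w | Z w = k])).
  by congr (P _); apply/seteqP; split => [w Fw|w [k _ []]//]; exists (Z w).
rewrite measure_semi_bigcup//.
- by move=> k; exact: measurableI.
- by move=> i j _ _ [w [[_ /= <-] [_ /= <-]]].
- by apply: bigcupT_measurable => k; exact: measurableI.
Qed.

(** Stated over any measurable type: with the given sigma-algebra it is ordinary measurability, with
    the one generated by the jumps it places the event in [sigma_family], where independence from
    [N] applies. *)
Lemma measurable_partial_sum d (T : measurableType d) (X : nat -> T -> nat) n k :
  (forall i, (1 <= i)%N -> forall B : set nat, measurable (X i @^-1` B)) ->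
  measurable [set w | (\sum_(1 <= i < n.+1) X i w)%N = k].
Proof.
move=> mX; elim: n k => [|n IH] k.
  have [->|k0] := eqVneq k 0%N.
    by rewrite (_ : [set _ | _] = setT)//; apply/seteqP; split => // w _ /=; rewrite big_nil.
  rewrite (_ : [set _ | _] = set0)//; apply/seteqP; split => // w /=.
  by rewrite big_nil => /esym/eqP; rewrite (negbTE k0).
rewrite (_ : [set _ | _] = \bigcup_j ([set w | (\sum_(1 <= i < n.+1) X i w)%N = j] `&`
    X n.+1 @^-1` [set j' | (j + j' = k)%N])).
  by apply: bigcupT_measurable => j; apply: measurableI; [exact: IH|exact: mX].
apply/seteqP; split => w /=; rewrite big_nat_recr//=.
  by move=> h; exists (\sum_(1 <= i < n.+1) X i w)%N.
by move=> [j _ [/= <-]].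
Qed.

Section subordination.
Context d (T : measurableType d) (R : realType) (P : probability T R).
Variables (lambda : R) (q : nat -> R) (N : R -> T -> nat) (X : nat -> {RV P >-> nat}).
Hypotheses (lambda_gt0 : 0 < lambda) (q_pmf : positive_pmf q)
  (N_poisson : poisson_process P lambda N)
  (X_indep : mutually_independent P [set n : nat | (1 <= n)%N] X)
  (X_law : forall n k : nat, (1 <= n)%N -> (1 <= k)%N -> P (X n @^-1` [set k]) = (q k)%:E)
  (N_X_indep : independent_systems P (sigma_family nonneg_times N)
    (sigma_family [set n : nat | (1 <= n)%N] X)).
Implicit Types (n k : nat) (s : R) (w : T).

Let S n w : nat := (\sum_(1 <= i < n.+1) X i w)%N.

Let SS n w : S n.+1 w = (S n w + X n.+1 w)%N.
Proof. by rewrite /S big_nat_recr. Qed.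

Let measurable_X n (B : set nat) : measurable (X n @^-1` B).
Proof. by rewrite -[X in measurable X]setTI; apply: measurable_funP. Qed.

Let measurable_S n k : measurable [set w | S n w = k].
Proof. by apply: measurable_partial_sum => i _ B; exact: measurable_X. Qed.

(** The masses at positive integers already add up to 1. *)
Let X_neq0 n : (1 <= n)%N -> P (X n @^-1` [set 0%N]) = 0%E.
Proof.
move=> n1; have [q0 q1] := q_pmf.
have mk k : measurable [set w | X n w = k] by exact: (measurable_X n [set k]).
have := measure_level_split P measurableT mk; rewrite probability_setT.
under eq_eseriesr do rewrite setTI.
rewrite (nneseries_split 0 1)// add0n big_nat1.
have -> : (\sum_(1 <= k <oo) P [set w | X n w = k] = 1)%E.
  rewrite -q1; apply/congr_lim/funext => m; rewrite !big_nat.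
  by apply: eq_bigr => k /andP[k1 _]; exact: X_law.
have := fin_num_measure P _ (mk 0%N).
rewrite -[X n @^-1` _]/[set w | X n w = 0%N].
case: (P _) => [r||]// _ [] h; congr EFin; move: h; lra.
Qed.

(** The events on later jumps are carried along to make the induction work: splitting by the value
    of [X n.+1] moves that jump from the partial sum to [J]. *)
Let S_indep n (J : {fset nat}) (B : nat -> set nat) k :
  (forall j, j \in J -> (n < j)%N) ->
  P ([set w | S n w = k] `&` \bigcap_(j in [set` J]) X j @^-1` B j) =
  ((conv_power q n k)%:E * \prod_(j <- J) P (X j @^-1` B j))%E.
Proof.
elim: n J B k => [|n IH] J B k nJ.
  have J1 : [set` J] `<=` [set n : nat | (1 <= n)%N] by move=> j /= /nJ.
  have [->|k0] := eqVneq k 0%N.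
    rewrite mul1e -(X_indep J1)//; congr (P _); apply/seteqP; split => w; first by case.
    by move=> h; split => //=; rewrite /S big_nil.
  rewrite /= (negbTE k0) mul0e (_ : _ `&` _ = set0) ?measure0//.
  by apply/seteqP; split => // w [/=]; rewrite /S big_nil => /esym/eqP; rewrite (negbTE k0).
have mX i : measurable [set w | X n.+1 w = i] by exact: (measurable_X n.+1 [set i]).
have mJ : measurable (\bigcap_(j in [set` J]) X j @^-1` B j).
  by apply: bigcap_measurableType => j _; exact: measurable_X.
rewrite (measure_level_split P _ mX); last by apply: measurableI => //; exact: measurable_S.
set pJ := (\prod_(j <- J) _)%E.
have nJn : n.+1 \notin J by apply/negP => /nJ; rewrite ltnn.
have E i : P ([set w | S n.+1 w = k] `&` \bigcap_(j in [set` J]) X j @^-1` B j `&`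
    [set w | X n.+1 w = i]) =
    if (i <= k)%N then ((conv_power q n (k - i))%:E * (P (X n.+1 @^-1` [set i]) * pJ))%E else 0%E.
  case: ifPn => ik; last first.
    rewrite (_ : _ `&` _ = set0) ?measure0//; apply/seteqP; split => // w [[/= + _] Xi].
    by rewrite SS Xi => h; move: ik; rewrite -h leq_addl.
  pose B' j := if j == n.+1 then [set i] else B j.
  have -> : (P (X n.+1 @^-1` [set i]) * pJ = \prod_(j <- (n.+1 |` J)%fset) P (X j @^-1` B' j))%E.
    rewrite big_fsetU1//= /B' eqxx; congr (_ * _)%E; rewrite /pJ big_seq [RHS]big_seq.
    apply: eq_bigr => j jJ; case: eqP => // jn.
    by move: nJn; rewrite -jn jJ.
  rewrite -IH; last by move=> j; rewrite in_fset1U => /orP[/eqP->|/nJ /ltnW].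
  congr (P _); apply/seteqP; split => w /=.
    move=> [[Sk BJ] Xi]; split; first by move: Sk; rewrite SS Xi => <-; rewrite addnK.
    move=> j /=; rewrite in_fset1U /B'; case: eqP => [->//|_ /= jJ].
    exact: BJ.
  move=> [Sk BJ]; have Xi : X n.+1 w = i.
    by have := BJ n.+1; rewrite /= in_fset1U eqxx /B' eqxx; apply.
  split => //; split; first by rewrite SS Xi Sk subnK.
  move=> j /= jJ; have := BJ j; rewrite /= in_fset1U jJ orbT /B' => /(_ isT).
  by case: eqP => // jn; move: nJn; rewrite -jn jJ.
rewrite (nneseries_fin_support (n := k.+1)) => [||i ki]; last 2 first.
- by move=> i; exact: measure_ge0.
- by rewrite E leqNgt ki.
(* The value 0 has probability 0, which leaves the range [1 <= i <= k] of the recursion of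
   [conv_power]. *)
rewrite big_ord_recl E leq0n X_neq0// mul0e mule0 add0e.
rewrite -(big_mkord xpredT (fun i => P (_ `&` _ `&` [set w | X n.+1 w = i.+1]))).
rewrite /= big_add1/= -sumEFin big_nat [in RHS]big_nat ge0_sume_distrl; last first.
  move=> i /andP[i1 ik]; rewrite lee_fin; apply: mulr_ge0; first by case: q_pmf => q0 _; exact: q0.
  by apply: conv_power_ge0; case: q_pmf.
apply: eq_bigr => i /andP[_ ik]; rewrite E ik X_law// EFinM.
by rewrite muleCA muleA.
Qed.

Let S_law n k : P [set w | S n w = k] = (conv_power q n k)%:E.
Proof.
have := @S_indep n fset0 (fun=> setT) k; rewrite big_nil mule1 => <- //.
by congr (P _); rewrite -[LHS]setIT; congr (_ `&` _); apply/seteqP; split => // w _ j /=; rewrite in_fset0.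
Qed.

Let sigma_S n k : sigma_family [set n : nat | (1 <= n)%N] X [set w | S n w = k].
Proof.
pose G := \bigcup_(i in [set n : nat | (1 <= n)%N]) preimage_set_system setT (X i) measurable.
apply: (@measurable_partial_sum _ (g_sigma_algebraType G) X n k) => i i1 B.
by apply: sub_sigma_algebra; exists i => //; exists B => //; rewrite setTI.
Qed.

Let sigma_N s n : 0 <= s -> sigma_family nonneg_times N [set w | N s w = n].
Proof.
move=> s0; apply: sub_sigma_algebra; exists s => //; exists [set n] => //.
by rewrite setTI.
Qed.

Let measurable_N s n : 0 <= s -> measurable [set w | N s w = n].
Proof.
move=> s0; have := levy_measurable (poisson_levy N_poisson) s0 measurableT (measurable_set1 (n%:R : R)).
by rewrite setTI; congr (_ (_ : set T)); apply/seteqP; split => w /= => [/eqP|->//]; rewrite eqr_nat => /eqP.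
Qed.

Variables (C : set_system T) (tau : T -> R).
Hypotheses (C_indep : independent_systems P C
    (sigma_join (sigma_family nonneg_times N) (sigma_family [set n : nat | (1 <= n)%N] X)))
  (tau_ge0 : forall w, 0 <= tau w) (mtau : measurable_fun setT tau)
  (Ctau : forall B, measurable B -> C (tau @^-1` B)).

Let step n k s := [set w | N s w = n] `&` [set w | S n w = k].

Let join_step n k s (B : set R) : 0 < s -> measurable B ->
  P (tau @^-1` B `&` step n k s) =
  (P (tau @^-1` B) * (conv_power q n k * pois lambda n s)%:E)%E.
Proof.
move=> s0 mB; rewrite C_indep.
- congr (_ * _)%E; rewrite /step N_X_indep.
  + rewrite S_law mulrC EFinM; congr (_ * _)%E.
    by rewrite (poisson_law N_poisson s0) /poisson_pmf mulr_gt0// /pois.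
  + by apply: sigma_N; exact: ltW.
  + exact: sigma_S.
- exact: Ctau.
- rewrite /step /sigma_join.
  pose G := sigma_family nonneg_times N `|` sigma_family [set n : nat | (1 <= n)%N] X.
  apply: (@measurableI _ (g_sigma_algebraType G)); apply: sub_sigma_algebra.
    by left; apply: sigma_N; exact: ltW.
  by right; exact: sigma_S.
Qed.

(* Approximating [tau] from above by variables with countably many values lets
   the independence be used at deterministic times, and right continuity of [N]
   gives the limit. *)
Let grid m w := Num.truncn (m.+1%:R * tau w).
Let approx m w : R := (grid m w).+1%:R / m.+1%:R.

(** Strictness serves twice: right limits are taken along sequences strictly above the point, and
    the Poisson law is given at positive times only. *)
Let approx_gt m w : tau w < approx m w.
Proof. by rewrite /approx ltr_pdivlMr// mulrC; exact: truncnS_gt. Qed.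

Let approx_cvg w : approx m w @[m --> \oo] --> tau w.
Proof.
apply: (@squeeze_cvgr _ _ _ _ (cst (tau w)) (fun m => tau w + m.+1%:R^-1)).
- apply: nearW => m; rewrite (ltW (approx_gt m w))/= /approx ler_pdivrMr// mulrDl mulVf//.
  by rewrite -natr1 lerD2r mulrC truncn_le mulr_ge0.
- exact: cvg_cst.
- by rewrite -[X in _ --> X]addr0; apply: cvgD; [exact: cvg_cst|exact: cvg_harmonic].
Qed.

(** Integers at distance less than 1 are equal, so right continuity makes the values eventually
    constant. *)
Let N_approx w : \forall m \near \oo, N (approx m w) w = N (tau w) w.
Proof.
have /cvg_at_rightP := levy_right_continuous (poisson_levy N_poisson) (w := w) (tau_ge0 w).
move=> /(_ (approx^~ w) (conj (fun m => approx_gt m w) (@approx_cvg w))).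
move=> /cvgr_dist_lt/(_ 1 ltr01); apply: filterS => m.
rewrite ltr_norml => /andP[h1 h2].
have [ab|ab|//] := ltngtP (N (approx m w) w) (N (tau w) w).
- by exfalso; have : (N (approx m w) w)%:R + 1 <= (N (tau w) w)%:R :> R; [rewrite natr1 ler_nat|lra].
- by exfalso; have : (N (tau w) w)%:R + 1 <= (N (approx m w) w)%:R :> R; [rewrite natr1 ler_nat|lra].
Qed.

Let cell m j := `[j%:R / m.+1%:R, j.+1%:R / m.+1%:R[%classic : set R.

Let gridE m j : [set w | grid m w = j] = tau @^-1` cell m j.
Proof.
apply/seteqP; split => w; rewrite /cell /= in_itv/= ler_pdivrMr// ltr_pdivlMr//.
  by move=> <-; rewrite mulrC truncn_itv// mulr_ge0.
by move=> h; apply: truncn_def; rewrite mulrC.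
Qed.

Let measurable_grid m j : measurable [set w | grid m w = j].
Proof. by rewrite gridE -[X in measurable X]setTI; apply: mtau => //; exact: measurable_itv. Qed.

Let level m n k := [set w | N (approx m w) w = n] `&` [set w | S n w = k].
Let level_lim n k := [set w | N (tau w) w = n] `&` [set w | S n w = k].

Let measurable_N_approx m n : measurable [set w | N (approx m w) w = n].
Proof.
rewrite (_ : [set _ | _] = \bigcup_j ([set w | grid m w = j] `&`
    [set w | N (j.+1%:R / m.+1%:R) w = n])).
  apply: bigcupT_measurable => j; apply: measurableI; first exact: measurable_grid.
  by apply: measurable_N; rewrite divr_ge0.
apply/seteqP; split => w /=; first by move=> h; exists (grid m w).
by move=> [j _ [/= <-]].
Qed.

Let measurable_N_tau n : measurable [set w | N (tau w) w = n].
Proof.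
rewrite (_ : [set _ | _] = \bigcup_i \bigcap_m [set w | N (approx (i + m) w) w = n]).
  by apply: bigcupT_measurable => i; apply: bigcapT_measurable => m; exact: measurable_N_approx.
apply/seteqP; split => w /=; have [i _ Ni] := N_approx w.
  by move=> <-; exists i => // m _ /=; apply: Ni => /=; exact: leq_addr.
move=> [j _ Nj]; rewrite -(Ni (j + i)%N) /=; last exact: leq_addl.
exact: Nj.
Qed.

Let measurable_pois_of (Y : T -> R) n : measurable_fun setT Y ->
  measurable_fun setT (fun w => (pois lambda n (Y w))%:E).
Proof. by move=> mY; apply/measurable_EFinP; apply: measurableT_comp => //; exact: measurable_pois. Qed.

Let measurable_approx m : measurable_fun setT (approx m).
Proof.
apply: measurable_funM => //.
move=> _ B mB; rewrite setTI.
rewrite (_ : _ @^-1` _ = \bigcup_(j in [set j : nat | B j.+1%:R]) [set w | grid m w = j]).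
  by apply: bigcup_measurable => j _; exact: measurable_grid.
by apply/seteqP; split => w /=; [move=> h; exists (grid m w)|move=> [j /= Bj ->]].
Qed.

Let approx_gt0 m w : 0 < approx m w.
Proof. exact: le_lt_trans (tau_ge0 w) (approx_gt m w). Qed.

(** On each cell of the grid [approx m] is constant, so [join_step] applies at a deterministic time;
    the cells are then summed. *)
Let P_level m n k :
  P (level m n k) = ((conv_power q n k)%:E * \int[P]_w (pois lambda n (approx m w))%:E)%E.
Proof.
have q0 : forall i, (1 <= i)%N -> 0 <= q i by case: q_pmf.
rewrite (measure_level_split P _ (measurable_grid m)); last first.
  by apply: measurableI; [exact: measurable_N_approx|exact: measurable_S].
have -> : (\int[P]_w (pois lambda n (approx m w))%:E =
    \sum_(j <oo) \int[P]_(w in [set w | grid m w = j]) (pois lambda n (approx m w))%:E)%E.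
  have UT : \bigcup_j [set w | grid m w = j] = setT.
    by rewrite -subTset => w _; exists (grid m w).
  rewrite -[in LHS]UT ge0_integral_bigcup ?UT//.
  - exact: measurable_pois_of.
  - by move=> w _; rewrite lee_fin pois_ge0// ltW.
  - by move=> i j _ _ [w [/= <- <-]].
rewrite -nneseriesZl; last first.
  by move=> j _; apply: integral_ge0 => w _; rewrite lee_fin pois_ge0// ltW.
apply: eq_eseriesr => j _.
have -> : (\int[P]_(w in [set w | grid m w = j]) (pois lambda n (approx m w))%:E =
    (pois lambda n (j.+1%:R / m.+1%:R))%:E * P [set w | grid m w = j])%E.
  rewrite -integral_cst//; apply: eq_integral => w; rewrite inE /= => gw.
  by rewrite /approx gw.
have -> : level m n k `&` [set w | grid m w = j] =
    tau @^-1` cell m j `&` step n k (j.+1%:R / m.+1%:R).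
  rewrite -gridE; apply/seteqP; split => w /=.
    by move=> [[Nw Sw] gw]; split => //; split => //=; rewrite -Nw /approx gw.
  by move=> [gw [Nw Sw]]; split => //; split => //=; rewrite /approx gw.
rewrite join_step; [|by rewrite divr_gt0|exact: measurable_itv].
by rewrite -gridE EFinM muleC -muleA.
Qed.

(** Dominated convergence on both sides of [P_level]: the events stabilise at each outcome, and the
    Poisson weights are continuous and bounded by 1. *)
Let P_level_lim n k :
  P (level_lim n k) = ((conv_power q n k)%:E * \int[P]_w (pois lambda n (tau w))%:E)%E.
Proof.
have mlevel m : measurable (level m n k).
  by apply: measurableI; [exact: measurable_N_approx|exact: measurable_S].
have mlim : measurable (level_lim n k).
  by apply: measurableI; [exact: measurable_N_tau|exact: measurable_S].
have i1 : P.-integrable setT (cst 1%E) by exact: finite_measure_integrable_cst.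
have C1 : P (level m n k) @[m --> \oo] --> P (level_lim n k).
  pose f m w := (\1_(level m n k) w)%:E : \bar R.
  have mf m : measurable_fun setT (f m).
    by apply/measurable_EFinP; apply: measurable_indic; exact: mlevel.
  have mflim : measurable_fun setT (fun w => (\1_(level_lim n k) w)%:E : \bar R).
    by apply/measurable_EFinP; apply: measurable_indic; exact: mlim.
  have [||_ _] := @dominated_convergence _ _ _ P _ measurableT f _ (cst 1%E) mf mflim _ i1 _.
  - apply: aeW => w _; apply: cvg_near_cst; have := N_approx w; apply: filterS => m Nw.
    by rewrite /f !indicE; congr ((nat_of_bool _)%:R%:E); apply/idP/idP; rewrite !inE /level /level_lim /= Nw.
  - by apply: aeW => w m _; rewrite /f /= ger0_norm ?indicE// lee_fin lern1; case: (_ \in _).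
  rewrite integral_indic// setIT; apply: cvg_trans; apply: near_eq_cvg; apply: nearW => m.
  by rewrite /f/= integral_indic// setIT.
have C2 : (\int[P]_w (pois lambda n (approx m w))%:E)%E @[m --> \oo] -->
    (\int[P]_w (pois lambda n (tau w))%:E)%E.
  have [] := @dominated_convergence _ _ _ P _ measurableT
    (fun m w => (pois lambda n (approx m w))%:E) (fun w => (pois lambda n (tau w))%:E) (cst 1%E)
    (fun m => measurable_pois_of n (measurable_approx m)) (measurable_pois_of n mtau) _ i1 _ => //.
  - apply: aeW => w _; apply: cvg_EFin; first exact: nearW.
    by apply: continuous_cvg; [exact: continuous_pois|exact: approx_cvg].
  - apply: aeW => w m _ /=; rewrite lee_fin ger0_norm ?pois_le1 ?pois_ge0//; exact: ltW.
have C3 := cvgeZl (y := (conv_power q n k)%:E) isT C2.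
have E : (fun m => P (level m n k)) =
    (fun m => (conv_power q n k)%:E * \int[P]_w (pois lambda n (approx m w))%:E)%E.
  by apply/funext => m; exact: P_level.
by rewrite E in C1; exact: cvg_unique C1 C3.
Qed.

(** Splitting by the number of jumps leaves a finite sum: more than [k] jumps cannot add up to
    [k]. *)
Lemma state_prob_subordinated k :
  fine (P [set w | compound_process N X (tau w) w = k]) =
  \sum_(n < k.+1) conv_power q n k * \int[P]_w pois lambda n (tau w).
Proof.
have E : (P [set w | compound_process N X (tau w) w = k] =
  \sum_(n < k.+1) (conv_power q n k)%:E * \int[P]_w (pois lambda n (tau w))%:E)%E.
  have LE n : [set w | compound_process N X (tau w) w = k] `&` [set w | N (tau w) w = n] =
      level_lim n k.
    by apply/seteqP; split => w /= [h1 h2]; split => //=; [rewrite -h2|rewrite /compound_process h1].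
  rewrite (measure_level_split P _ measurable_N_tau); last first.
    rewrite (_ : [set _ | _] = \bigcup_n level_lim n k).
      by apply: bigcupT_measurable => n; apply: measurableI; [exact: measurable_N_tau|exact: measurable_S].
    by apply/seteqP; split => w /=; [move=> h; exists (N (tau w) w)|move=> [n _ [/= <-]]].
  under eq_eseriesr do rewrite LE P_level_lim.
  rewrite (nneseries_fin_support (n := k.+1)) => [//|n|n kn].
    by rewrite -P_level_lim measure_ge0.
  by rewrite conv_power_eq0 ?mul0e.
have fp n : (\int[P]_w (pois lambda n (tau w))%:E)%E \is a fin_num.
  apply: (@integrable_fin_num _ _ _ P) => //; apply: (@le_integrable _ _ _ P _ measurableT _ (cst 1%E)).
  - exact: measurable_pois_of.
  - by move=> w _ /=; rewrite lee_fin normr1 ger0_norm ?pois_le1 ?pois_ge0.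
  - exact: finite_measure_integrable_cst.
rewrite E -[RHS]/(fine (_%:E)) -sumEFin; congr fine; apply: eq_bigr => n _.
by rewrite EFinM /Rintegral fineK.
Qed.

End subordination.

(** * Assembly of the two systems of equations *)

Lemma sum_conv_power_balance (R : realType) (q f : nat -> R) l k :
  l * \sum_(n < k.+1) conv_power q n k * ((if n : nat is n'.+1 then f n' else 0) - f n) =
  - l * (\sum_(n < k.+1) conv_power q n k * f n) +
  l * \sum_(1 <= i < k.+1) q i * \sum_(n < (k - i).+1) conv_power q n (k - i)%N * f n.
Proof.
rewrite -sum_conv_powerS mulNr -mulrN -mulrDr; congr (_ * _).
by rewrite addrC -sumrB; apply: eq_bigr => n _; rewrite mulrBr.
Qed.

Lemma sum_conv_power0 (R : realType) (q : nat -> R) k :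
  \sum_(n < k.+1) conv_power q n k * (n == 0%N :> nat)%:R = (k == 0%N)%:R.
Proof.
rewrite big_ord_recl/= mulr1 big1 ?addr0// => n _.
by rewrite mulr0.
Qed.

Lemma probability_Rintegral_cst d (T : measurableType d) (R : realType) (P : probability T R) (r : R) :
  \int[P]_w r = r.
Proof. by rewrite -[RHS]/(fine r%:E) -(expectation_cst P r) unlock. Qed.

Section inverse_pois.
Context d (T : measurableType d) (R : realType) (P : probability T R).
Variables (l nu : R) (A : R -> T -> R).
Hypotheses (l_gt0 : 0 < l) (nu01 : 0 < nu < 1) (sA : stable_subordinator P nu A).

Lemma scaled_pois_inverse n t : 0 < t ->
  \int[P]_w pois l n (inverse_subordinator A t w) = scaled_pois P l nu (inv_scale nu A) n t.
Proof.
move=> t0; rewrite /scaled_pois /Rintegral; congr fine.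
have mg : measurable_fun setT (fun x : R => pois l n `|x|).
  by apply: measurableT_comp; [exact: measurable_pois|apply: continuous_measurable_fun; exact: norm_continuous].
have g0 (x : R) : 0 <= pois l n `|x| by apply: pois_ge0.
transitivity (\int[P]_w (pois l n `|inverse_subordinator A t w|)%:E)%E.
  by apply: eq_integral => w _; rewrite ger0_norm ?inverse_subordinator_ge0.
rewrite (integral_inverse_subordinator nu01 sA t0 mg g0).
by apply: eq_integral => w _; rewrite ger0_norm// mulr_ge0 ?powR_ge0.
Qed.

(** A path that stays at 0 for a while has a positive inverse at time 0; such paths form a null
    event, off which the integrand is constant. *)
Lemma integral_pois_inverse0 n :
  \int[P]_w pois l n (inverse_subordinator A 0 w) = (n == 0%N)%:R.
Proof.
rewrite -(pois0 l n) /Rintegral (ae_eq_integral (cst (pois l n 0)%:E))//.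
- exact: probability_Rintegral_cst.
- apply/measurable_EFinP; apply: measurableT_comp; first exact: measurable_pois.
  exact: (measurable_inverse_subordinator sA 0).
- exists [set w | inverse_subordinator A 0 w != 0]; split.
  + have := measurable_inverse_subordinator sA 0 measurableT (measurableC (measurable_set1 (0 : R))).
    by rewrite setTI; congr (_ (_ : set T)); apply/seteqP; split => w /= /eqP.
  + exact: (inverse_subordinator0_null nu01 sA).
  + by move=> w /= h; apply/eqP => L0; apply: h => _; rewrite L0.
Qed.

End inverse_pois.

Theorem proposition3p1 (R : realType) (d : measure_display)
    (T : measurableType d) (P : probability T R)
    (lambda : R) (lambda_gt0 : 0 < lambda)
    (q : nat -> R) (q_pmf : positive_pmf q)
    (N : R -> T -> nat) (N_poisson : poisson_process P lambda N)
    (X : nat -> {RV P >-> nat})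
    (X_indep : mutually_independent P [set n : nat | (1 <= n)%N] X)
    (X_law : forall n k : nat, (1 <= n)%N -> (1 <= k)%N ->
      P (X n @^-1` [set k]) = (q k)%:E)
    (N_X_indep : independent_systems P (sigma_family nonneg_times N)
      (sigma_family [set n : nat | (1 <= n)%N] X)) :
  (forall (nu : R) (A : R -> T -> R), 0 < nu < 1 ->
    stable_subordinator P nu A ->
    independent_systems P
      (sigma_family nonneg_times (inverse_subordinator A))
      (sigma_join (sigma_family nonneg_times N)
        (sigma_family [set n : nat | (1 <= n)%N] X)) ->
    let M_nu t w := compound_process N X (inverse_subordinator A t w) w in
    let p := state_prob P M_nu in
    [/\ forall t : R, 0 < t ->
          is_caputo_derive nu (p 0%N) t (- lambda * p 0%N t),
        forall (k : nat) (t : R), (1 <= k)%N -> 0 < t ->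
          is_caputo_derive nu (p k) t
            (- lambda * p k t +
             lambda * \sum_(1 <= i < k.+1) q i * p (k - i)%N t),
        p 0%N 0 = 1 &
        forall k : nat, (1 <= k)%N -> p k 0 = 0])
  /\
  (forall (nu : R) (A : R -> T -> R), 1 < nu ->
    stable_subordinator P (1 / nu) A ->
    independent_systems P
      (sigma_family nonneg_times A)
      (sigma_join (sigma_family nonneg_times N)
        (sigma_family [set n : nat | (1 <= n)%N] X)) ->
    let M_nu t w := compound_process N X (A t w) w in
    let p := state_prob P M_nu in
    [/\ forall t : R, 0 < t ->
          is_rl_derive nu (p 0%N) t (lambda * p 0%N t),
        forall (k : nat) (t : R), (1 <= k)%N -> 0 < t ->
          is_rl_derive nu (p k) t
            (lambda * p k t -
             lambda * \sum_(1 <= i < k.+1) q i * p (k - i)%N t),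
        p 0%N 0 = 1 &
        forall k : nat, (1 <= k)%N -> p k 0 = 0]).
Proof.
have pE (C : set_system T) (tau : T -> R) k :
    independent_systems P C (sigma_join (sigma_family nonneg_times N)
      (sigma_family [set n : nat | (1 <= n)%N] X)) ->
    (forall w, 0 <= tau w) -> measurable_fun setT tau ->
    (forall B, measurable B -> C (tau @^-1` B)) ->
    fine (P [set w | compound_process N X (tau w) w = k]) =
    \sum_(n < k.+1) conv_power q n k * \int[P]_w pois lambda n (tau w).
  move=> iC t0 mt Ct.
  exact: (state_prob_subordinated lambda_gt0 q_pmf N_poisson X_indep X_law N_X_indep iC t0 mt Ct).
split=> nu A.
- move=> nu01 sA C_indep M_nu p.
  have pLE k s : 0 <= s -> p k s = \sum_(n < k.+1) conv_power q n k *
      \int[P]_w pois lambda n (inverse_subordinator A s w).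
    move=> s0; apply: (pE _ _ k C_indep).
    + by move=> w; exact: inverse_subordinator_ge0.
    + exact: (measurable_inverse_subordinator sA).
    + move=> B mB; apply: sub_sigma_algebra; exists s => //.
      by exists B => //; rewrite setTI.
  pose f n s := scaled_pois P lambda nu (inv_scale nu A) n s.
  have pfE k s : 0 < s -> p k s = \sum_(n < k.+1) conv_power q n k * f n s.
    move=> s0; rewrite pLE ?(ltW s0)//; apply: eq_bigr => n _.
    by rewrite (scaled_pois_inverse _ nu01 sA).
  (* Stated for every [k]: at [k = 0] the sum is empty and the first equation results. *)
  have D k t : 0 < t -> is_caputo_derive nu (p k) t
      (- lambda * p k t + lambda * \sum_(1 <= i < k.+1) q i * p (k - i)%N t).
    move=> t0; have -> : - lambda * p k t + lambda * \sum_(1 <= i < k.+1) q i * p (k - i)%N t =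
        lambda * \sum_(n < k.+1) conv_power q n k *
          (scaled_pois_pred P lambda nu (inv_scale nu A) n t - f n t).
      rewrite [RHS](sum_conv_power_balance q (f^~ t)) pfE//; congr (_ + _ * _).
      by apply: eq_bigr => i _; rewrite pfE.
    apply: (is_caputo_derive_mixture (W := inv_scale nu A) (K := k.+1)
      (c := fun n => conv_power q n k) lambda_gt0 nu01 _ _ _ _ (pfE k) t0).
    + apply: (measurableT_comp (measurable_powR _)); exact: (stable_measurable sA ler01).
    + by move=> w; exact: powR_ge0.
    + exact: integrable_inv_scale.
    + by move=> s g s0 cg g0; exact: kernel_identity.
  have p0E k : p k 0 = (k == 0%N)%:R.
    rewrite pLE// -(sum_conv_power0 q); apply: eq_bigr => n _.
    by rewrite (integral_pois_inverse0 _ nu01 sA).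
  split => [t t0|k t _ t0||k k1].
  + by have := D 0%N t t0; rewrite big_geq// mulr0 addr0.
  + exact: D.
  + by rewrite p0E.
  + by rewrite p0E gtn_eqF.
- move=> nu_gt1 sA C_indep M_nu p.
  have pLE k s : 0 <= s -> p k s = \sum_(n < k.+1) conv_power q n k * mixed_pois P lambda A n s.
    move=> s0; apply: (pE _ _ k C_indep).
    + by move=> w; exact: (stable_ge0 sA).
    + exact: (stable_measurable sA).
    + move=> B mB; apply: sub_sigma_algebra; exists s => //.
      by exists B => //; rewrite setTI.
  have D k t : 0 < t -> is_rl_derive nu (p k) t
      (lambda * p k t - lambda * \sum_(1 <= i < k.+1) q i * p (k - i)%N t).
    move=> t0; have -> : lambda * p k t - lambda * \sum_(1 <= i < k.+1) q i * p (k - i)%N t =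
        lambda * \sum_(n < k.+1) conv_power q n k *
          (mixed_pois P lambda A n t - mixed_pois_pred P lambda A n t).
      (* The coefficients are here [f_n - f_(n-1)], the opposite of those in the Caputo case, so the
         common balance identity applies after a change of sign. *)
      apply: oppr_inj; rewrite opprD opprK -mulNr -mulrN -sumrN.
      under [in RHS]eq_bigr do rewrite -mulrN opprB.
      rewrite [RHS](sum_conv_power_balance q (fun n => mixed_pois P lambda A n t)).
      rewrite pLE ?(ltW t0)//; congr (_ + _ * _).
      by apply: eq_bigr => i _; rewrite pLE ?(ltW t0).
    apply: (is_rl_derive_mixture (K := k.+1) (w := fun n => conv_power q n k)
      lambda_gt0 nu_gt1 sA _ t0) => s s0.
    exact: (pLE k s (ltW s0)).
  have p0E k : p k 0 = (k == 0%N)%:R.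
    rewrite pLE// -(sum_conv_power0 q); apply: eq_bigr => n _; congr (_ * _).
    (* [A 0] vanishes at every outcome, so no null event has to be removed. *)
    rewrite /mixed_pois (_ : (fun w => pois lambda n (A 0 w)) = cst (n == 0%N :> nat)%:R).
      exact: probability_Rintegral_cst.
    by apply/funext => w; rewrite (levy_start (stable_levy sA)) pois0.
  split => [t t0|k t _ t0||k k1].
  + by have := D 0%N t t0; rewrite big_geq// mulr0 subr0.
  + exact: D.
  + by rewrite p0E.
  + by rewrite p0E gtn_eqF.
Qed.
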